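(* Let $\Omega\subset\mathbb{R}^2$ be a bounded domain, and let $\mathcal{A}(x,z)$ be a nonnegative semidefinite matrix in $\Omega\times\mathbb{R}$ satisfying, for some positive constants $c_0,C_0$, $$c_0\,\xi^{T}A\xi\le\xi^{T}\mathcal{A}(\cdot,z)\xi\le C_0\,\xi^{T}A\xi\quad\text{a.e. in }\Omega,\ \text{for all }z\in\mathbb{R},\ \xi\in\mathbb{R}^2,\qquad A(x)=\begin{bmatrix}1&0\\0&f(x)^2\end{bmatrix},$$ where $A$ depends only on the first coordinate $x$ and $f=f_{k,\sigma}$. Let $u$ be a weak subsolution of $\nabla^{\mathrm{tr}}\mathcal{A}(\cdot,u)\nabla u=\phi$ in $\Omega$. Then $$\operatorname*{ess\,sup}_{\Omega}u\le\sup_{\partial\Omega}u+C\|\phi\|_{X(\Omega)}$$ provided that: (1) $\phi$ is $A$-admissible for $\Omega$; and (2) at least one of the following holds: (a) $k\ge1$ and $0<\sigma<1$; (b) $k\ge2$ and $\sigma>0$.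
   Context: For $k\in\mathbb{N}$, $\sigma>0$: $f_{k,\sigma}(r)=e^{-\left(\ln\frac1r\right)\left(\ln^{(k)}\frac1r\right)^\sigma}$ for small $r>0$, with $\ln^{(k)}$ the $k$-fold iterated logarithm; $f$ is even with $f(0)=0$, equals $f_{k,\sigma}(|x|)$ for small $|x|$, and is positive and nondegenerate away from $x=0$ (twice continuously differentiable, $f'(x)>0$ for $x>0$). $\nabla_Av=\left(\frac{\partial v}{\partial x},f(x)\frac{\partial v}{\partial y}\right)$. $W_A^{1,2}(\Omega)$ has norm $\left(\int_\Omega|v|^2+|\nabla_Av|^2\right)^{1/2}$ and $(W_A^{1,2})_0(\Omega)$ is the closure of the Lipschitz functions with compact support in $\Omega$; $(W_A^{1,1})_0(\Omega)$ is defined analogously with $\int|v|+|\nabla_Av|$. It is assumed $\phi\in L^2_{\mathrm{loc}}(\Omega)$. $u\in W_A^{1,2}(\Omega)$ is a weak subsolution if $-\int_\Omega\nabla w^{\mathrm{tr}}\mathcal{A}(\cdot,u)\nabla u\ge\int_\Omega\phi w$ for all nonnegative $w\in(W_A^{1,2})_0(\Omega)$. $\sup_{\partial\Omega}u\equiv\inf\{\ell\in\mathbb{R}:(u-\ell)^+\in(W_A^{1,2})_0(\Omega)\}$. $\phi$ is $A$-admissible for $\Omega$ if $\|\phi\|_{X(\Omega)}\equiv\sup_{v\in(W_A^{1,1})_0(\Omega)}\dfrac{\int_\Omega|v\phi|}{\int_\Omega|\nabla_Av|}<\infty$. $C$ is a constant independent of $u$ and $\phi$. *)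

(* Defs.v *)
From HB Require Import structures.
From mathcomp Require Import all_boot all_order all_algebra.
From mathcomp Require Import all_classical all_reals all_analysis.
From mathcomp Require Import ess_sup_inf.
Set Implicit Arguments.
Unset Strict Implicit.
Unset Printing Implicit Defensive.
Import Order.TTheory GRing.Theory Num.Theory.
Import numFieldNormedType.Exports.
Local Open Scope classical_set_scope.
Local Open Scope ring_scope.

(* A point of the plane is z = (z.1, z.2) : R * R, a vector
   or gradient is a column 'cV[R]_2. *)

Notation leb2 := (lebesgue_measure \x lebesgue_measure)%E.

Section Geometry.
Context {R : realType}.
Implicit Types (r s : R) (f : R -> R) (z : R * R) (M : 'M[R]_2)
  (xi eta : 'cV[R]_2).

Definition f_ks (k : nat) s r : R :=
  expR (- (ln r^-1 * (iter k (@ln R) r^-1) `^ s)).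

(* The germ at 0 is punctured because f 0 = 0, whereas f_ks k s 0 is a junk
   value coming from 0^-1 = 0. *)
Definition degenerate_profile (k : nat) s f : Prop :=
  [/\ f 0 = 0,
      (forall x, f (- x) = f x),
      (\forall x \near 0^', f x = f_ks k s `|x|),
      (forall x, x != 0 ->
        [/\ 0 < f x, derivable f x 1, derivable (derive1 f) x 1
          & {for x, continuous (derive1 (derive1 f))}])
    & (forall x, 0 < x -> 0 < derive1 f x)].

Definition bform M xi eta : R := (xi^T *m M *m eta) 0 0.

Definition psd M : Prop := forall xi, 0 <= bform M xi xi.

Definition Amx f z : 'M[R]_2 :=
  diag_mx (\row_(i < 2) (if i == 0 then 1 else f z.1 ^+ 2)).

Definition enorm xi : R := Num.sqrt (\sum_i xi i 0 ^+ 2).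

Definition bounded_domain (O : set (R * R)) : Prop :=
  [/\ O !=set0, open O, connected O & bounded_set O].

End Geometry.

Section Sobolev.
Context {R : realType}.
Implicit Types (f : R -> R) (O K : set (R * R)) (u v w phi psi : R * R -> R)
  (g h : R * R -> 'cV[R]_2).

Definition d1 psi : R * R -> R := fun z => 'D_((1, 0) : R * R) psi z.
Definition d2 psi : R * R -> R := fun z => 'D_((0, 1) : R * R) psi z.

Fixpoint Cn (n : nat) psi : Prop :=
  if n is m.+1 then
    [/\ continuous psi,
        (forall z, derivable psi z ((1, 0) : R * R)),
        (forall z, derivable psi z ((0, 1) : R * R)),
        Cn m (d1 psi) & Cn m (d2 psi)]
  else continuous psi.

Definition compactly_supported O psi : Prop :=
  compact (closure [set z | psi z != 0]) /\
  closure [set z | psi z != 0] `<=` O.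

Definition test_function O psi : Prop :=
  (forall n, Cn n psi) /\ compactly_supported O psi.

Definition lipschitz_c O psi : Prop :=
  lipschitz psi /\ compactly_supported O psi.

(* nabla_A v for a gradient field g of v. *)
Definition nablaA f g : R * R -> 'cV[R]_2 :=
  fun z => \col_(i < 2) (if i == 0 then g z 0 0 else f z.1 * g z 1 0).

(* g = (dv/dx, dv/dy) in the weak sense.  Only f * dv/dy needs to be a function
   on O, so the second identity is tested for the vector field f(x) d/dy, whose
   formal adjoint is - f(x) d/dy; it determines dv/dy a.e., as f <> 0 off x = 0. *)
Definition weak_gradient f O v g : Prop :=
  forall psi, test_function O psi ->
    (\int[leb2]_(z in O) (v z * d1 psi z)
      = - (\int[leb2]_(z in O) (nablaA f g z 0 0 * psi z))) /\
    (\int[leb2]_(z in O) (v z * (f z.1 * d2 psi z))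
      = - (\int[leb2]_(z in O) (nablaA f g z 1 0 * psi z))).

(* The norm of W_A^{1,p}, used for p = 1, 2, of v with gradient field g. *)
Definition Wnorm (p : nat) f O v g : \bar R :=
  ((\int[leb2]_(z in O)
     (`|v z| ^+ p + enorm (nablaA f g z) ^+ p)%:E) `^ (p%:R^-1))%E.

(* v is in W_A^{1,p}(O); g, unique up to null sets, is kept as a parameter so
   that nabla_A v and the weak formulation can refer to it. *)
Definition inW (p : nat) f O v g : Prop :=
  [/\ measurable_fun O v,
      (forall i, measurable_fun O (fun z => g z i 0)),
      weak_gradient f O v g
    & (Wnorm p f O v g < +oo)%E].

(* (W_A^{1,p})_0(O), the closure of lipschitz_c O in W_A^{1,p}(O). *)
Definition inW0 (p : nat) f O v g : Prop :=
  inW p f O v g /\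
  forall e : R, 0 < e ->
    exists psi h, [/\ lipschitz_c O psi, inW p f O psi h
      & (Wnorm p f O (fun z => (v z - psi z)%R) (fun z => (g z - h z)%R)
            < e%:E)%E].

Definition L2loc O phi : Prop :=
  measurable_fun O phi /\
  forall K, compact K -> K `<=` O ->
    ((\int[leb2]_(z in K) (phi z ^+ 2)%:E) < +oo)%E.

(* In \bar R one has 0 / 0 = 0 and a / 0 = +oo for a > 0. *)
Definition Xnorm f O phi : \bar R :=
  ereal_sup [set q | exists v g, inW0 1 f O v g /\
    q = ((\int[leb2]_(z in O) `|v z * phi z|%:E)
         / (\int[leb2]_(z in O) (enorm (nablaA f g z))%:E))%E].

Definition admissible f O phi : Prop := (Xnorm f O phi < +oo)%E.

(* Both integrals are required to exist.  leb2 lives on the Borel sets and cA is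
   not assumed Borel, so F is a representative of the a.e. class of
   grad w^T cA(., u) grad u; u, w, phi, gw and gu are Borel representatives. *)
Definition weak_subsolution f O (cA : R * R -> R -> 'M[R]_2) phi u : Prop :=
  exists gu, inW 2 f O u gu /\
  forall w gw, inW0 2 f O w gw ->
    {ae leb2, forall z : R * R, O z -> 0 <= w z} ->
    exists F : R * R -> R,
      [/\ {ae leb2, forall z : R * R, O z ->
             F z = bform (cA z (u z)) (gw z) (gu z)},
          leb2.-integrable O (EFin \o F),
          leb2.-integrable O (EFin \o (fun z => phi z * w z))
        & - (\int[leb2]_(z in O) F z) >= \int[leb2]_(z in O) (phi z * w z)].

Definition bdry_sup f O u : \bar R :=
  ereal_inf [set l%:E | l in
    [set l : R | exists g, inW0 2 f O (fun z => Num.max (u z - l) 0) g]].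

(* Patching by -oo outside O makes ess_sup, taken over the whole plane, ignore
   the complement of O. *)
Definition ess_sup_on O u : \bar R :=
  ess_sup leb2 (patch (fun=> -oo%E) O (EFin \o u)).

Definition A_elliptic f O (c0 C0 : R) (cA : R * R -> R -> 'M[R]_2) : Prop :=
  {ae leb2, forall z : R * R, O z -> forall (s : R) (xi : 'cV[R]_2),
    c0 * bform (Amx f z) xi xi <= bform (cA z s) xi xi /\
    bform (cA z s) xi xi <= C0 * bform (Amx f z) xi xi}.

End Sobolev.

(* Main.v *)
Require Import Defs.
From HB Require Import structures.
From mathcomp Require Import all_boot all_order all_algebra.
From mathcomp Require Import all_classical all_reals all_analysis.
From mathcomp Require Import ring lra measurable_realfun ess_sup_inf.
Set Implicit Arguments.
Unset Strict Implicit.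
Unset Printing Implicit Defensive.
Import Order.TTheory GRing.Theory Num.Theory.
Import numFieldNormedType.Exports.
Local Open Scope classical_set_scope.
Local Open Scope ring_scope.

(* Only two properties of the weight are used: [f] is nondecreasing in [|x|], and
   [f r >= exp (- r ^ (- 1/2))] for small [r].

   Let [E] be a set of measure at most [m].  At points of [E] with [|x| >= rho] whose vertical slice
   of [E] has length at most [tau], bound [|v|] by the integral of [|f d_y v| / f rho] over the
   vertical line; the other points lie over a set of abscissae of measure at most [2 rho + m / tau],
   and there [|v|] is bounded by the integral of [|d_x v|] over the horizontal line.  Hence
   [int_E |v| <= (2 rho + m / tau + tau / f rho) int |nabla_A v|] for [v] vanishing on the boundary.

   Testing the equation with a smooth truncation [v] of [w = (u - l)^+] at height [m], admissibility
   of [phi] and AM-GM give [int |nabla_A v| <= K |{w > m}|] for all positive [K >= X / c0].  With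
   the inequality above, [(d / 2) |{w > m + d}| <= theta K |{w > m}|].  Asking [|{w > m}|] to decay
   like [e^(-4j)] along levels [m_j], the choice [tau = e^(-2j)], [rho = (j + N)^(-2)] makes
   [theta = O(j^(-2))] by the lower bound on [f]; the level increments are therefore summable and
   [w <= C K] almost everywhere.

   The chain rule [nabla_A (G v) = G'(v) nabla_A v], needed to use truncations as test functions,
   follows from [v (z + t e) - v z = int_0^t (d_e v) (z + s e) ds] for almost every [z]. *)

(** Since [u] is only distributionally differentiable, the chain rule cannot be read off from a
    dense class of regular functions; the identity for [v (z + t e) - v z] replaces mollification.
    In the direction [y] it is obtained for [f v], whose derivative is an integrable function, and
    then divided by [f] off the axis. The truncation has a Lipschitz derivative because its Taylor
    remainder must be quadratic in the increment of [v], hence of order [t ^ 2] after integration.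

    The requirements on [tau] compete: [m / tau] asks it to dominate the measure of the level set,
    [tau / f rho] asks it to be small against [f rho], while [rho] has to be summable along the
    levels. At radii [j ^ (-2)] the bound keeps [f] above [e ^ (-j)], so that [e ^ (-2j)] fits
    between [e ^ (-4j)] and [e ^ (-j)]; a bound [exp (- r ^ (- a))] with [a < 1] leaves the same
    room at radii [j ^ (- 1/a)]. Since [X] may vanish and the iteration divides by [K], the argument
    runs with [K] slightly above [X / c0]; the excess tends to [0] at the end. *)

(** * Translation invariance on the line and in the plane *)

Section Translation.
Context {R : realType}.
Local Notation mu := (@lebesgue_measure R).

Definition trans1 (a : R) : measurableTypeR R -> measurableTypeR R := fun x => x + a.

Lemma measurable_trans1 a : measurable_fun setT (trans1 a).
Proof. exact: measurable_funD. Qed.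
HB.instance Definition _ a := isMeasurableFun.Build _ _ _ _ (trans1 a) (measurable_trans1 a).

Lemma lebesgue_trans1 a (A : set (measurableTypeR R)) : measurable A ->
  pushforward mu (trans1 a) A = mu A.
Proof.
move=> mA; apply/esym/lebesgue_measure_unique => //= _ [[b c]] _ <-.
rewrite /pushforward.
have -> : trans1 a @^-1` `]b, c] = `]b - a, c - a]%classic.
  by apply/seteqP; split => x /=; rewrite /trans1 !in_itv/= ltrBlDr lerBrDr.
rewrite !lebesgue_measure_itv/= !lte_fin ltrD2r.
by case: ifP => // _; rewrite -!EFinD; congr _%:E; lra.
Qed.

Definition trans2 (a : R * R) : measurableTypeR R * measurableTypeR R ->
  measurableTypeR R * measurableTypeR R := fun z => (z.1 + a.1, z.2 + a.2).

Lemma measurable_trans2 a : measurable_fun setT (trans2 a).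
Proof.
apply: measurable_fun_pair; apply: measurable_funD => //.
Qed.
HB.instance Definition _ a := isMeasurableFun.Build _ _ _ _ (trans2 a) (measurable_trans2 a).

Lemma leb2_trans2 a A : measurable A -> pushforward (leb2 : set (R * R) -> _) (trans2 a) A = leb2 A.
Proof.
move=> mA; apply/esym.
apply: (product_measure_unique (m' := pushforward (mu \x mu)%E (trans2 a))) => // B C mB mC /=.
rewrite /pushforward.
have -> : trans2 a @^-1` (B `*` C) = (trans1 a.1 @^-1` B) `*` (trans1 a.2 @^-1` C) by [].
rewrite product_measure1E//.
- by rewrite -(lebesgue_trans1 a.1 mB) -(lebesgue_trans1 a.2 mC).
- by rewrite -[X in measurable X]setTI; apply: measurable_trans1.
- by rewrite -[X in measurable X]setTI; apply: measurable_trans1.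
Qed.

End Translation.

Section PlaneIntegral.
Context {R : realType}.
Local Notation mu := (@lebesgue_measure R).
Local Notation integ P := ((mu \x mu)%E.-integrable setT (EFin \o P)).
Implicit Types (P phi : R * R -> R) (e z : R * R) (s t : R).

Lemma ge0_integral_trans1 a (g : R -> \bar R) : measurable_fun [set: measurableTypeR R] g ->
  (forall x, 0 <= g x)%E -> (\int[mu]_x g (x + a)%R = \int[mu]_x g x)%E.
Proof.
move=> mg g0.
rewrite -[RHS](@eq_measure_integral _ _ _ setT mu (pushforward mu (trans1 a))); last first.
  by move=> A mA _; exact: lebesgue_trans1.
by rewrite ge0_integral_pushforward// => x _; exact: g0.
Qed.

Lemma ge0_integral_trans2 a (g : R * R -> \bar R) : measurable_fun [set: measurableTypeR R * measurableTypeR R] g ->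
  (forall x, 0 <= g x)%E ->
  (\int[leb2]_z g (trans2 a z) = \int[leb2]_z g z)%E.
Proof.
move=> mg g0.
rewrite -[RHS](@eq_measure_integral _ _ _ setT (mu \x mu)%E (pushforward (mu \x mu)%E (trans2 a))); last first.
  by move=> A mA _; exact: leb2_trans2.
rewrite ge0_integral_pushforward//; exact: measurable_trans2.
Qed.

Lemma integ_trans2 a P : integ P -> integ (P \o trans2 a).
Proof.
move=> /integrableP[mP P0]; apply/integrableP; split.
  by apply: measurableT_comp mP _; exact: measurable_trans2.
have := @ge0_integral_trans2 a (fun z => `|(P z)%:E|%E).
by move=> -> //; exact: measurableT_comp.
Qed.

Lemma Rintegral_trans2 a P : integ P ->
  \int[leb2]_z P (trans2 a z) = \int[leb2]_z P z.
Proof.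
move=> iP; rewrite /Rintegral; congr fine.
rewrite -[RHS](@eq_measure_integral _ _ _ setT (mu \x mu)%E (pushforward (mu \x mu)%E (trans2 a))); last first.
  by move=> A mA _; exact: leb2_trans2.
rewrite integral_pushforward//.
- by case/integrableP: iP.
- by rewrite preimage_setT; exact: (integ_trans2 a iP).
Qed.

Lemma ae_trans2 a (Q : R * R -> Prop) :
  {ae (mu \x mu)%E, forall z, Q z} -> {ae (mu \x mu)%E, forall z, Q (trans2 a z)}.
Proof.
move=> [A [mA A0 QA]]; exists (trans2 a @^-1` A); split.
- by rewrite -[X in measurable X]setTI; apply: measurable_trans2.
- by rewrite -A0 -[RHS](leb2_trans2 a mA).
- by move=> z /= nQ; apply: QA.
Qed.

End PlaneIntegral.

(** Second countability by hand: the union runs over all rational squares, those not contained in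
    [O] being replaced by the empty set. *)
Lemma open_measurable2 (R : realType) (O : set (R * R)) : open O ->
  measurable (O : set (measurableTypeR R * measurableTypeR R)).
Proof.
move=> oO.
pose box (q : rat * rat * rat) : set (measurableTypeR R * measurableTypeR R) :=
  ball (ratr q.1.1 : R) (ratr q.2) `*` ball (ratr q.1.2 : R) (ratr q.2).
pose F q := if pselect (box q `<=` O) then box q else set0.
have -> : O = \bigcup_q F q.
  apply/seteqP; split => [z Oz|z [q _]]; last first.
    by move=> Fz; move: Fz; rewrite /F; case: (pselect _) => h //=; exact: h.
  have /nbhs_ballP[e/= e0 eO] : nbhs z O by exact: open_nbhs_nbhs.
  have [r] := @rat_in_itvoo R 0 (e / 2) ltac:(lra); rewrite in_itv/= => /andP[r0 re].
  have [a] := @rat_in_itvoo R (z.1 - ratr r) z.1 ltac:(lra); rewrite in_itv/= => /andP[a0 a1].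
  have [b] := @rat_in_itvoo R (z.2 - ratr r) z.2 ltac:(lra); rewrite in_itv/= => /andP[b0 b1].
  exists (a, b, r) => //; rewrite /F; case: (pselect _) => [h|] /=.
    by split => /=; rewrite /ball/= ltr_norml; apply/andP; split; lra.
  case => -[x y] [] /=; rewrite /ball/= !ltr_norml => /andP[? ?] /andP[? ?].
  by apply: eO; split => /=; rewrite /ball/= ltr_norml; apply/andP; split; lra.
apply: countable_bigcupT_measurable => [|q]; first exact: countableP.
rewrite /F; case: (pselect _) => h //=.
by apply: measurableX; exact: measurable_ball.
Qed.

Lemma continuous_measurable2 (R : realType) (g : R * R -> R) : continuous g ->
  measurable_fun [set: measurableTypeR R * measurableTypeR R] g.
Proof.
move=> /continuousP cg.
apply: (measurability _ (RGenOpens.measurableE R)).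
move=> _ [_ [a [b ->] <-]]; rewrite setTI.
apply: open_measurable2; apply: cg; exact: interval_open.
Qed.

(** * Real-valued integrals: domination, Cauchy-Schwarz, dominated convergence *)

Section RIntegral.
Context {R : realType} d (T : measurableType d) (m : {measure set T -> \bar R}).
Variables (D : set T) (mD : measurable D).
Local Notation integ P := (m.-integrable D (EFin \o P)).
Implicit Types f g : T -> R.

Lemma integ_mfun f : integ f -> measurable_fun D f.
Proof. by case/integrableP => /measurable_EFinP. Qed.

Lemma integ_le f g : measurable_fun D f -> (forall x, D x -> `|f x| <= g x) ->
  integ g -> integ f.
Proof.
move=> mf fg; apply: le_integrable => //; first exact/measurable_EFinP.
by move=> x Dx /=; rewrite lee_fin (le_trans (fg _ Dx))// ler_norm.
Qed.

Lemma integ_ae_le f g : measurable_fun D f ->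
  {ae m, forall x, D x -> `|f x| <= g x} -> integ g -> integ f.
Proof.
move=> mf fg /integrableP[/measurable_EFinP mg gi]; apply/integrableP; split; first exact/measurable_EFinP.
apply: le_lt_trans gi; apply: ae_ge0_le_integral => //.
- by do 2 apply: measurableT_comp => //.
- by do 2 apply: measurableT_comp => //.
- by apply: filterS fg => x fg Dx /=; rewrite lee_fin (le_trans (fg Dx))// ler_norm.
Qed.

Lemma integD f g : integ f -> integ g -> integ (fun x => f x + g x).
Proof. by move=> fi gi; have := integrableD mD fi gi. Qed.

Lemma integN f : integ f -> integ (fun x => - f x).
Proof. by move=> fi; have := integrableN fi. Qed.

Lemma integB f g : integ f -> integ g -> integ (fun x => f x - g x).
Proof. by move=> fi gi; apply: integD => //; exact: integN. Qed.

Lemma integZ c f : integ f -> integ (fun x => c * f x).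
Proof. by move=> fi; have := integrableZl mD c fi. Qed.

Lemma integ_abs f : integ f -> integ (fun x => `|f x|).
Proof. by move=> fi; have := integrable_norm fi. Qed.

Lemma integM c f g : measurable_fun D g -> (forall x, D x -> `|g x| <= c) ->
  integ f -> integ (fun x => g x * f x).
Proof.
move=> mg gc fi; apply: (@integ_le _ (fun x => c * `|f x|)).
- by apply: measurable_funM => //; exact: integ_mfun.
- by move=> x Dx; rewrite normrM ler_wpM2r// gc.
- exact/integZ/integ_abs.
Qed.

Lemma ae_eq_Rint f g : measurable_fun D f -> measurable_fun D g ->
  {ae m, forall x, D x -> f x = g x} ->
  \int[m]_(x in D) f x = \int[m]_(x in D) g x.
Proof.
move=> mf mg fg; rewrite /Rintegral; congr fine; apply: ae_eq_integral => //.
- exact/measurable_EFinP.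
- exact/measurable_EFinP.
- by apply: filterS fg => x fg Dx /=; rewrite fg.
Qed.

Lemma ae_le_Rint f g : integ f -> integ g ->
  {ae m, forall x, D x -> f x <= g x} ->
  \int[m]_(x in D) f x <= \int[m]_(x in D) g x.
Proof.
move=> fi gi fg.
rewrite -subr_ge0 -RintegralB//.
rewrite (@ae_eq_Rint _ (fun x => `|g x - f x|)).
- by apply: Rintegral_ge0.
- exact/integ_mfun/integB.
- exact/integ_mfun/integ_abs/integB.
- by apply: filterS fg => x fg Dx; rewrite ger0_norm// subr_ge0 fg.
Qed.

Lemma integ_fin f : integ f ->
  (\int[m]_(x in D) (f x)%:E)%E = (\int[m]_(x in D) f x)%:E.
Proof. by move=> fi; rewrite /Rintegral fineK//; exact: integrable_fin_num. Qed.

Lemma integ_cst c : (m D < +oo)%E -> integ (fun=> c).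
Proof.
move=> Doo; apply: measurable_bounded_integrable => //.
by exists `|c|; split; [exact: num_real|move=> M cM x _; exact: ltW].
Qed.

Lemma cauchy_schwarz1 f : (m D < +oo)%E -> measurable_fun D f ->
  integ (fun x => f x ^+ 2) ->
  integ f /\ (\int[m]_(x in D) `|f x|) ^+ 2 <= fine (m D) * \int[m]_(x in D) f x ^+ 2.
Proof.
move=> Doo mf f2.
have cstint c : integ (fun=> c) by exact: integ_cst.
have fi : integ f.
  apply: (@integ_le _ (fun x => 1 + f x ^+ 2)) => //; last exact: integD.
  by move=> x _; have := sqr_ge0 (`|f x| - 1); rewrite sqrrB real_normK ?num_real//; nra.
split => //.
set S := \int[m]_(x in D) _ ^+ 2.
set P := \int[m]_(x in D) _.
have S0 : 0 <= S by apply: Rintegral_ge0 => x _; exact: sqr_ge0.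
have P0 : 0 <= P by exact: Rintegral_ge0.
have M0 : 0 <= fine (m D) by exact: fine_ge0.
have key c : 2 * c * P <= c ^+ 2 * fine (m D) + S.
  rewrite -[c ^+ 2 * _](@Rintegral_cst _ _ _ m D mD) -RintegralD// -RintegralZl//; last exact: integ_abs.
  apply: le_Rintegral => //.
  - exact/integZ/integ_abs.
  - exact: integD.
  - move=> x _; have := sqr_ge0 (`|f x| - c).
    by rewrite sqrrB real_normK ?num_real//; nra.
have [M00|Mp] := eqVneq (fine (m D)) 0; last first.
  have Mp' : 0 < fine (m D) by rewrite lt0r Mp M0.
  have := key (P / fine (m D)); set q := P / _.
  have -> : P = q * fine (m D) by rewrite /q divfK.
  by move=> h; rewrite expr2; nra.
have [->|Pn] := eqVneq P 0; first by rewrite M00 mul0r expr0n.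
have Pp : 0 < P by rewrite lt0r Pn P0.
have := key ((S + 1) / P).
rewrite M00 mulr0 add0r -mulrA divfK//; lra.
Qed.

Lemma Rdominated_convergence (F : nat -> T -> R) f g :
  (forall n, measurable_fun D (F n)) -> measurable_fun D f ->
  (forall x, D x -> (fun n => F n x) @ \oo --> f x) ->
  integ g -> (forall n x, D x -> `|F n x| <= g x) ->
  integ f /\ (fun n => \int[m]_(x in D) F n x) @ \oo --> \int[m]_(x in D) f x.
Proof.
move=> mF mf Ff ig Fg.
have h1 x : D x -> (fun n => (F n x)%:E) @ \oo --> (f x)%:E.
  by move=> Dx; apply/fine_cvgP; split; [exact: nearW|exact: Ff].
have h2 n x : D x -> (`|(F n x)%:E| <= (g x)%:E)%E by move=> Dx; rewrite lee_fin; exact: Fg.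
have [iF _ cF] := @dominated_convergence _ _ _ m D mD
  (fun n => EFin \o F n) (EFin \o f) (EFin \o g)
  (fun n => (measurable_EFinP _ _).2 (mF n)) ((measurable_EFinP _ _).2 mf)
  (aeW _ (fun x Dx => h1 x Dx)) ig
  (aeW _ (fun x n Dx => h2 n x Dx)).
split=> //; apply: fine_cvg; rewrite integ_fin// in cF *; exact: cF.
Qed.
End RIntegral.

Section AlmostEverywhere.
Context {R : realType} d (T : measurableType d) (m : {measure set T -> \bar R}).
Implicit Types P Q : T -> Prop.

Lemma ae_imp P Q : {ae m, forall x, P x} -> (forall x, P x -> Q x) -> {ae m, forall x, Q x}.
Proof. by move=> aP PQ; apply: filterS aP. Qed.

Lemma ae_and P Q : {ae m, forall x, P x} -> {ae m, forall x, Q x} ->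
  {ae m, forall x, P x /\ Q x}.
Proof. by move=> aP aQ; apply: filterS2 aP aQ. Qed.

Lemma ae_all P : (forall x, P x) -> {ae m, forall x, P x}.
Proof. by move=> h; apply: aeW. Qed.
End AlmostEverywhere.

(** * Smooth bumps, Steklov averages and tensor test functions *)

Section Smooth.
Context {R : realType}.
Implicit Types (a b : R -> R).

Fixpoint C1 (n : nat) a : Prop :=
  if n is m.+1 then exists a' : R -> R,
    (forall x : R, is_derive x (1 : R) a (a' x)) /\ C1 m a'
  else continuous a.

Definition smooth a := forall n, C1 n a.

Lemma is_derive_continuous a (a' : R -> R) :
  (forall x : R, is_derive x (1 : R) a (a' x)) -> continuous a.
Proof.
move=> da x; apply: differentiable_continuous; apply/derivable1_diffP.
by case: (da x).
Qed.

Lemma C1_continuous n a : C1 n a -> continuous a.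
Proof. by case: n => //= n [a' [da _]]; exact: is_derive_continuous da. Qed.

Lemma C1S n a : C1 n.+1 a -> C1 n a.
Proof.
elim: n a => [|n IH] a; first exact: C1_continuous.
by move=> [a' [da a'n]]; exists a'; split => //; exact: IH.
Qed.

Lemma smooth_continuous a : smooth a -> continuous a.
Proof. by move/(_ 0%N). Qed.

Lemma smooth_derive a : smooth a ->
  exists a', (forall x : R, is_derive x (1 : R) a (a' x)) /\ smooth a'.
Proof.
move=> sa; exists ('D_1 a); split => [x|n].
  by have [a' [/(_ x)[? _] _]] := sa 1%N; exact: derivableP.
have [a' [da na']] := sa n.+1.
suff -> : 'D_1 a = a' by [].
by apply/funext => x; case: (da x).
Qed.

Lemma derive_smooth a a' : (forall x : R, is_derive x (1 : R) a (a' x)) -> smooth a' -> smooth a.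
Proof. by move=> da sa [|n]; [exact: is_derive_continuous da|exists a'; split]. Qed.

Lemma C1_cst n (c : R) : C1 n (fun=> c).
Proof.
elim: n c => [|n IH] c /=; first by move=> x; exact: cvg_cst.
by exists (fun=> 0); split => // x; exact: is_derive_cst.
Qed.

Lemma C1D n a b : C1 n a -> C1 n b -> C1 n (fun x => a x + b x).
Proof.
elim: n a b => [|n IH] a b /=; first by move=> ca cb x; exact: cvgD (ca x) (cb x).
move=> [a' [da na]] [b' [db nb]]; exists (fun x => a' x + b' x); split; last exact: IH.
by move=> x; exact: is_deriveD.
Qed.

Lemma C1M n a b : C1 n a -> C1 n b -> C1 n (fun x => a x * b x).
Proof.
elim: n a b => [|n IH] a b; first by move=> ca cb x; exact: cvgM (ca x) (cb x).
move=> ha hb; have := C1S ha; have := C1S hb.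
case: ha => a' [da na]; case: hb => b' [db nb] nb0 na0.
exists (fun x => a x * b' x + b x * a' x); split; last by apply: C1D; exact: IH.
by move=> x; exact: is_deriveM.
Qed.

Lemma C1_affine n a (c d : R) : C1 n a -> C1 n (fun x => a (c * x + d)).
Proof.
elim: n a => [|n IH] a /=.
  move=> ca x; apply: continuous_comp; last exact: ca.
  by apply: cvgD; [apply: cvgM; [exact: cvg_cst|exact: cvg_id]|exact: cvg_cst].
move=> [a' [da na]]; exists (fun x => c * a' (c * x + d)); split; last first.
  by apply: C1M; [exact: C1_cst|exact: IH].
move=> x; rewrite mulrC; apply: is_derive1_comp.
have h1 : is_derive x (1 : R) (fun y : R => c * y) (c * 1) by exact: is_deriveZ.
have := is_deriveD h1 (is_derive_cst d x (1 : R)).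
by rewrite mulr1 addr0; apply.
Qed.

Lemma smoothM a b : smooth a -> smooth b -> smooth (fun x => a x * b x).
Proof. by move=> sa sb n; exact: C1M. Qed.
Lemma smoothD a b : smooth a -> smooth b -> smooth (fun x => a x + b x).
Proof. by move=> sa sb n; exact: C1D. Qed.
Lemma smooth_cst (c : R) : smooth (fun=> c).
Proof. by move=> n; exact: C1_cst. Qed.
Lemma smooth_affine a (c d : R) : smooth a -> smooth (fun x => a (c * x + d)).
Proof. by move=> sa n; exact: C1_affine. Qed.
Lemma smoothX a n : smooth a -> smooth (fun x => a x ^+ n).
Proof.
move=> sa; elim: n => [|n IH]; first exact: smooth_cst.
have -> : (fun x => a x ^+ n.+1) = (fun x => a x * a x ^+ n) by apply/funext => x; rewrite exprS.
exact: smoothM.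
Qed.

(* the functions [P(1/x) exp(-1/x)] on [x > 0] are stable under derivation *)
Definition flat (P : {poly R}) (x : R) : R := if 0 < x then P.[x^-1] * expR (- x^-1) else 0.

(** A linear bound is all that differentiability at [0] requires, since dividing [flat P] by its
    argument only changes the polynomial to ['X * P]. *)
Lemma flat_bound (P : {poly R}) : exists C, forall x, `|flat P x| <= C * `|x|.
Proof.
have mono n : exists2 C : R, 0 <= C & forall u : R, 0 < u -> u ^+ n * expR (- u) <= C * u^-1.
  exists (n.+1)`!%:R; first by rewrite ler0n.
  move=> u u0; rewrite expRN ler_pdivrMr ?expR_gt0// mulrAC ler_pdivlMr// -exprSr.
  have := expR_ge1Dxn n (ltW u0) => h.
  have f0 : 0 < ((n.+1)`!%:R : R) by rewrite ltr0n fact_gt0.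
  rewrite -ler_pdivrMl// mulrC; lra.
(* The extra power [u ^+ n] makes the induction on [P] go through: the factor [u] produced by
   [P * 'X + c] is absorbed by passing to [n.+1]. *)
have key n : exists2 C : R, 0 <= C & forall u : R, 0 < u -> `|u ^+ n * P.[u]| * expR (- u) <= C * u^-1.
  elim/poly_ind: P n => [|P c IH] n.
    by exists 0 => // u _; rewrite horner0 mulr0 normr0 !mul0r.
  have [C C0 CP] := IH n.+1; have [D D0 DP] := mono n.
  exists (C + `|c| * D) => [|u u0]; first by rewrite addr_ge0 ?mulr_ge0.
  rewrite hornerMXaddC mulrDr (le_trans (ler_wpM2r (expR_ge0 _) (ler_normD _ _)))// !mulrDl.
  rewrite lerD//.
    by have := CP _ u0; rewrite exprSr -mulrA (mulrC u).
  rewrite normrM (ger0_norm (exprn_ge0 _ (ltW u0))) mulrC mulrA mulrC -[leRHS]mulrA ler_wpM2l//.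
  by rewrite mulrC DP.
have [C C0 CP] := key 0%N; exists C => x; rewrite /flat; case: ifPn => x0; last first.
  by rewrite normr0 mulr_ge0.
have := CP x^-1; rewrite expr0 mul1r invrK invr_gt0 => /(_ x0).
by rewrite normrM (ger0_norm (expR_ge0 _)) (gtr0_norm x0).
Qed.

Lemma flat_derive (P : {poly R}) (x : R) :
  is_derive x (1 : R) (flat P) (flat ('X^2 * (P - P^`())) x).
Proof.
have [x0|x0|->] := ltgtP x 0.
- have e : \forall y \near x, flat P y = cst 0 y.
    near=> y; rewrite /flat; case: ifPn => // y0; exfalso.
    have : y < 0 by near: y; exact: lt_nbhsl.
    by move=> /(lt_trans y0); rewrite ltxx.
  rewrite {2}/flat ltNge (ltW x0)/=.
  apply: near_eq_is_derive (is_derive_cst _ _ _).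
  by apply: filterS e => y ->.
- have e : \forall y \near x, P.[y^-1] * expR (- y^-1) = flat P y.
    near=> y; rewrite /flat ifT//; near: y; exact: lt_nbhsr.
  apply: near_eq_is_derive e _.
  rewrite {1}/flat x0.
  have xn : x != 0 by rewrite gt_eqF.
  have dV : is_derive x (1 : R) (fun y => y^-1) (- x ^- 2).
    by apply: is_derive_eq; [exact: is_deriveV|rewrite /GRing.scale/= mulr1].
  have dP : is_derive x (1 : R) (fun y => P.[y^-1]) (P^`().[x^-1] * - x ^- 2).
    by apply: is_derive1_comp.
  have dE : is_derive x (1 : R) (fun y => expR (- y^-1)) (expR (- x^-1) * x ^- 2).
    rewrite -[x ^- 2]opprK.
    apply: (@is_derive1_comp _ _ (fun y => - y^-1)).
  apply: is_derive_eq (is_deriveM dP dE) _.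
  rewrite /GRing.scale/= !hornerE/= exprVn; ring.
(* At [0] the difference quotient of [flat P] equals [flat ('X * P)], which tends to [0] by the
   linear bound. *)
- have [C HC] := flat_bound P; have [D HD] := flat_bound ('X * P).
  have f0 Q : flat Q 0 = 0 by rewrite /flat ltxx.
  rewrite f0.
  suff h : (fun h : R => h^-1 *: (flat P (h *: 1 + 0) - flat P 0)) @ 0^' --> (0 : R).
    by split; [apply/cvg_ex; exists 0|exact/cvg_lim].
  apply/cvgrPdist_lt => e e0.
  have D1 : 0 < `|D| + 1 by rewrite ltr_wpDl.
  near=> y.
  have yn : y != 0 by near: y; exact: nbhs_dnbhs_neq.
  have -> : y^-1 *: (flat P (y *: 1 + 0) - flat P 0) = flat ('X * P) y.
    rewrite f0 subr0 addr0 /flat /GRing.scale/= mulr1; case: ifP => _; last by rewrite mulr0.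
    by rewrite hornerM hornerX mulrA.
  rewrite sub0r normrN; apply: le_lt_trans (HD y) _.
  have : `|y| < e / (`|D| + 1).
    near: y; apply: dnbhs0_lt; exact: divr_gt0.
  rewrite ltr_pdivlMr// => h; have := ler_norm D; have := normr_ge0 y; nra.
Unshelve. all: by end_near. Qed.

Lemma smooth_flat P : smooth (flat P).
Proof.
move=> n; elim: n P => [|n IH] P /=.
  exact: (is_derive_continuous (flat_derive P)).
by exists (flat ('X^2 * (P - P^`()))); split => //; exact: flat_derive.
Qed.

Definition bump (p q x : R) : R := flat 1 (x - p) * flat 1 (q - x).
(** As [bump p q] takes values in [[0, 1[] and is positive exactly on []p, q[], these smooth
    functions converge to the indicator of []p, q[] while their support stays in [[p, q]]; no
    rescaling or mollifier is involved. *)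
Definition bumpn (n : nat) (p q x : R) : R := 1 - (1 - bump p q x) ^+ n.

Lemma smooth_bumpn n p q : smooth (bumpn n p q).
Proof.
have -> : bumpn n p q = fun x => 1 + (-1) * (1 + (-1) * (flat 1 (1 * x + - p) * flat 1 (-1 * x + q))) ^+ n.
  apply/funext => x; rewrite /bumpn /bump mul1r !mulN1r (addrC _ q) //.
apply: smoothD; first exact: smooth_cst.
apply: smoothM; first exact: smooth_cst.
apply: smoothX; apply: smoothD; first exact: smooth_cst.
apply: smoothM; first exact: smooth_cst.
by apply: smoothM; apply: smooth_affine; exact: smooth_flat.
Qed.

Lemma flat1_itv x : 0 <= flat 1 x < 1.
Proof.
rewrite /flat; case: ifPn => x0; last by rewrite lexx ltr01.
by rewrite hornerC mul1r expR_ge0 expR_lt1 oppr_lt0 invr_gt0.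
Qed.

Lemma bump_itv p q x : 0 <= bump p q x < 1.
Proof.
have /andP[a0 a1] := flat1_itv (x - p); have /andP[b0 b1] := flat1_itv (q - x).
rewrite /bump mulr_ge0//=; nra.
Qed.

Lemma bumpn_itv n p q x : 0 <= bumpn n p q x <= 1.
Proof.
have /andP[a0 a1] := bump_itv p q x.
rewrite /bumpn subr_ge0 lerBlDr lerDl exprn_ge0 ?exprn_ile1//; lra.
Qed.

Lemma bumpn_out n p q x : (0 < n)%N -> x \notin `]p, q[ -> bumpn n p q x = 0.
Proof.
rewrite in_itv/= negb_and -!leNgt => n0 h.
suff -> : bumpn n p q x = 1 - (1 - 0) ^+ n by rewrite subr0 expr1n subrr.
rewrite /bumpn /bump /flat; case/orP: h => h.
  by rewrite [0 < x - p]ltNge subr_le0 h mul0r.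
by rewrite [0 < q - x]ltNge subr_le0 h mulr0.
Qed.

Lemma bumpn_cvg p q x : (fun n => bumpn n p q x) @ \oo --> (\1_(`]p, q[%classic) x : R).
Proof.
rewrite indicE mem_setE.
have [xpq|xpq] := boolP (x \in `]p, q[); last first.
  rewrite -(cvg_shiftS (fun n => bumpn n p q x)).
  by under eq_fun do rewrite bumpn_out//; exact: cvg_cst.
have b0 : 0 < bump p q x.
  move: xpq; rewrite in_itv/= => /andP[px xq].
  by rewrite /bump /flat !subr_gt0 px xq !hornerC !mul1r mulr_gt0// expR_gt0.
have /andP[_ b1] := bump_itv p q x.
have -> : (fun n => bumpn n p q x) = (fun n => 1 - geometric 1 (1 - bump p q x) n).
  by apply/funext => n; rewrite /geometric/= mul1r.
rewrite -[X in _ --> X]subr0; apply: cvgB; first exact: cvg_cst.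
by apply: cvg_geometric; rewrite ger0_norm; lra.
Qed.

(* Testing with the integral of [a] over [x - t, x] turns a weak derivative into a difference. *)
Definition steklov (t : R) (a : R -> R) (x : R) : R :=
  \int[lebesgue_measure]_(s in `[0, t]) a (x - s).

Lemma steklov_derive t a p q : 0 < t -> continuous a ->
  (forall x, x \notin `[p, q] -> a x = 0) ->
  forall x : R, is_derive x (1 : R) (steklov t a) (a x - a (x - t)).
Proof.
move=> t0 ca aout.
have mua : measurable_fun setT a by exact: continuous_measurable_fun.
have ia A : measurable A -> lebesgue_measure.-integrable A (EFin \o a).
  move=> mA; apply: (@integrableS _ _ _ _ setT) => //.
  have -> : EFin \o a = (EFin \o a) \_ `[p, q].
    apply/funext => x; rewrite patchE; case: ifPn => // xpq /=.
    by rewrite aout//; move: xpq; rewrite mem_setE.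
  apply/(integrable_mkcond _ _).1 => //.
  apply: continuous_compact_integrable; first exact: segment_compact.
  exact: continuous_subspaceT.
(* A primitive based at [-oo] serves every [x] at once; it exists because [a] vanishes off a
   segment. The Steklov average is then the difference [F x - F (x - t)]. *)
pose F x := \int[lebesgue_measure]_(s in `]-oo, x]) a s.
have dF x : is_derive x (1 : R) F (a x).
  have [dx <-] := @continuous_FTC1 R a -oo%O x (x + 1) ltac:(lra) (ia _ (measurable_itv _)) (ltNyr _) (ca x).
  by rewrite derive1E; exact: derivableP.
have -> : steklov t a = fun x => F x - F (x - t).
  apply/funext => x.
  have dG s : is_derive s (1 : R) (fun s => - F (x - s)) (a (x - s)).
    have h1 : is_derive s (1 : R) (fun y : R => x - y) (-1).
      have := is_deriveB (is_derive_cst x s (1 : R)) (is_derive_id s (1 : R)).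
      by rewrite sub0r; apply.
    have := is_deriveN (@is_derive1_comp _ F (fun y => x - y) s _ _ (dF (x - s)) h1).
    by rewrite mulrN1 opprK; apply.
  have cG : continuous (fun s => - F (x - s)) by exact: is_derive_continuous dG.
  rewrite /steklov /Rintegral (@continuous_FTC2 R (fun s => a (x - s)) (fun s => - F (x - s)) 0 t t0).
  - by rewrite subr0 -EFinB /= opprK addrC.
  - apply: continuous_subspaceT => s; apply: continuous_comp; last exact: ca.
    by apply: cvgB; [exact: cvg_cst|exact: cvg_id].
  - split.
    + by move=> s _; case: (dG s).
    + by apply: cvg_at_right_filter; exact: cG.
    + by apply: cvg_at_left_filter; exact: cG.
  - by move=> s _; rewrite derive1E; case: (dG s).
move=> x.
have h1 : is_derive x (1 : R) (fun y : R => y - t) 1.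
  have := is_deriveB (is_derive_id x (1 : R)) (is_derive_cst t x (1 : R)).
  by rewrite subr0; apply.
have := is_deriveB (dF x) (@is_derive1_comp _ F (fun y => y - t) x _ _ (dF (x - t)) h1).
by rewrite mulr1; apply.
Qed.

Lemma smooth_steklov t n p q : 0 < t -> smooth (steklov t (bumpn n.+1 p q)).
Proof.
move=> t0; have sb := smooth_bumpn n.+1 p q.
apply: derive_smooth.
  apply: (steklov_derive (p := p) (q := q)) => //; first exact: smooth_continuous.
  move=> x xpq; apply: bumpn_out => //; apply: contra xpq.
  by rewrite !in_itv/= => /andP[/ltW-> /ltW->].
have -> : (fun x => bumpn n.+1 p q x - bumpn n.+1 p q (x - t)) =
  (fun x => bumpn n.+1 p q x + (-1) * bumpn n.+1 p q (1 * x + - t)).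
  by apply/funext => x; rewrite mulN1r mul1r.
by apply: smoothD => //; apply: smoothM; [exact: smooth_cst|exact: smooth_affine].
Qed.

Lemma steklov_out t n p q x : 0 < t -> x \notin `[p, (q + t)] ->
  steklov t (bumpn n.+1 p q) x = 0.
Proof.
move=> t0 xpq; rewrite /steklov /Rintegral integral0_eq// => s /=.
rewrite !in_itv/= => /andP[s0 st]; congr _%:E; apply: bumpn_out => //.
apply: contra xpq; rewrite !in_itv/= => /andP[h1 h2]; apply/andP; split; lra.
Qed.

Lemma is_derive_line (g : R * R -> R) (z v : R * R) (s l : R) :
  is_derive (s *: v + z) v g l <-> is_derive s (1 : R) (fun h => g (h *: v + z)) l.
Proof.
have e : (fun h : R => h^-1 *: ((g \o shift (s *: v + z)) (h *: v) - g (s *: v + z))) =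
   (fun h : R => h^-1 *: (((fun h => g (h *: v + z)) \o shift s) (h *: 1) - (fun h => g (h *: v + z)) s)).
  apply/funext => h /=.
  by rewrite scalerDl addrA [h *: 1]mulr1.
split => -[dg gl].
- by split; [move: dg; rewrite /derivable e|move: gl; rewrite /derive e].
- by split; [move: dg; rewrite /derivable -e|move: gl; rewrite /derive -e].
Qed.

Lemma Cn_tensor0 a b : smooth a -> smooth b -> continuous (fun z : R * R => a z.1 * b z.2).
Proof.
move=> sa sb z; apply: cvgM.
  by apply: (@continuous_comp _ _ _ fst a z); [exact: cvg_fst|exact: smooth_continuous].
by apply: (@continuous_comp _ _ _ snd b z); [exact: cvg_snd|exact: smooth_continuous].
Qed.

Lemma is_derive_tensor1 a a' b z : (forall x : R, is_derive x (1 : R) a (a' x)) ->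
  is_derive z ((1, 0) : R * R) (fun z => a z.1 * b z.2) (a' z.1 * b z.2).
Proof.
move=> da.
  rewrite -[z in is_derive z]add0r -(scale0r ((1, 0) : R * R)); apply/is_derive_line.
  have -> : (fun h : R => a (h *: ((1, 0) : R * R) + z).1 * b (h *: ((1, 0) : R * R) + z).2) =
     (fun h : R => b z.2 *: a (1 * h + z.1)).
    by apply/funext => h; rewrite /= [h *: 1]mulr1 [h *: 0]mulr0 add0r mul1r mulrC.
  rewrite mulrC; apply: is_deriveZ.
  rewrite -[a' z.1]mulr1; apply: (@is_derive1_comp _ a (fun h => 1 * h + z.1)).
    by rewrite mulr0 add0r.
  have h1 : is_derive (0 : R) (1 : R) (fun y : R => 1 * y) (1 * 1) by exact: is_deriveZ.
  by have := is_deriveD h1 (is_derive_cst z.1 (0 : R) (1 : R)); rewrite mulr1 addr0; apply.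
Qed.

Lemma is_derive_tensor2 a b b' z : (forall x : R, is_derive x (1 : R) b (b' x)) ->
  is_derive z ((0, 1) : R * R) (fun z => a z.1 * b z.2) (a z.1 * b' z.2).
Proof.
move=> db.
  rewrite -[z in is_derive z]add0r -(scale0r ((0, 1) : R * R)); apply/is_derive_line.
  have -> : (fun h : R => a (h *: ((0, 1) : R * R) + z).1 * b (h *: ((0, 1) : R * R) + z).2) =
     (fun h : R => a z.1 *: b (1 * h + z.2)).
    by apply/funext => h; rewrite /= [h *: 1]mulr1 [h *: 0]mulr0 add0r mul1r.
  apply: is_deriveZ.
  rewrite -[b' z.2]mulr1; apply: (@is_derive1_comp _ b (fun h => 1 * h + z.2)).
    by rewrite mulr0 add0r.
  have h1 : is_derive (0 : R) (1 : R) (fun y : R => 1 * y) (1 * 1) by exact: is_deriveZ.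
  by have := is_deriveD h1 (is_derive_cst z.2 (0 : R) (1 : R)); rewrite mulr1 addr0; apply.
Qed.

Lemma d1_tensor a a' b : (forall x : R, is_derive x (1 : R) a (a' x)) ->
  d1 (fun z => a z.1 * b z.2) = (fun z => a' z.1 * b z.2).
Proof. by move=> da; apply/funext => z; case: (is_derive_tensor1 b z da). Qed.

Lemma d2_tensor a b b' : (forall x : R, is_derive x (1 : R) b (b' x)) ->
  d2 (fun z => a z.1 * b z.2) = (fun z => a z.1 * b' z.2).
Proof. by move=> db; apply/funext => z; case: (is_derive_tensor2 a z db). Qed.

Lemma Cn_tensor n a b : smooth a -> smooth b -> Cn n (fun z => a z.1 * b z.2).
Proof.
elim: n a b => [|n IH] a b sa sb; first exact: Cn_tensor0.
have [a' [da sa']] := smooth_derive sa; have [b' [db sb']] := smooth_derive sb.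
have cab : continuous (fun z => a z.1 * b z.2) by exact: Cn_tensor0.
split => //=; [by move=> z; case: (is_derive_tensor1 b z da)|by move=> z; case: (is_derive_tensor2 a z db)| |].
  by rewrite (d1_tensor b da); exact: IH.
by rewrite (d2_tensor a db); exact: IH.
Qed.
End Smooth.

(* [leb2] itself has no sigma-finite instance: the library attaches that
   structure to products of subprobabilities only. *)
Section PlaneMeasure.
Context {R : realType}.
Local Notation mu := (@lebesgue_measure R).

Definition plane_measure : set (measurableTypeR R * measurableTypeR R) -> \bar R := (mu \x mu)%E.
HB.instance Definition _ := Measure.on plane_measure.

Lemma plane_measure_sigma_finite : sigma_finite setT plane_measure.
Proof.
have /sigma_finiteP[F [TF ndF Foo]] := sigma_finiteT mu.
exists (fun n => F n `*` F n).
  rewrite -setXTT {1}TF TF predeqE => -[x y]; split.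
    move=> [/= [n _ Fnx] [k _ Gky]]; exists (maxn n k) => //; split.
    - by move: x Fnx; exact/subsetPset/ndF/leq_maxl.
    - by move: y Gky; exact/subsetPset/ndF/leq_maxr.
  by move=> [n _ []/= ? ?]; split; exists n.
move=> k; have [? ?] := Foo k.
split; first exact: measurableX.
by rewrite /plane_measure product_measure1E// lte_mul_pinfty// ge0_fin_numE.
Qed.
HB.instance Definition _ :=
  @Measure_isSigmaFinite.Build _ _ _ plane_measure plane_measure_sigma_finite.
End PlaneMeasure.

(** * Integrals along segments and Fubini's theorem *)

Section Seg.
Context {R : realType}.
Local Notation mu := (@lebesgue_measure R).
Local Notation leb2R := ((@lebesgue_measure R) \x (@lebesgue_measure R))%E.
Local Notation integ P := (leb2R.-integrable setT (EFin \o P)).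
Local Notation integ3 P := (((@plane_measure R) \x mu)%E.-integrable setT (EFin \o P)).
Implicit Types (P phi : R * R -> R) (e z : R * R) (s t : R).

Definition pt e s z : R * R := trans2 (s * e.1, s * e.2) z.
Definition seg e t P z : R := \int[mu]_(s in `[0, t]) P (pt e s z).

Lemma ptE e s z : pt e s z = s *: e + z.
Proof. by rewrite addrC. Qed.

Lemma ptD e s t z : pt e s (pt e t z) = pt e (s + t) z.
Proof. by rewrite !ptE scalerDl addrA. Qed.

Lemma pt0 e z : pt e 0 z = z.
Proof. by rewrite ptE scale0r add0r. Qed.

Lemma ptN e s z : pt (- e) s z = pt e (- s) z.
Proof. by rewrite !ptE scalerN scaleNr. Qed.

Lemma measurable_pt e (c : R) : measurable_fun
  [set: (measurableTypeR R * measurableTypeR R) * measurableTypeR R]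
  (fun w => pt e (c * w.2) w.1 : measurableTypeR R * measurableTypeR R).
Proof.
apply: measurable_fun_pair; apply: measurable_funD.
- by apply: (measurableT_comp measurable_fst); exact: measurable_fst.
- apply: measurable_funM; last exact: measurable_cst.
  by apply: measurable_funM; [exact: measurable_cst|exact: measurable_snd].
- by apply: (measurableT_comp measurable_snd); exact: measurable_fst.
- apply: measurable_funM; last exact: measurable_cst.
  by apply: measurable_funM; [exact: measurable_cst|exact: measurable_snd].
Qed.

Lemma measurable_pt1 e (c : R) z : measurable_fun [set: measurableTypeR R]
  (fun s => pt e (c * s) z : measurableTypeR R * measurableTypeR R).
Proof.
by apply: measurable_fun_pair; apply: measurable_funD => //;
   apply: measurable_funM => //; exact: measurable_funM.
Qed.

Lemma mu0t_lty t : (mu `[0%R, t]%classic < +oo)%E.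
Proof. by rewrite lebesgue_measure_itv/=; case: ifP => // _; rewrite -EFinB ltry. Qed.

(** The factor [c] lets one integrability lemma cover both sides of the adjointness relation below:
    [c = 1] moves the point along the segment, [c = 0] leaves it fixed. *)
Definition segK e (c : R) t P (w : (R * R) * R) : R :=
  P (pt e (c * w.2) w.1) * \1_(`[0, t]%classic) w.2.

(** With the parameter integrated last, every slice is a translate of [P], so the integral of the
    absolute value is the length of [[0, t]] times that of [P]. *)
Lemma integ3_seg e (c : R) t P : integ P ->
  integ3 (segK e c t P).
Proof.
move=> iP; have mP := integ_mfun iP.
set K := segK e c t P.
have mK : measurable_fun [set: (measurableTypeR R * measurableTypeR R) * measurableTypeR R] K.
  apply: measurable_funM.
    exact: (measurableT_comp mP (measurable_pt e c)).
  by apply: measurableT_comp => //; exact: measurable_indic.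
apply/integrableP; split; first exact/measurable_EFinP.
rewrite (@fubini_tonelli2 _ _ _ _ _ (@plane_measure R) mu)//=; last first.
  by apply/measurable_EFinP; exact: measurableT_comp.
rewrite /fubini_G/=.
under eq_integral => s _.
  have -> : (\int[leb2R]_z `|K (z, s)|%:E = (\1_(`[0, t]) s)%:E * \int[leb2R]_z `|P z|%:E)%E.
    under eq_integral do rewrite /K/segK/= normrM EFinM muleC.
    rewrite ge0_integralZl//=; last first.
      apply/measurable_EFinP; apply: measurableT_comp => //.
      by apply: (measurableT_comp mP); exact: measurable_trans2.
    rewrite ger0_norm ?indicE//.
    congr (_ * _)%E.
    rewrite -[RHS](@ge0_integral_trans2 R (c * s * e.1, c * s * e.2))//.
    by apply/measurable_EFinP; exact: measurableT_comp.
  over.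
rewrite ge0_integralZr//=.
- rewrite integral_indic// setIT.
  have mt : mu `[0, t]%classic \is a fin_num by rewrite lebesgue_measure_itv/=; case: ifP.
  by case/integrableP: iP => _ iP; apply: lte_mul_pinfty.
- by apply/measurable_EFinP; exact: measurable_indic.
- exact: integral_ge0.
Qed.

Lemma fubini_seg e c t P z :
  fubini_F mu (EFin \o segK e c t P) z =
  (\int[mu]_(s in `[0%R, t]) (P (pt e (c * s) z))%:E)%E.
Proof.
rewrite /fubini_F/segK/= [RHS]integral_mkcond; apply: eq_integral => s _.
by rewrite patchE indicE; case: ifP => _; rewrite ?mulr1 ?mulr0.
Qed.

Lemma pt_mul1 e s z : pt e (1 * s) z = pt e s z. Proof. by rewrite mul1r. Qed.

Lemma segK_patch e t P z : (fun s => (segK e 1 t P (z, s))%:E) =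
  (EFin \o (fun s => P (pt e s z))) \_ `[0, t].
Proof.
apply/funext => s /=.
by rewrite /segK patchE indicE pt_mul1; case: ifP => _; rewrite ?mulr1 ?mulr0.
Qed.

Lemma ae_integrable_seg e t P : integ P ->
  {ae leb2R, forall z, mu.-integrable `[0, t] (EFin \o (fun s => P (pt e s z)))}.
Proof.
move=> /(integ3_seg e 1 t) /ae_integrable1; apply: filterS => z h.
by apply/(integrable_mkcond _ _).2 => //; rewrite -segK_patch.
Qed.

Lemma integ_fine d (T : measurableType d) (m : {measure set T -> \bar R}) (F : T -> \bar R) :
  m.-integrable setT F -> m.-integrable setT (EFin \o (fine \o F)).
Proof.
move=> iF; apply: le_integrable (iF) => //.
- apply/measurable_EFinP; apply: measurableT_comp; first exact: fine_measurable.
  by case/integrableP: iF.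
- by move=> x _ /=; case: (F x) => [r| |] //=; rewrite normr0 leey.
Qed.

Lemma seg_fubini e t P z :
  seg e t P z = fine (fubini_F mu (EFin \o segK e 1 t P) z).
Proof. by rewrite fubini_seg /seg /Rintegral; under [in RHS]eq_integral do rewrite pt_mul1. Qed.

Lemma integ_seg e t P : integ P -> integ (seg e t P).
Proof.
move=> iP; have := integ_fine (integrable_fubini_F (integ3_seg e 1 t iP)).
by congr (_.-integrable _ _); apply/funext => z /=; rewrite seg_fubini.
Qed.

Lemma integ3_segM e (c : R) t P phi (C : R) : integ P -> measurable_fun [set: measurableTypeR R * measurableTypeR R] phi ->
  (forall z, `|phi z| <= C) -> integ3 (fun w => phi w.1 * segK e c t P w).
Proof.
move=> iP mphi phiC.
apply: (integM measurableT (c := C)) => //; last exact: integ3_seg.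
by apply: (measurableT_comp mphi); exact: measurable_fst.
Qed.

Lemma integral_segM e t P phi c : integ P -> measurable_fun [set: measurableTypeR R * measurableTypeR R] phi ->
    (forall z, `|phi z| <= c) ->
  (\int[leb2R]_z (phi z * seg e t P z)%:E =
   \int[leb2R]_z fubini_F mu (EFin \o (fun w : (R * R) * R => (phi w.1 * segK e 1 t P w)%R)) z)%E.
Proof.
move=> iP mphi phic; have iQ := integ3_segM e 1 t iP mphi phic.
set Q := (fun w => _) in iQ *.
apply: ae_eq_integral => //.
- apply/measurable_EFinP; apply: measurable_funM => //.
  exact: integ_mfun (integ_seg e t iP).
- by case/integrableP: (integrable_fubini_F iQ).
- apply: (ae_imp (ae_integrable_seg e t iP)) => z iz _ /=.
  have -> : fubini_F mu (EFin \o Q) z = (\int[mu]_s ((phi z)%:E * (segK e 1 t P (z, s))%:E))%E by [].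
  have i1 : mu.-integrable setT (EFin \o (fun s => segK e 1 t P (z, s))).
    have -> : EFin \o (fun s => segK e 1 t P (z, s)) = _ := segK_patch e t P z.
    by apply/(integrable_mkcond _ _).1.
  rewrite (integralZl _ i1)// EFinM; congr (_ * _)%E.
  have := fubini_seg e 1 t P z; rewrite /fubini_F => ->.
  rewrite /seg -integ_fin//.
  by under [in RHS]eq_integral do rewrite pt_mul1.
Qed.

(** Averaging along [e] and along [- e] are adjoint: for each fixed [s], translation invariance
    moves the shift from [P] onto [phi], and Fubini's theorem assembles the slices. *)
Lemma fubini_segM e t P phi c : integ P -> measurable_fun [set: measurableTypeR R * measurableTypeR R] phi ->
    (forall z, `|phi z| <= c) ->
  \int[leb2R]_z (phi z * seg e t P z) = \int[leb2R]_z (P z * seg (- e) t phi z).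
Proof.
move=> iP mphi phic.
pose Q (w : (R * R) * R) : R := phi w.1 * segK e 1 t P w.
pose Q' (w : (R * R) * R) : R := phi (pt e ((-1) * w.2) w.1) * segK e 0 t P w.
have iQ : integ3 Q by exact: integ3_segM.
have iQ' : integ3 Q'.
  apply: (integM measurableT (c := c)) => //; last exact: integ3_seg.
  by apply: (measurableT_comp mphi); exact: measurable_pt.
have lhs := integral_segM e t iP mphi phic.
have rhs : (\int[leb2R]_z (P z * seg (- e) t phi z)%:E = \int[leb2R]_z fubini_F mu (EFin \o Q') z)%E.
  apply: eq_integral => z _; rewrite EFinM.
  pose g s := phi (pt e ((-1) * s) z) * \1_(`[0, t]%classic) s.
  have -> : fubini_F mu (EFin \o Q') z = (\int[mu]_s ((P z)%:E * (g s)%:E))%E.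
    apply: eq_integral => s _; rewrite -EFinM /Q' /segK /g /= mul0r pt0; congr _%:E; ring.
  have mg : measurable_fun [set: measurableTypeR R] (fun s => phi (pt e ((-1) * s) z)).
    apply: (measurableT_comp mphi); exact: measurable_pt1.
  have i0 : mu.-integrable `[0, t] (EFin \o (fun s => phi (pt e ((-1) * s) z))).
    apply: measurable_bounded_integrable => //.
    - exact: mu0t_lty.
    - exact: measurable_funTS.
    - by exists c; split; [exact: num_real|move=> M cM s _; exact: le_trans (phic _) (ltW cM)].
  have g0 : EFin \o g = (EFin \o (fun s => phi (pt e ((-1) * s) z))) \_ `[0, t].
    by apply/funext => s; rewrite /g patchE/= indicE; case: ifP => _; rewrite ?mulr1 ?mulr0.
  have i1 : mu.-integrable setT (EFin \o g) by rewrite g0; apply/(integrable_mkcond _ _).1.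
  rewrite (integralZl _ i1)//; congr (_ * _)%E.
  rewrite g0 -integral_mkcond /seg -integ_fin//.
    by apply: eq_integral => s _ /=; rewrite ptN mulN1r.
  by apply: eq_integrable i0 => // s _ /=; rewrite ptN mulN1r.
rewrite /Rintegral; congr fine.
rewrite lhs rhs.
have := Fubini iQ; rewrite /fubini_F => ->; have := Fubini iQ' => ->.
apply: ae_eq_integral => //.
- exact: measurable_fubini_G iQ.
- exact: measurable_fubini_G iQ'.
apply: ae_imp (ae_and (ae_integrable2 iQ) (ae_integrable2 iQ')) _ => s [i1 i2] _.
rewrite [LHS]integ_fin// [RHS]integ_fin//; congr _%:E.
rewrite -[LHS](@Rintegral_trans2 R (-1 * s * e.1, -1 * s * e.2))//.
apply: eq_Rintegral => z _; rewrite /Q /Q' /segK /= -/(pt e _ z) ptD mul0r pt0.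
by rewrite mulN1r mul1r subrr pt0.
Qed.

(** Keeping the parameter [s] outermost allows a bound on the individual slices, uniform in [s], to
    be integrated over the segment. *)
Lemma fubini_slices e t P phi c : integ P -> measurable_fun [set: measurableTypeR R * measurableTypeR R] phi ->
    (forall z, `|phi z| <= c) ->
  let h s := \int[leb2R]_z (phi z * P (pt e s z)) in
  mu.-integrable `[0, t] (EFin \o h) /\
  \int[leb2R]_z (phi z * seg e t P z) = \int[mu]_(s in `[0, t]) h s.
Proof.
move=> iP mphi phic h; have iQ := integ3_segM e 1 t iP mphi phic.
set Q := (fun w => _) in iQ.
have hE s : fine (fubini_G (@plane_measure R) (EFin \o Q) s) = h s * \1_(`[0, t]%classic) s.
  rewrite /fubini_G /h -RintegralZr//; last first.
    by apply: (integM measurableT (c := c)) => //; exact: integ_trans2.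
  rewrite /Rintegral; congr fine; apply: eq_integral => z _ /=.
  by rewrite /Q /segK /= mul1r mulrA.
have hP : (EFin \o h) \_ `[0, t] = EFin \o (fine \o fubini_G (@plane_measure R) (EFin \o Q)).
  apply/funext => s; rewrite patchE /= hE indicE; case: ifP => _; by rewrite ?mulr1 ?mulr0.
have iG : mu.-integrable setT (fubini_G (@plane_measure R) (EFin \o Q)).
  apply/integrableP; split; first exact: measurable_fubini_G iQ.
  have mQ := integ_mfun iQ.
  have mQe := (measurable_EFinP setT Q).2 mQ.
  have H := (@integrable21ltyP _ _ _ _ R (@plane_measure R) mu _ mQe).1 iQ.
  apply: (le_lt_trans _ H); apply: ge0_le_integral => //.
  - by apply: measurableT_comp => //; exact: measurable_fubini_G iQ.
  - apply: (measurable_fun_fubini_tonelli_G (m1 := @plane_measure R) (fun w => `|(Q w)%:E|%E)) => //.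
    by apply/measurable_EFinP; exact: measurableT_comp.
  - move=> s _; apply: le_abse_integral => //; apply/measurable_EFinP.
    exact: measurableT_comp mQ (measurable_pair2 _).
split; first by apply/(integrable_mkcond _ _).2 => //; rewrite hP; exact: integ_fine.
rewrite [LHS]/Rintegral (integral_segM e t iP mphi phic) -/Q.
have := Fubini iQ; rewrite /fubini_F => ->.
rewrite /Rintegral [in RHS]integral_mkcond hP; congr fine.
apply: ae_eq_integral => //.
- exact: measurable_fubini_G iQ.
- by case/integrableP: (integ_fine iG).
- apply: ae_imp (integrable_ae measurableT iG) _ => s fs _ /=.
  by rewrite fineK//; exact: fs.
Qed.
End Seg.

(** * Functions that vanish almost everywhere *)

Section Dynkin.
Context {R : realType}.
Local Notation mu := (@lebesgue_measure R).
Local Notation leb2R := ((@lebesgue_measure R) \x (@lebesgue_measure R))%E.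
Local Notation integ P := (leb2R.-integrable setT (EFin \o P)).
Local Notation plane := (measurableTypeR R * measurableTypeR R)%type.

Lemma dynkin_zero d (S : measurableType d) (g : plane -> S) (W : set plane)
    (G : set (set S)) (q : plane -> R) :
  measurable_fun setT g -> measurable W -> integ q ->
  d.-measurable = <<s G >> -> setI_closed G ->
  (\int[leb2R]_(z in W) (q z)%:E = 0)%E ->
  (forall A, G A -> (\int[leb2R]_(z in g @^-1` A `&` W) (q z)%:E = 0)%E) ->
  forall A, measurable A -> (\int[leb2R]_(z in g @^-1` A `&` W) (q z)%:E = 0)%E.
Proof.
move=> mg mW iq mG GI W0 G0 A mA.
have mpre B : measurable B -> measurable (g @^-1` B).
  by move=> mB; rewrite -[X in measurable X]setTI; exact: mg.
have := mA; rewrite {1}mG.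
apply: (dynkin_induction (P := [set A | (\int[leb2R]_(z in g @^-1` A `&` W) (q z)%:E = 0)%E]) mG GI) => //=.
- by rewrite preimage_setT setTI.
- move=> B mB B0.
  have WE : W = (g @^-1` B `&` W) `|` (g @^-1` (~` B) `&` W).
    by rewrite -setIUl -preimage_setU setUv preimage_setT setTI.
  have := @integral_setU _ _ _ leb2R (g @^-1` B `&` W) (g @^-1` (~` B) `&` W) (EFin \o q).
  rewrite -WE /= W0 B0 add0e => <- //.
  + exact: measurableI (mpre _ mB) mW.
  + exact: measurableI (mpre _ (measurableC mB)) mW.
  + by apply/measurable_EFinP; apply: measurable_funTS; exact: integ_mfun iq.
  + apply/disj_setPS => z [[/= Bz _] [/= nBz _]]; exact: nBz.
- move=> F mF tF F0.
  have -> : g @^-1` (\bigcup_k F k) `&` W = \bigcup_k (g @^-1` (F k) `&` W).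
    by rewrite preimage_bigcup setI_bigcupl.
  rewrite integral_bigcup//.
  + by under eq_eseriesr do rewrite F0; rewrite eseries0.
  + apply/trivIsetP => i j _ _ ij.
    move/trivIsetP : tF => /(_ i j I I ij) h.
    by rewrite setIACA -preimage_setI h preimage_set0 set0I.
  + by move=> k; exact: measurableI (mpre _ (mF k)) mW.
  + apply: integrableS iq => //; apply: bigcupT_measurable => k.
    exact: measurableI (mpre _ (mF k)) mW.
Qed.

Lemma RGenOpens_setI : setI_closed (@RGenOpens.G R).
Proof.
move=> _ _ [a [b ->]] [c [e ->]]; exists (Num.max a c), (Num.min b e).
apply/seteqP; split => x /=; rewrite !in_itv/=.
  by move=> [/andP[? ?] /andP[? ?]]; rewrite gt_max lt_min; apply/andP; split; apply/andP.
by rewrite gt_max lt_min => /andP[/andP[-> ->] /andP[-> ->]].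
Qed.

(** Intervals are widened to Borel sets one coordinate at a time, and products of Borel sets to all
    Borel sets of the plane. The set where [q >= 0] and its complement then show that the integral
    of [|q|] is zero. *)
Lemma ae0_of_rectangles (q : plane -> R) (a0 b0 c0 e0 : R) : integ q ->
  (forall z, ~ (`]a0, b0[%classic `*` `]c0, e0[%classic) z -> q z = 0) ->
  (forall a b c e : R, (\int[leb2R]_(z in `]a, b[%classic `*` `]c, e[%classic) (q z)%:E = 0)%E) ->
  {ae leb2R, forall z, q z = 0}.
Proof.
move=> iq qout q0.
have GE : (measurable : set (set (measurableTypeR R))) = <<s (@RGenOpens.G R) >>.
  exact: RGenOpens.measurableE.
have mitv (a b : R) : measurable (`]a, b[%classic : set (measurableTypeR R)) by exact: measurable_itv.
have restr (X Y : set plane) : (forall z, q z != 0 -> X z <-> Y z) ->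
    (\int[leb2R]_(z in X) (q z)%:E = \int[leb2R]_(z in Y) (q z)%:E)%E.
  move=> XY; rewrite [LHS]integral_mkcond [RHS]integral_mkcond; apply: eq_integral => z _.
  rewrite !patchE; have [q_0|qn0] := eqVneq (q z) 0; first by rewrite q_0; do 2 case: ifP.
  by congr (if _ then _ else _); apply/idP/idP => /set_mem h; apply/mem_set/XY.
have qin z : q z != 0 -> (`]a0, b0[%classic `*` `]c0, e0[%classic) z.
  by move=> qn0; apply: contrapT => /qout h; rewrite h eqxx in qn0.
(* The whole line is not one of the tested intervals; as [q] vanishes outside the reference
   rectangle, []a0, b0[] stands in for it. *)
have qT (c e : R) : (\int[leb2R]_(z in setT `*` `]c, e[%classic) (q z)%:E = 0)%E.
  rewrite -[RHS](q0 a0 b0 c e); apply: restr => z /qin[z1 _].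
  by split => -[].
have q1 (A : set (measurableTypeR R)) (c e : R) : measurable A ->
    (\int[leb2R]_(z in A `*` `]c, e[%classic) (q z)%:E = 0)%E.
  have := @dynkin_zero _ _ fst (setT `*` `]c, e[%classic) (@RGenOpens.G R) q measurable_fst
    (measurableX measurableT (mitv _ _)) iq GE RGenOpens_setI (qT c e).
  have E (B : set R) : fst @^-1` B `&` (setT `*` `]c, e[%classic) = B `*` `]c, e[%classic.
    by apply/seteqP; split => [[x y]/= [? []]|[x y] /= []].
  move=> h mA; rewrite -E; apply: h mA => _ [a [b ->]]; rewrite E; exact: q0.
have qT2 (A : set (measurableTypeR R)) : measurable A ->
    (\int[leb2R]_(z in A `*` setT) (q z)%:E = 0)%E.
  move=> mA; rewrite -[RHS](q1 A c0 e0 mA); apply: restr => z /qin[_ z2].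
  by split => -[].
have q2 (A B : set (measurableTypeR R)) : measurable A -> measurable B ->
    (\int[leb2R]_(z in A `*` B) (q z)%:E = 0)%E.
  move=> mA; have := @dynkin_zero _ _ snd (A `*` setT) (@RGenOpens.G R) q measurable_snd
    (measurableX mA measurableT) iq GE RGenOpens_setI (qT2 A mA).
  have E (C : set R) : snd @^-1` C `&` (A `*` setT) = A `*` C.
    by apply/seteqP; split => [[x y]/= [? []]|[x y] /= []].
  move=> h mB; rewrite -E; apply: h mB => _ [a [b ->]]; rewrite E; exact: q1.
have q3 (X : set plane) : measurable X -> (\int[leb2R]_(z in X) (q z)%:E = 0)%E.
  have := @dynkin_zero _ _ idfun setT
    [set A `*` B | A in (measurable : set (set (measurableTypeR R))) &
                   B in (measurable : set (set (measurableTypeR R)))] q.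
  move=> h mX; rewrite -[X]setIT; apply: h mX => //.
  - exact: measurable_id.
  - exact: measurable_prod_measurableType.
  - move=> _ _ [A mA [B mB <-]] [C mC [E mE <-]]; exists (A `&` C); first exact: measurableI.
    by exists (B `&` E); [exact: measurableI|rewrite setXI].
  - by rewrite -setXTT; exact: q2.
  - by move=> _ [A mA [B mB <-]]; rewrite setIT; exact: q2.
have mq := integ_mfun iq.
have mX : measurable [set z | 0 <= q z].
  rewrite -[X in measurable X]setTI; have -> : [set z | 0 <= q z] = q @^-1` `[0, +oo[%classic.
    by apply/seteqP; split => z /=; rewrite in_itv/= andbT.
  exact: mq.
have q4 : (\int[leb2R]_z `|(EFin \o q) z| = 0)%E.
  rewrite -(setUv [set z | 0 <= q z]) ge0_integral_setU//=.
  - rewrite (eq_integral (EFin \o q)); last first.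
      by move=> z /set_mem/= qz; rewrite ger0_norm.
    rewrite q3// add0e (eq_integral (fun z => (-1)%:E * (EFin \o q) z)%E); last first.
      by move=> z /set_mem/= /negP; rewrite -ltNge => qz; rewrite ltr0_norm// -EFinM mulN1r.
    have mC := measurableC mX.
    rewrite integralZl//=; first by rewrite q3 ?mule0.
    exact: integrableS iq.
  - exact: measurableC.
  - by rewrite setUv; apply/measurable_EFinP; exact: measurableT_comp.
  - by apply/disj_setPS => z [].
have h : ae_eq leb2R setT (EFin \o q) (cst 0%E).
  by apply/(ae_eq_integral_abs leb2R measurableT) => //; exact/measurable_EFinP.
by apply: ae_imp h _ => z /(_ I) /= [].
Qed.

Lemma ae0_of_bumps (q : plane -> R) (a0 b0 c0 e0 : R) : integ q ->
  (forall z, ~ (`]a0, b0[%classic `*` `]c0, e0[%classic) z -> q z = 0) ->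
  (forall n a b c e, a0 <= a -> b <= b0 -> c0 <= c -> e <= e0 -> 
    \int[leb2R]_z (bumpn n.+1 a b z.1 * bumpn n.+1 c e z.2 * q z) = 0) ->
  {ae leb2R, forall z, q z = 0}.
Proof.
move=> iq qout h; apply: ae0_of_rectangles (iq) (qout) _ => a b c e.
(* The hypothesis concerns only bumps inside the reference rectangle. Clipping the interval loses
   nothing, because [q] is zero outside. *)
pose a' := Num.max a a0; pose b' := Num.min b b0.
pose c' := Num.max c c0; pose e' := Num.min e e0.
pose F n z := bumpn n.+1 a' b' z.1 * bumpn n.+1 c' e' z.2 * q z.
have mb n (x y : R) : measurable_fun setT (bumpn n.+1 x y).
  by apply: continuous_measurable_fun; exact/smooth_continuous/smooth_bumpn.
have mbb n : measurable_fun [set: measurableTypeR R * measurableTypeR R] (fun z : plane => bumpn n.+1 a' b' z.1 * bumpn n.+1 c' e' z.2).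
  by apply: measurable_funM; apply: (measurableT_comp (mb _ _ _)).
have b1 n x y z : `|bumpn n x y z| <= 1 :> R.
  by have /andP[? ?] := bumpn_itv n x y z; rewrite ger0_norm.
have bb n z : `|bumpn n.+1 a' b' z.1 * bumpn n.+1 c' e' z.2| <= 1.
  by rewrite normrM -[leRHS]mulr1 ler_pM.
have iF n : integ (F n) by apply: (integM measurableT (c := 1)).
have F0 n : (\int[leb2R]_z (F n z)%:E = 0)%E.
  by rewrite integ_fin// h// /a' /b' /c' /e' ?le_max ?ge_min ?lexx ?orbT.
have mi (x y : R) : measurable_fun setT (\1_(`]x, y[%classic) : R -> R).
  by apply: measurable_indic; exact: measurable_itv.
pose f z := \1_(`]a', b'[%classic) z.1 * \1_(`]c', e'[%classic) z.2 * q z.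
have mf : measurable_fun [set: measurableTypeR R * measurableTypeR R] f.
  apply: measurable_funM; last exact: integ_mfun iq.
  by apply: measurable_funM; apply: (measurableT_comp (mi _ _)).
have fE : (\int[leb2R]_(z in `]a, b[%classic `*` `]c, e[%classic) (q z)%:E = \int[leb2R]_z (f z)%:E)%E.
  rewrite integral_mkcond; apply: eq_integral => z _; rewrite patchE /f.
  have [->|qn0] := eqVneq (q z) 0; first by rewrite mulr0; case: ifP.
  have [/= + +] : (`]a0, b0[%classic `*` `]c0, e0[%classic) z.
    by apply: contrapT => /qout h'; rewrite h' eqxx in qn0.
  rewrite !in_itv/= => /andP[x0 x1] /andP[y0 y1].
  rewrite !indicE !mem_setE !in_itv/= !gt_max !lt_min x0 x1 y0 y1 !andbT.
  case: ifPn => [/set_mem[/=]|/negP zn]; first by rewrite !in_itv/= => -> ->; rewrite !mul1r.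
  case: (boolP (a < z.1 < b)) => h1; rewrite ?mul0r//.
  case: (boolP (c < z.2 < e)) => h2; rewrite ?mulr0 ?mul0r//.
  by exfalso; apply: zn; apply/mem_set; split; rewrite /= in_itv/=.
have cFf z : (fun n => F n z) @ \oo --> f z.
  have bc x y w : (fun n => bumpn n.+1 x y w) @ \oo --> (\1_(`]x, y[%classic) w : R).
    by have := @bumpn_cvg R x y w; rewrite -(cvg_shiftS (fun n => bumpn n x y w)).
  by apply: cvgM; [apply: cvgM; exact: bc|exact: cvg_cst].
have Fq n z : `|F n z| <= `|q z| by rewrite normrM ler_piMl.
have [_] := @Rdominated_convergence R _ _ leb2R setT measurableT F f (fun z => `|q z|)
  (fun n => integ_mfun (iF n)) mf (fun z _ => cFf z) (integ_abs iq) (fun n z _ => Fq n z).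
rewrite fE integ_fin//; last first.
  apply: (@integ_le _ _ _ _ _ measurableT _ (fun z => `|q z|)) => //; last exact: integ_abs.
  move=> z _.
  rewrite normrM ler_piMl// normrM !indicE !normr_nat.
  by do 2 case: (_ \in _); rewrite ?mulr0 ?mul0r ?mulr1.
have -> : (fun n => \int[leb2R]_z F n z) = fun=> 0.
  by apply/funext => n; rewrite /Rintegral F0.
by move/(cvg_lim (@Rhausdorff R)) => <-; rewrite lim_cst.
Qed.
End Dynkin.

(** * From weak derivatives to differences along lines *)

Section WeakToLine.
Context {R : realType}.
Local Notation mu := (@lebesgue_measure R).
Local Notation leb2R := ((@lebesgue_measure R) \x (@lebesgue_measure R))%E.
Local Notation integ P := (leb2R.-integrable setT (EFin \o P)).
Local Notation e1 := ((1, 0) : R * R).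
Local Notation e2 := ((0, 1) : R * R).
Implicit Types (P V : R * R -> R) (e z : R * R) (s t : R) (O K : set (R * R)).

Definition bump2 n (a b c d : R) z : R := bumpn n.+1 a b z.1 * bumpn n.+1 c d z.2.

Lemma measurable_bumpn n a b : measurable_fun setT (bumpn n a b : R -> R).
Proof. by apply: continuous_measurable_fun; exact/smooth_continuous/smooth_bumpn. Qed.

Lemma measurable_bump2 n a b c d : measurable_fun [set: measurableTypeR R * measurableTypeR R] (bump2 n a b c d).
Proof. by apply: measurable_funM; apply: (measurableT_comp (measurable_bumpn _ _ _)). Qed.

Lemma bump2_le1 n a b c d z : `|bump2 n a b c d z| <= 1.
Proof.
have /andP[? ?] := bumpn_itv n.+1 a b z.1; have /andP[? ?] := bumpn_itv n.+1 c d z.2.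
by rewrite normrM -[leRHS]mulr1 ler_pM// ger0_norm.
Qed.

(** The hypothesis is the conclusion tested against a bump, with the translation of [V] moved to the
    bump by invariance and the average of [P] moved to it by adjointness. *)
Lemma line_of_bumps e t z0 (r : R) V P : 0 < t -> integ V -> integ P ->
  (forall n a b c d, z0.1 - r <= a -> b <= z0.1 + r -> z0.2 - r <= c -> d <= z0.2 + r ->
    \int[leb2R]_z ((bump2 n a b c d z - bump2 n a b c d (pt e (- t) z)) * V z) =
    - \int[leb2R]_z (P z * seg (- e) t (bump2 n a b c d) z)) ->
  {ae leb2R, forall z, ball z0 r z -> V (pt e t z) - V z = seg e t P z}.
Proof.
move=> t0 iV iP h.
pose q0 z := V (pt e t z) - V z - seg e t P z.
have iVt : integ (V \o pt e t) by exact: integ_trans2.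
have iq0 : integ q0.
  exact: (integB measurableT (integB measurableT iVt iV) (integ_seg e t iP)).
pose B : set (R * R) := `]z0.1 - r, z0.1 + r[%classic `*` `]z0.2 - r, z0.2 + r[%classic.
pose q z := \1_B z * q0 z.
have mB : measurable (B : set (measurableTypeR R * measurableTypeR R)).
  by apply: measurableX; exact: measurable_itv.
have iq : integ q.
  apply: (integM measurableT (c := 1)) => // z _.
  by rewrite indicE; case: (_ \in _); rewrite ?normr1 ?normr0.
have : {ae leb2R, forall z, q z = 0}.
  apply: (ae0_of_bumps (a0 := z0.1 - r) (b0 := z0.1 + r) (c0 := z0.2 - r) (e0 := z0.2 + r)) => //.
    by move=> z nBz; rewrite /q indicE memNset// mul0r.
  move=> n a b c d ha hb hc hd.
  have := h n a b c d ha hb hc hd; set phi := bump2 n a b c d => h1.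
  have mphi : measurable_fun [set: measurableTypeR R * measurableTypeR R] phi by exact: measurable_bump2.
  have phi1 z : `|phi z| <= 1 by exact: bump2_le1.
  have -> : (fun z => bumpn n.+1 a b z.1 * bumpn n.+1 c d z.2 * q z) = (fun z => phi z * V (pt e t z) - phi z * V z - phi z * seg e t P z).
    apply/funext => z; rewrite -/(bump2 n a b c d z) -/phi /q indicE.
    have [Bz|nBz] := pselect (B z); first by rewrite mem_set// mul1r /q0; ring.
    suff -> : phi z = 0 by rewrite !mul0r !subr0.
    rewrite /phi /bump2; move: nBz => /not_andP[] /= /negP nz; [|rewrite mulrC];
      rewrite bumpn_out ?mul0r//; apply: contra nz; rewrite !in_itv/= => /andP[? ?]; apply/andP; split; lra.
  have iM W : integ W -> integ (fun z => phi z * W z) by move=> iW; exact: (integM measurableT (c := 1)).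
  have i1 := iM _ iVt; have i2 := iM _ iV; have i3 := iM _ (integ_seg e t iP).
  rewrite RintegralB//; last exact: integB.
  rewrite RintegralB// (fubini_segM e t iP mphi phi1).
  have -> : \int[leb2R]_z (phi z * V (pt e t z)) = \int[leb2R]_z (phi (pt e (- t) z) * V z).
    rewrite -[LHS](@Rintegral_trans2 R (- t * e.1, - t * e.2))//.
    by apply: eq_Rintegral => z _; rewrite -/(pt e (- t) z) ptD subrr pt0.
  have i4 : integ (fun z => phi (pt e (- t) z) * V z).
    apply: (integM measurableT (c := 1)) => //; apply: measurableT_comp => //; exact: measurable_trans2.
  have := h1; under eq_Rintegral do rewrite mulrBl.
  by rewrite RintegralB// => h2; rewrite -[X in X - _]opprB h2 opprK subrr.
move=> q00; apply: (ae_imp q00) => z + Bz; rewrite /q indicE mem_set ?mul1r.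
  by rewrite /q0 => /eqP; rewrite subr_eq0 => /eqP.
by case: Bz; rewrite /ball/= !ltr_distlC => ? ?; split; rewrite /= in_itv.
Qed.

Lemma test_tensor O (A B : R -> R) (a b c d : R) : smooth A -> smooth B ->
  (forall x, x \notin `[a, b] -> A x = 0) -> (forall x, x \notin `[c, d] -> B x = 0) ->
  `[a, b]%classic `*` `[c, d]%classic `<=` O ->
  test_function O (fun z => A z.1 * B z.2).
Proof.
move=> sA sB A0 B0 BO.
have cB : compact (`[a, b]%classic `*` `[c, d]%classic).
  by apply: compact_setX; exact: segment_compact.
have clB : closed (`[a, b]%classic `*` `[c, d]%classic).
  by apply: compact_closed => //; exact: norm_hausdorff.
have sub : closure [set z | A z.1 * B z.2 != 0] `<=` `[a, b]%classic `*` `[c, d]%classic.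
  rewrite closureE; apply: smallest_sub => // z /= /eqP h.
  split => /=; apply: contrapT => /negP n; apply: h; first by rewrite A0// mul0r.
  by rewrite B0// mulr0.
split; first by move=> n; exact: Cn_tensor.
split; last exact: subset_trans BO.
by apply: subclosed_compact cB _ => //; exact: closed_closure.
Qed.

Lemma pt_e1 s z : pt e1 s z = (z.1 + s, z.2).
Proof. by rewrite /pt /trans2/= mulr1 mulr0 addr0. Qed.

Lemma pt_e2 s z : pt e2 s z = (z.1, z.2 + s).
Proof. by rewrite /pt /trans2/= mulr1 mulr0 addr0. Qed.

Lemma integ_bumpn t n a b (x : R) :
  mu.-integrable `[0, t] (EFin \o (fun s => bumpn n a b (x - s))).
Proof.
apply: measurable_bounded_integrable => //; first exact: mu0t_lty.
  by apply: (measurableT_comp (measurable_bumpn _ _ _)); exact: measurable_funB.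
exists 1; split; [exact: num_real|move=> M cM s _ /=].
by have /andP[? ?] := bumpn_itv n a b (x - s); rewrite ger0_norm// (le_trans _ (ltW cM)).
Qed.

Lemma steklovM t n a b (x r : R) :
  steklov t (bumpn n a b) x * r = \int[mu]_(s in `[0, t]) (bumpn n a b (x - s) * r).
Proof.
have mI : measurable (`[0%R, t]%classic : set (measurableTypeR R)) by exact: measurable_itv.
have := @RintegralZr _ _ R mu `[0%R, t]%classic _ r mI (integ_bumpn t n a b x).
by move=> ->.
Qed.

Lemma bump_box z0 (r a b c d : R) : z0.1 - 3 * r <= a -> b <= z0.1 + 3 * r ->
  z0.2 - 3 * r <= c -> d <= z0.2 + 3 * r -> 0 < r ->
  `[a, b]%classic `*` `[c, d]%classic `<=` ball z0 (4 * r).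
Proof.
move=> ha hb hc hd r0 [x y] [/=]; rewrite !in_itv/= => /andP[? ?] /andP[? ?].
by split; rewrite /ball/= ltr_distlC; apply/andP; split; lra.
Qed.

Lemma bumpn_out_cc n (a b x : R) : x \notin `[a, b] -> bumpn n.+1 a b x = 0.
Proof.
move=> h; apply: bumpn_out => //; apply: contra h.
by rewrite !in_itv/= => /andP[/ltW-> /ltW->].
Qed.

(** The test function is a bump whose first factor is replaced by its Steklov average: its
    derivative is the difference of the bump and its translate. The bump sits within [2 * r], the
    average reaches [t < r] further, and the closed support must lie in the open ball of radius
    [4 * r]. *)
Lemma weak_line1 O z0 (r t : R) V P : 0 < t < r -> ball z0 (4 * r) `<=` O ->
  integ V -> integ P ->
  (forall psi, test_function O psi ->
     \int[leb2R]_z (V z * d1 psi z) = - \int[leb2R]_z (P z * psi z)) ->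
  {ae leb2R, forall z, ball z0 (2 * r) z -> V (pt e1 t z) - V z = seg e1 t P z}.
Proof.
move=> /andP[t0 tr] bO iV iP hw; apply: line_of_bumps => // n a b c d ha hb hc hd.
have st : forall x : R, is_derive x (1 : R) (steklov t (bumpn n.+1 a b))
    (bumpn n.+1 a b x - bumpn n.+1 a b (x - t)).
  apply: (steklov_derive (p := a) (q := b)) => //.
    exact/smooth_continuous/smooth_bumpn.
  by move=> x; exact: bumpn_out_cc.
have := hw (fun z => steklov t (bumpn n.+1 a b) z.1 * bumpn n.+1 c d z.2).
rewrite (d1_tensor (bumpn n.+1 c d) st) => h.
have -> : \int[leb2R]_z ((bump2 n a b c d z - bump2 n a b c d (pt e1 (- t) z)) * V z) =
  \int[leb2R]_z (V z * ((bumpn n.+1 a b z.1 - bumpn n.+1 a b (z.1 - t)) * bumpn n.+1 c d z.2)).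
  by apply: eq_Rintegral => z _; rewrite pt_e1 /bump2/=; ring.
rewrite h; last first.
  apply: (test_tensor (a := a) (b := b + t) (c := c) (d := d)).
  - exact: smooth_steklov.
  - exact: smooth_bumpn.
  - by move=> x; exact: steklov_out.
  - by move=> x; exact: bumpn_out_cc.
  - by apply: subset_trans bO; apply: bump_box; lra.
congr (- _); apply: eq_Rintegral => z _; congr (_ * _).
rewrite steklovM.
by apply: eq_Rintegral => s _; rewrite ptN pt_e1 /bump2.
Qed.

Lemma weak_line2 O z0 (r t : R) V P : 0 < t < r -> ball z0 (4 * r) `<=` O ->
  integ V -> integ P ->
  (forall psi, test_function O psi ->
     \int[leb2R]_z (V z * d2 psi z) = - \int[leb2R]_z (P z * psi z)) ->
  {ae leb2R, forall z, ball z0 (2 * r) z -> V (pt e2 t z) - V z = seg e2 t P z}.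
Proof.
move=> /andP[t0 tr] bO iV iP hw; apply: line_of_bumps => // n a b c d ha hb hc hd.
have st : forall x : R, is_derive x (1 : R) (steklov t (bumpn n.+1 c d))
    (bumpn n.+1 c d x - bumpn n.+1 c d (x - t)).
  apply: (steklov_derive (p := c) (q := d)) => //.
    exact/smooth_continuous/smooth_bumpn.
  by move=> x; exact: bumpn_out_cc.
have := hw (fun z => bumpn n.+1 a b z.1 * steklov t (bumpn n.+1 c d) z.2).
rewrite (d2_tensor (bumpn n.+1 a b) st) => h.
have -> : \int[leb2R]_z ((bump2 n a b c d z - bump2 n a b c d (pt e2 (- t) z)) * V z) =
  \int[leb2R]_z (V z * (bumpn n.+1 a b z.1 * (bumpn n.+1 c d z.2 - bumpn n.+1 c d (z.2 - t)))).
  by apply: eq_Rintegral => z _; rewrite pt_e2 /bump2/=; ring.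
rewrite h; last first.
  apply: (test_tensor (a := a) (b := b) (c := c) (d := d + t)).
  - exact: smooth_bumpn.
  - exact: smooth_steklov.
  - by move=> x; exact: bumpn_out_cc.
  - by move=> x; exact: steklov_out.
  - by apply: subset_trans bO; apply: bump_box; lra.
congr (- _); apply: eq_Rintegral => z _; congr (_ * _).
rewrite [bumpn _ a b _ * _]mulrC steklovM.
by apply: eq_Rintegral => s _; rewrite ptN pt_e2 /bump2 mulrC.
Qed.

Lemma ae_seq (I : eqType) (s : seq I) (Q : I -> R * R -> Prop) :
  (forall i, i \in s -> {ae leb2R, forall z, Q i z}) ->
  {ae leb2R, forall z, forall i, i \in s -> Q i z}.
Proof.
elim: s => [|i s IH] h; first by apply: ae_all.
apply: (ae_imp (ae_and (h i (mem_head _ _)) (IH _))) => [j js|z [Qi Qs] j].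
  by apply: h; rewrite inE js orbT.
by rewrite inE => /predU1P[->//|]; exact: Qs.
Qed.

Lemma finite_ball_cover O K : open O -> compact K -> K `<=` O ->
  exists2 S : seq ((R * R) * R),
    (forall i, i \in S -> 0 < i.2 /\ ball i.1 (4 * i.2) `<=` O) &
    forall z, K z -> exists2 i, i \in S & ball i.1 i.2 z.
Proof.
move=> oO cK KO.
pose valid (i : (R * R) * R) := 0 < i.2 /\ ball i.1 (4 * i.2) `<=` O.
(* This is the filter of finite sequences ordered by inclusion. Compactness in the near-covering
   form, applied to it, turns a ball at each point into one finite sequence good for all of [K];
   pairs that are not [valid] are discarded afterwards. *)
pose F : set_system (seq ((R * R) * R)) :=
  [set X | exists s0 : seq ((R * R) * R), forall s : seq ((R * R) * R), {subset s0 <= s} -> X s].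
have FF : Filter F.
  split.
  - by exists [::].
  - move=> X Y [s1 h1] [s2 h2]; exists (s1 ++ s2) => s hs; split.
      by apply: h1 => i i1; apply: hs; rewrite mem_cat i1.
    by apply: h2 => i i2; apply: hs; rewrite mem_cat i2 orbT.
  - by move=> X Y XY [s h]; exists s => s' /h/XY.
move: cK => /compact_near_coveringP /(_ _ F (fun (s : seq ((R * R) * R)) z => exists2 i, i \in s /\ valid i & ball i.1 i.2 z) FF).
case=> [z Kz|s /(_ s (fun _ => id)) h].
  have /nbhs_ballP[r/= r0 rO] : nbhs z O by apply: open_nbhs_nbhs; split => //; exact: KO.
  exists (ball z (r / 4), [set s : seq ((R * R) * R) | (z, r / 4) \in s]) => /=.
    split; first by apply: nbhsx_ballx; lra.
    by exists [:: (z, r / 4)] => ss; apply; exact: mem_head.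
  move=> [y s] /= [zy zs]; exists (z, r / 4) => //; split => //; split => /=; first lra.
  by rewrite mulrC divfK.
exists [seq i <- s | `[< valid i >]] => [i|z Kz]; first by rewrite mem_filter => /andP[/asboolP].
by have [i [si vi] iz] := h z Kz; exists i => //; rewrite mem_filter si andbT; apply/asboolP.
Qed.

(** [t0] is the smallest radius of a finite cover, so a step of length less than [t0] that starts or
    ends in one of its balls starts in the ball of twice the radius. Both ends matter: a difference
    of functions supported in [K] is nonzero as soon as one end is in [K]. *)
Lemma compact_local_ae O K e (D : R -> R * R -> Prop) :
  open O -> compact K -> K `<=` O ->
  `|e.1| <= 1 -> `|e.2| <= 1 ->
  (forall z0 r t, 0 < t < r -> ball z0 (4 * r) `<=` O ->
     {ae leb2R, forall z, ball z0 (2 * r) z -> D t z}) ->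
  exists2 t0, 0 < t0 & forall t, 0 < t < t0 ->
    {ae leb2R, forall z, K z \/ K (pt e t z) -> D t z}.
Proof.
move=> oO cK KO he1 he2 hD.
have [S SD KS] := finite_ball_cover oO cK KO.
have [t0 t00 t0S] : exists2 t0, 0 < t0 & forall i, i \in S -> t0 <= i.2.
  have : forall i, i \in S -> 0 < i.2 by move=> i /SD[].
  elim: S {SD KS} => [|i s IH] hs; first by exists 1.
  have [j js|t1 t10 t1s] := IH _; first by apply: hs; rewrite inE js orbT.
  exists (Num.min i.2 t1); first by rewrite lt_min t10 hs// mem_head.
  move=> j; rewrite inE => /predU1P[->|/t1s h]; first by rewrite ge_min lexx.
  by rewrite ge_min h orbT.
exists t0 => // t /andP[t_0 tt0].
have : {ae leb2R, forall z, forall i, i \in S -> ball i.1 (2 * i.2) z -> D t z}.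
  apply: ae_seq => i iS; have [i0 iO] := SD _ iS.
  by apply: hD => //; rewrite t_0 (lt_le_trans tt0)// t0S.
move=> H; apply: (ae_imp H) => z hz.
have bound i w : i \in S -> ball i.1 i.2 w -> (w = z \/ w = pt e t z) -> D t z.
  move=> iS [/= b1 b2] wz; have ti := lt_le_trans tt0 (t0S _ iS).
  apply: (hz i iS); case: wz => wz; subst w.
    by split; apply: le_ball (b1) || apply: le_ball (b2); lra.
  move: b1 b2; rewrite /ball/= /trans2/= !ltr_distlC => /andP[? ?] /andP[? ?].
  move: he1 he2; rewrite !ler_norml => /andP[? ?] /andP[? ?].
  by split; rewrite /ball/= ltr_distlC; apply/andP; split; nra.
by move=> [/KS[i iS bi]|/KS[i iS bi]]; apply: (bound i _ iS bi); [left|right].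
Qed.

End WeakToLine.

(** * The chain rule in one direction *)

Section LineChainRule.
Context {R : realType}.
Local Notation mu := (@lebesgue_measure R).
Local Notation leb2R := ((@lebesgue_measure R) \x (@lebesgue_measure R))%E.
Local Notation integ P := (leb2R.-integrable setT (EFin \o P)).
Implicit Types (v p P phi dphi : R * R -> R) (e z : R * R) (s t : R) (K : set (R * R)).

Lemma fine_mu0t t : 0 <= t -> fine (mu `[0%R, t]%classic) = t.
Proof.
move=> t0; rewrite lebesgue_measure_itv/= lte_fin.
by case: ltP => /= h; rewrite ?subr0//; lra.
Qed.

Lemma seg_cst e t (c : R) z : 0 <= t -> seg e t (fun=> c) z = c * t.
Proof. by move=> t0; rewrite /seg Rintegral_cst// fine_mu0t. Qed.

Lemma integral_seg e t P : 0 <= t -> integ P ->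
  \int[leb2R]_z seg e t P z = t * \int[leb2R]_z P z.
Proof.
move=> t0 iP.
have := @fubini_segM R e t P (fun=> 1) 1 iP (measurable_cst _) (fun=> _).
under eq_Rintegral do rewrite mul1r.
move=> -> => [|_]; last by rewrite normr1.
by under eq_Rintegral do rewrite seg_cst// mul1r; rewrite RintegralZr// mulrC.
Qed.

Lemma seg_sqr e t P : 0 <= t -> integ P -> integ (fun z => P z ^+ 2) ->
  {ae leb2R, forall z, seg e t P z ^+ 2 <= t * seg e t (fun z => P z ^+ 2) z}.
Proof.
move=> t0 iP iP2.
apply: (ae_imp (ae_and (ae_integrable_seg e t iP) (ae_integrable_seg e t iP2))) => z [i1 i2].
have [_] := @cauchy_schwarz1 _ _ _ mu `[0, t]%classic (measurable_itv _) (fun s => P (pt e s z))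
  (mu0t_lty t) (integ_mfun i1) i2.
rewrite fine_mu0t//; apply: le_trans.
rewrite -[leLHS]real_normK ?num_real// ler_sqr ?nnegrE ?Rintegral_ge0//.
exact: le_normr_Rintegral.
Qed.

Lemma integ_seg_sqr e t P : 0 <= t -> integ P -> integ (fun z => P z ^+ 2) ->
  integ (fun z => seg e t P z ^+ 2) /\
  \int[leb2R]_z seg e t P z ^+ 2 <= t ^+ 2 * \int[leb2R]_z P z ^+ 2.
Proof.
move=> t0 iP iP2; have sq := seg_sqr e t0 iP iP2.
have i2 := integZ measurableT t (integ_seg e t iP2).
have i1 : integ (fun z => seg e t P z ^+ 2).
  apply: (integ_ae_le measurableT _ _ i2).
    by apply: measurable_funX; exact: integ_mfun (integ_seg e t iP).
  by apply: (ae_imp sq) => z h _; rewrite ger0_norm ?sqr_ge0.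
split => //.
rewrite expr2 -mulrA -(integral_seg e)// -RintegralZl//; last exact: integ_seg.
by apply: ae_le_Rint => //; apply: (ae_imp sq).
Qed.

Lemma slices_bound e t P phi (C h0 c : R) : 0 <= t -> integ P ->
  measurable_fun [set: measurableTypeR R * measurableTypeR R] phi -> (forall z, `|phi z| <= C) ->
  (forall s, 0 <= s <= t -> `|\int[leb2R]_z (phi z * P (pt e s z)) - h0| <= c) ->
  `|\int[leb2R]_z (phi z * seg e t P z) - t * h0| <= t * c.
Proof.
move=> t0 iP mphi phiC hs.
have [ih ->] := fubini_slices e t iP mphi phiC.
have icst (k : R) : mu.-integrable `[0, t] (EFin \o (fun=> k)).
  by apply: integ_cst => //; exact: mu0t_lty.
have E (k : R) : \int[mu]_(s in `[0, t]) k = t * k by rewrite Rintegral_cst// fine_mu0t// mulrC.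
have mI : measurable (`[0%R, t]%classic : set (measurableTypeR R)) by exact: measurable_itv.
set h := (fun s => _) in ih *.
have -> : \int[mu]_(s in `[0, t]) h s - t * h0 = \int[mu]_(s in `[0, t]) (h s - h0).
  by rewrite (RintegralB mI ih (icst h0)) E.
have ihB := integB mI ih (icst h0).
apply: le_trans (le_normr_Rintegral mI ihB) _.
rewrite -E; apply: (le_Rintegral mI (integ_abs ihB) (icst c)) => s.
by rewrite /= in_itv/=; exact: hs.
Qed.
Section ChainRule.
Variables (G G' : R -> R) (L C t0 : R) (e : R * R) (K : set (R * R)) (v p phi dphi : R * R -> R).
Hypotheses (t00 : 0 < t0) (L0 : 0 <= L) (C0 : 0 <= C).
Hypotheses (GT : forall a b, `|G b - G a - G' a * (b - a)| <= L * (b - a) ^+ 2)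
  (G'1 : forall a, `|G' a| <= 1) (G'L : forall a b, `|G' b - G' a| <= L * `|b - a|)
  (G1 : forall a, `|G a| <= `|a|)
  (mG : measurable_fun setT G) (mG' : measurable_fun setT G').
Hypotheses (iv : integ v) (ip : integ p) (ip2 : integ (fun z => p z ^+ 2)).
Hypothesis hD : forall t, 0 < t < t0 ->
  {ae leb2R, forall z, K z \/ K (pt e t z) -> v (pt e t z) - v z = seg e t p z}.
Hypotheses (mphi : measurable_fun [set: measurableTypeR R * measurableTypeR R] phi) (mdphi : measurable_fun [set: measurableTypeR R * measurableTypeR R] dphi)
  (phiK : forall z, ~ K z -> phi z = 0) (phiC : forall z, `|phi z| <= C)
  (dphiC : forall z, `|dphi z| <= C)
  (phiL : forall s z, `|phi (pt e s z) - phi z| <= C * `|s|)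
  (phiT : forall t z, 0 < t -> `|phi (pt e (- t) z) - phi z + t * dphi z| <= C * t ^+ 2).

Let mv : measurable_fun [set: measurableTypeR R * measurableTypeR R] v. Proof. exact: integ_mfun iv. Qed.
Let psi z := phi z * G' (v z).
Let mpsi : measurable_fun [set: measurableTypeR R * measurableTypeR R] psi.
Proof. by apply: measurable_funM => //; exact: measurableT_comp. Qed.
Let psiC z : `|psi z| <= C.
Proof. by rewrite /psi normrM -[leRHS]mulr1 ler_pM. Qed.
Let Gv z := G (v z).
Let iGv : integ Gv.
Proof.
have mGv : measurable_fun [set: measurableTypeR R * measurableTypeR R] Gv by exact: measurableT_comp mG mv.
exact: (integ_le measurableT mGv (fun z _ => G1 (v z)) (integ_abs iv)).
Qed.

Let N2 := \int[leb2R]_z `|p z|.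
Let S := \int[leb2R]_z p z ^+ 2.
Let N1 := \int[leb2R]_z `|v z|.

(** After the shift is moved onto [psi], the change of [psi] is at most [C * s] plus [C * L] times
    the increment [g] of [v]. The product [|g| * |p|] is split with weights [1 / s] and [s]; since
    the integral of [g ^+ 2] is at most [s ^+ 2 * S], both halves are of order [s]. *)
Let slice s : 0 <= s < t0 ->
  `|\int[leb2R]_z (psi z * p (pt e s z)) - \int[leb2R]_z (psi z * p z)| <= s * (C * N2 + C * L * S).
Proof.
move=> /andP[]; rewrite le_eqVlt => /predU1P[<- _|s0 st0].
  by rewrite mul0r; under eq_Rintegral do rewrite pt0; rewrite subrr normr0.
have ips : integ (p \o pt e s) by exact: integ_trans2.
have mpsis : measurable_fun [set: measurableTypeR R * measurableTypeR R] (fun z => psi (pt e (- s) z)).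
  by apply: measurableT_comp mpsi _; exact: measurable_trans2.
have iM (g : R * R -> R) : measurable_fun [set: measurableTypeR R * measurableTypeR R] g -> (forall z, `|g z| <= C) ->
    forall q, integ q -> integ (fun z => g z * q z).
  by move=> mg gC q iq; exact: (integM measurableT (c := C)).
have -> : \int[leb2R]_z (psi z * p (pt e s z)) = \int[leb2R]_z (psi (pt e (- s) z) * p z).
  rewrite -[LHS](@Rintegral_trans2 R (- s * e.1, - s * e.2)); last exact: (iM psi mpsi psiC _ ips).
  by apply: eq_Rintegral => z _; rewrite -/(pt e (- s) z) ptD subrr pt0.
have i1 := iM _ mpsis (fun z => psiC _) _ ip; have i2 := iM psi mpsi psiC _ ip.
rewrite -(RintegralB measurableT i1 i2).
have i12 := integB measurableT i1 i2.
apply: le_trans (le_normr_Rintegral measurableT i12) _.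
have [iq qS] := integ_seg_sqr e (ltW s0) ip ip2.
pose q z := seg e s p z ^+ 2.
have iqs : integ (fun z => q (pt e (- s) z)) by exact: (integ_trans2 (- s * e.1, - s * e.2) iq).
have qsS : \int[leb2R]_z q (pt e (- s) z) <= s ^+ 2 * S.
  by rewrite (@Rintegral_trans2 R (- s * e.1, - s * e.2)).
have j1 := integZ measurableT (C * s) (integ_abs ip).
have j2 := integZ measurableT (C * L * s / 2) ip2.
have j3 := integZ measurableT (C * L / s / 2) iqs.
have j12 := integD measurableT j1 j2; have j := integD measurableT j12 j3.
apply: le_trans (_ : _ <= \int[leb2R]_z (C * s * `|p z| + C * L * s / 2 * p z ^+ 2 + C * L / s / 2 * q (pt e (- s) z))) _.
  apply: (ae_le_Rint measurableT (integ_abs i12) j).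
  have st : 0 < s < t0 by rewrite s0.
  have := ae_trans2 (- s * e.1, - s * e.2) (hD st).
  move=> H; apply: (ae_imp H) => z /=.
  rewrite -/(pt e (- s) z) ptD subrr pt0 => hz _.
  have [hK|/not_orP[nK1 nK2]] := pselect (K (pt e (- s) z) \/ K z); last first.
    rewrite /psi (phiK nK1) (phiK nK2) !mul0r subrr normr0.
    have s0' := ltW s0; have CL : 0 <= C * L by exact: mulr_ge0.
    apply: addr_ge0; first apply: addr_ge0.
    - by rewrite !mulr_ge0.
    - by rewrite mulr_ge0 ?sqr_ge0// divr_ge0// mulr_ge0.
    - by rewrite mulr_ge0 ?sqr_ge0// !divr_ge0.
  have {}hz := hz hK.
  rewrite -mulrBl normrM.
  set y := pt e (- s) z in hz *; set g := seg e s p y in hz *.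
  have b1 : `|psi y - psi z| <= C * s + C * L * `|g|.
    have -> : psi y - psi z = (phi y - phi z) * G' (v y) + phi z * (G' (v y) - G' (v z)).
      by rewrite /psi; ring.
    apply: le_trans (ler_normD _ _) _; rewrite !normrM lerD//.
      rewrite -[leRHS]mulr1 ler_pM//.
      by have := phiL (- s) z; rewrite normrN (gtr0_norm s0).
    rewrite -mulrA ler_pM//.
    by apply: le_trans (G'L _ _) _; rewrite -normrN opprB hz.
  apply: le_trans (ler_wpM2r (normr_ge0 _) b1) _.
  rewrite mulrDl -addrA lerD2l.
  have -> : C * L * `|g| * `|p z| = C * L * (`|g| * `|p z|) by rewrite mulrA.
  have -> : C * L * s / 2 * p z ^+ 2 + C * L / s / 2 * q y =
            C * L * ((s * p z ^+ 2 + g ^+ 2 / s) / 2).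
    by rewrite /q -/g; field; rewrite gt_eqF.
  apply: ler_wpM2l; first exact: mulr_ge0.
  rewrite -(real_normK (num_real (p z))) -(real_normK (num_real g)).
  have -> : (s * `|p z| ^+ 2 + `|g| ^+ 2 / s) / 2 =
    `|g| * `|p z| + (s * `|p z| - `|g|) ^+ 2 / s / 2 by field; rewrite gt_eqF.
  by rewrite lerDl !divr_ge0 ?sqr_ge0// ltW.
rewrite (RintegralD measurableT j12 j3) (RintegralD measurableT j1 j2).
rewrite !RintegralZl//; last exact: integ_abs.
rewrite -/N2 -/S.
apply: le_trans (_ : C * s * N2 + C * L * s / 2 * S + C * L / s / 2 * (s ^+ 2 * S) <= _).
  rewrite lerD2l ler_wpM2l// !mulr_ge0// ?invr_ge0 ltW//.
rewrite le_eqVlt; apply/orP; left; apply/eqP; field; by rewrite gt_eqF.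
Qed.

(** The Taylor remainder of [G] is at most [L] times the square of the increment of [v], and by
    Cauchy-Schwarz on the segment that square has integral at most [t ^+ 2 * S]. This is where the
    square integrability of [p] is spent. *)
Let quad t : 0 < t < t0 ->
  `|\int[leb2R]_z (Gv z * (phi (pt e (- t) z) - phi z)) - \int[leb2R]_z (psi z * seg e t p z)|
    <= C * L * t ^+ 2 * S.
Proof.
move=> /[dup] tt /andP[/ltW tge0 _].
have iM (g : R * R -> R) c : measurable_fun [set: measurableTypeR R * measurableTypeR R] g ->
    (forall z, `|g z| <= c) -> forall q, integ q -> integ (fun z => g z * q z).
  by move=> mg gC q iq; exact: (integM measurableT (c := c)).
have mphit : measurable_fun [set: measurableTypeR R * measurableTypeR R] (fun z => phi (pt e (- t) z)).
  by apply: measurableT_comp mphi _; exact: measurable_trans2.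
have iGt : integ (fun z => Gv (pt e t z)) by exact: (integ_trans2 (t * e.1, t * e.2) iGv).
have j1 := iM _ C mphit (fun z => phiC _) _ iGv.
have j2 := iM _ C mphi phiC _ iGv.
have j3 := iM _ C mphi phiC _ iGt.
have j4 := iM _ C mpsi psiC _ (integ_seg e t ip).
have -> : \int[leb2R]_z (Gv z * (phi (pt e (- t) z) - phi z)) =
    \int[leb2R]_z (phi z * Gv (pt e t z) - phi z * Gv z).
  transitivity (\int[leb2R]_z (phi (pt e (- t) z) * Gv z - phi z * Gv z)).
    by apply: eq_Rintegral => z _; ring.
  rewrite (RintegralB measurableT j1 j2) (RintegralB measurableT j3 j2); congr (_ - _).
  rewrite -[RHS](@Rintegral_trans2 R (- t * e.1, - t * e.2))//.
  by apply: eq_Rintegral => z _; rewrite -/(pt e (- t) z) ptD subrr pt0.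
have j32 := integB measurableT j3 j2; have j := integB measurableT j32 j4.
rewrite -(RintegralB measurableT j32 j4).
apply: le_trans (le_normr_Rintegral measurableT j) _.
have [iq qS] := integ_seg_sqr e tge0 ip ip2.
have CL : 0 <= C * L by exact: mulr_ge0.
apply: le_trans (_ : _ <= \int[leb2R]_z (C * L * seg e t p z ^+ 2)) _; last first.
  have -> : C * L * t ^+ 2 * S = C * L * (t ^+ 2 * S) by rewrite !mulrA.
  by rewrite (RintegralZl _ measurableT iq) ler_wpM2l.
apply: (ae_le_Rint measurableT (integ_abs j) (integZ measurableT (C * L) iq)).
apply: (ae_imp (hD tt)) => z hz _.
have [Kz|nKz] := pselect (K z); last first.
  by rewrite /psi (phiK nKz) !mul0r !subrr normr0 mulr_ge0// sqr_ge0.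
have {}hz := hz (or_introl Kz).
have -> : phi z * Gv (pt e t z) - phi z * Gv z - psi z * seg e t p z =
   phi z * (G (v (pt e t z)) - G (v z) - G' (v z) * (v (pt e t z) - v z)).
  by rewrite /psi /Gv hz; ring.
rewrite normrM -mulrA; apply: ler_pM => //.
by rewrite -hz; exact: GT.
Qed.

Let expand t : 0 < t ->
  `|\int[leb2R]_z (Gv z * (phi (pt e (- t) z) - phi z)) + t * \int[leb2R]_z (Gv z * dphi z)|
    <= C * t ^+ 2 * N1.
Proof.
move=> tp.
have mphit : measurable_fun [set: measurableTypeR R * measurableTypeR R] (fun z => phi (pt e (- t) z)).
  by apply: measurableT_comp mphi _; exact: measurable_trans2.
have j1 : integ (fun z => (phi (pt e (- t) z) - phi z) * Gv z).
  apply: (integM measurableT (c := C + C)) iGv; first exact: measurable_funB.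
  by move=> z _; apply: le_trans (ler_normB _ _) _; exact: lerD.
have j2 : integ (fun z => dphi z * Gv z) by exact: (integM measurableT (c := C)).
have j3 := integZ measurableT t j2; have j := integD measurableT j1 j3.
have -> : \int[leb2R]_z (Gv z * (phi (pt e (- t) z) - phi z)) =
          \int[leb2R]_z ((phi (pt e (- t) z) - phi z) * Gv z).
  by apply: eq_Rintegral => z _; rewrite mulrC.
have -> : \int[leb2R]_z (Gv z * dphi z) = \int[leb2R]_z (dphi z * Gv z).
  by apply: eq_Rintegral => z _; rewrite mulrC.
rewrite -(RintegralZl t measurableT j2) -(RintegralD measurableT j1 j3).
apply: le_trans (le_normr_Rintegral measurableT j) _.
rewrite -(RintegralZl _ measurableT (integ_abs iv)).
apply: (le_Rintegral measurableT (integ_abs j) (integZ measurableT _ (integ_abs iv))) => z _.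
rewrite mulrA -mulrDl normrM; apply: ler_pM => //; last exact: G1.
exact: phiT.
Qed.

(* Up to an L1 error [O(t^2)], [G (v (z + t e)) - G (v z)] is the integral of [G' (v z) * p] over the
   segment; shift the difference onto [phi] and divide by [t]. *)
Lemma line_chain_rule :
  \int[leb2R]_z (G (v z) * dphi z) = - \int[leb2R]_z (G' (v z) * p z * phi z).
Proof.
have -> : \int[leb2R]_z (G' (v z) * p z * phi z) = \int[leb2R]_z (psi z * p z).
  by apply: eq_Rintegral => z _; rewrite /psi; ring.
pose M := C * L * S + (C * N2 + C * L * S) + C * N1.
have key t : 0 < t < t0 ->
    `|\int[leb2R]_z (Gv z * dphi z) + \int[leb2R]_z (psi z * p z)| <= t * M.
  move=> /[dup] tt /andP[tp tt0].
  have h1 := quad tt; have h2 := expand tp.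
  have h3 : `|\int[leb2R]_z (psi z * seg e t p z) - t * \int[leb2R]_z (psi z * p z)| <=
      t * (t * (C * N2 + C * L * S)).
    apply: (slices_bound (ltW tp) ip mpsi psiC) => s /andP[s0 st].
    apply: le_trans (slice _) _; first by rewrite s0 (le_lt_trans st).
    apply: ler_wpM2r => //; rewrite addr_ge0// ?mulr_ge0//.
      exact: Rintegral_ge0.
    by apply: Rintegral_ge0 => z _; exact: sqr_ge0.
  move: h1 h2 h3.
  set a := \int[leb2R]_z _; set b := \int[leb2R]_z _; set c := \int[leb2R]_z _; set d := \int[leb2R]_z _.
  move=> h1 h2 h3.
  rewrite -(ler_pM2l tp) -{1}(gtr0_norm tp) -normrM.
  have -> : t * (c + d) = (a + t * c) - (a - b) - (b - t * d) by ring.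
  apply: le_trans (ler_normB _ _) _; apply: le_trans (lerD (ler_normB _ _) (lexx _)) _.
  have -> : t * (t * M) = C * t ^+ 2 * N1 + C * L * t ^+ 2 * S + t * (t * (C * N2 + C * L * S)).
    by rewrite /M; ring.
  by rewrite !lerD.
have M0 : 0 <= M.
  have S0 : 0 <= S by apply: Rintegral_ge0 => z _; exact: sqr_ge0.
  have N10 : 0 <= N1 by exact: Rintegral_ge0.
  have N20 : 0 <= N2 by exact: Rintegral_ge0.
  by rewrite /M !addr_ge0// !mulr_ge0.
apply/eqP; rewrite -subr_eq0 opprK -normr_eq0 eq_le normr_ge0 andbT.
apply/ler_addgt0Pr => eps eps0; rewrite add0r.
have M1 : 0 < M + 1 by lra.
pose t := Num.min (t0 / 2) (eps / (M + 1)).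
have tp : 0 < t by rewrite lt_min !divr_gt0.
have tt0 : t < t0 by rewrite gt_min ltr_pdivrMr// ltr_pMr// ltr1n.
apply: le_trans (key t _) _; first by rewrite tp.
have te : t <= eps / (M + 1) by rewrite ge_min lexx orbT.
apply: le_trans (ler_wpM2r M0 te) _.
rewrite mulrAC ler_pdivrMr//; nra.
Qed.

End ChainRule.
End LineChainRule.

(** * The degenerate weight *)

Section Weight.
Context {R : realType}.
Implicit Types f : R -> R.

Definition degenerate_weight f : Prop :=
  [/\ measurable_fun [set: measurableTypeR R] f, f 0 = 0,
      forall x, x != 0 -> 0 < f x & forall x y, `|x| <= `|y| -> f x <= f y].

Lemma degenerate_weight_ge0 f x : degenerate_weight f -> 0 <= f x.
Proof.
move=> [_ f0 fp _]; have [->|xn] := eqVneq x 0; first by rewrite f0.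
exact/ltW/fp.
Qed.

Lemma profile_weight k s f : degenerate_profile k s f -> degenerate_weight f.
Proof.
move=> [f0 fN _ fd fp].
have fpos x : x != 0 -> 0 < f x by move=> /fd[].
have fnorm x : f x = f `|x| by have [x0|//] := ler0P x; rewrite fN.
have mono x y : 0 <= x -> x <= y -> f x <= f y.
  move=> x0; rewrite le_eqVlt => /predU1P[->//|xy].
  (* The derivative is controlled only away from [0], so this endpoint is settled by [f 0 = 0] and
     positivity, and the mean value theorem handles the rest. *)
  have [->|xn] := eqVneq x 0.
    by rewrite f0 ltW// fpos// gt_eqF// (le_lt_trans x0).
  have xp : 0 < x by rewrite lt0r xn.
  have dpos c : x <= c -> derivable f c 1.
    by move=> xc; have [] := fd c; rewrite ?gt_eqF// (lt_le_trans xp).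
  have dc c : c \in `]x, y[ -> is_derive c (1 : R) f (derive1 f c).
    by rewrite in_itv/= => /andP[/ltW /dpos xc _]; rewrite derive1E; exact: derivableP.
  have cf : {within `[x, y], continuous f}.
    by apply: derivable_within_continuous => c; rewrite in_itv/= => /andP[/dpos].
  have [c cxy E] := MVT_segment (ltW xy) dc cf.
  have c0 : 0 < c by move: cxy; rewrite in_itv/= => /andP[xc _]; exact: lt_le_trans xp xc.
  by rewrite -subr_ge0 E mulr_ge0 ?subr_ge0 ?ltW// fp.
split => //; last by move=> x y xy; rewrite fnorm (fnorm y) mono.
(* [f] decreases on the negative axis; writing it as a nondecreasing function of [|x|] makes
   measurability a consequence of monotonicity. *)
pose h x := f (Num.max x 0).
have mh : measurable_fun [set: measurableTypeR R] h.
  apply: nondecreasing_measurable => // x y xy; rewrite /h; apply: mono; first by rewrite le_max lexx orbT.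
  by rewrite ge_max !le_max xy lexx !orbT.
have -> : f = h \o (fun x => `|x|) by apply/funext => x; rewrite /h /= max_l// fnorm.
by apply: (measurableT_comp mh); exact: normr_measurable.
Qed.
End Weight.

(** * Uniform bounds for test functions *)

Section TestFunctions.
Context {R : realType}.
Local Notation e1 := ((1, 0) : R * R).
Local Notation e2 := ((0, 1) : R * R).
Implicit Types (K O : set (R * R)) (phi : R * R -> R).

Lemma continuous_compact_bounded K phi : continuous phi -> compact K ->
  (forall z, ~ K z -> phi z = 0) -> exists2 C, 0 <= C & forall z, `|phi z| <= C.
Proof.
move=> cphi cK phi0.
have : compact (phi @` K) by apply: continuous_compact => //; exact: continuous_subspaceT.
move=> /compact_bounded[M [Mr hM]].
exists (Num.max M 0 + 1) => [|z]; first by rewrite addr_ge0// le_max lexx orbT.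
have [Kz|/phi0->] := pselect (K z); last by rewrite normr0 addr_ge0// le_max lexx orbT.
apply: (hM (Num.max M 0 + 1)); last by exists z.
by rewrite ltr_pwDr// le_max lexx.
Qed.

Lemma zero_derive K phi (v z : R * R) : closed K -> (forall z, ~ K z -> phi z = 0) ->
  ~ K z -> 'D_v phi z = 0.
Proof.
move=> clK phi0 nKz.
have : \forall y \near z, cst 0 y = phi y.
  have : nbhs z (~` K) by apply: open_nbhs_nbhs; split => //; exact: closed_openC.
  by apply: filterS => y /phi0 ->.
move=> h; have := near_eq_is_derive h (is_derive_cst (0 : R) z v).
by case.
Qed.

Lemma line_lipschitz phi (e : R * R) (C : R) :
  (forall z, derivable phi z e) -> (forall z, `|'D_e phi z| <= C) ->
  forall s z, exists2 c, `|c| <= `|s| & phi (pt e s z) - phi z = s * 'D_e phi (pt e c z).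
Proof.
move=> dphi dC s z.
have dh x : is_derive x (1 : R) (fun h => phi (h *: e + z)) ('D_e phi (pt e x z)).
  by apply/is_derive_line; rewrite ptE; exact: derivableP.
have ch := is_derive_continuous dh.
have [s0|s0] := leP 0 s.
  have [c] := @MVT_segment R _ _ 0 s s0 (fun x _ => dh x) (continuous_subspaceT ch).
  rewrite in_itv/= => /andP[c0 cs] E; exists c; first by rewrite !ger0_norm.
  by move: E; rewrite subr0 scale0r add0r -ptE mulrC.
have [c] := @MVT_segment R _ _ s 0 (ltW s0) (fun x _ => dh x) (continuous_subspaceT ch).
rewrite in_itv/= => /andP[sc c0] E; exists c.
  by rewrite (ltr0_norm s0) ler0_norm// lerN2.
move: E; rewrite sub0r scale0r add0r -ptE => E.
by rewrite -[LHS]opprB E mulrN opprK mulrC.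
Qed.

(** These are the properties of a test function and its derivative along [e] that the translation
    arguments consume: support, sup bounds, a Lipschitz bound and a second order expansion, with a
    single constant. *)
Definition line_bounds K (e : R * R) (C : R) phi dphi :=
  [/\ 0 <= C, forall z, ~ K z -> phi z = 0, forall z, ~ K z -> dphi z = 0,
      (forall z, `|phi z| <= C) /\ (forall z, `|dphi z| <= C)
    & (forall s z, `|phi (pt e s z) - phi z| <= C * `|s|) /\
      (forall t z, 0 < t -> `|phi (pt e (- t) z) - phi z + t * dphi z| <= C * t ^+ 2)].

Lemma test_line_bounds K (e : R * R) phi : compact K -> (forall z, ~ K z -> phi z = 0) ->
  continuous phi -> (forall z, derivable phi z e) -> continuous (fun z => 'D_e phi z) ->
  (forall z, derivable (fun z => 'D_e phi z) z e) ->
  continuous (fun z => 'D_e (fun z => 'D_e phi z) z) ->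
  exists C, line_bounds K e C phi (fun z => 'D_e phi z).
Proof.
move=> cK phi0 c0 d0 c1 d1' c2.
have clK : closed K by apply: compact_closed => //; exact: norm_hausdorff.
have phi1 z : ~ K z -> 'D_e phi z = 0 by exact: zero_derive.
have phi2 z : ~ K z -> 'D_e (fun z => 'D_e phi z) z = 0 by exact: zero_derive.
have [C0 C00 h0] := continuous_compact_bounded c0 cK phi0.
have [C1 C10 h1] := continuous_compact_bounded c1 cK phi1.
have [C2 C20 h2] := continuous_compact_bounded c2 cK phi2.
pose C := C0 + C1 + C2.
have [l0 l1 l2] : [/\ C0 <= C, C1 <= C & C2 <= C] by rewrite /C; split; lra.
exists C; split => //; first by rewrite /C; lra.
  by split=> z; [exact: le_trans (h0 z) l0|exact: le_trans (h1 z) l1].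
split.
  move=> s z; have [c _ ->] := line_lipschitz d0 h1 s z.
  by rewrite normrM mulrC ler_wpM2r// (le_trans (h1 _)).
(* Two mean value theorems: the first replaces the difference by the derivative at an intermediate
   point at distance at most [t], the second compares that derivative with the one at [z]. *)
move=> t z t0; have [c ct ->] := line_lipschitz d0 h1 (- t) z.
rewrite mulNr addrC -mulrBr normrM (gtr0_norm t0).
have [c' _ E] := line_lipschitz d1' h2 c z.
rewrite -normrN opprB E normrM.
rewrite mulrA expr2 mulrC; apply: ler_pM => //; first by rewrite mulr_ge0// ltW.
  exact: le_trans (h2 _) l2.
by apply: ler_wpM2l; [exact: ltW|rewrite (le_trans ct)// normrN gtr0_norm].
Qed.
End TestFunctions.

(** * Norms and integrability in the degenerate Sobolev spaces *)

Section SobolevIntegrals.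
Context {R : realType}.
Local Notation mu := (@lebesgue_measure R).
Local Notation leb2R := ((@lebesgue_measure R) \x (@lebesgue_measure R))%E.
Local Notation plane := (measurableTypeR R * measurableTypeR R)%type.
Local Notation integ P := (leb2R.-integrable setT (EFin \o P)).
Implicit Types (f : R -> R) (O K : set (R * R)) (u v w phi psi : R * R -> R)
  (g h : R * R -> 'cV[R]_2).

Lemma integ_patch O v : measurable (O : set plane) ->
  leb2R.-integrable O (EFin \o v) <-> integ (v \_ O).
Proof.
move=> mO; rewrite -restrict_EFin; exact: integrable_mkcond.
Qed.

Lemma bounded_box O : bounded_set O -> exists2 M, 0 < M &
  forall z, O z -> `|z.1| <= M /\ `|z.2| <= M.
Proof.
move=> [M [_ hM]]; exists (Num.max M 0 + 1) => [|z Oz].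
  by rewrite ltr_wpDl// le_max lexx orbT.
have : `|z| <= Num.max M 0 + 1 by apply: hM => //; rewrite ltr_pwDr// le_max lexx.
by rewrite prod_normE ge_max => /andP[].
Qed.

Lemma bounded_lebesgue O : open O -> bounded_set O -> (leb2R O < +oo)%E.
Proof.
move=> oO /bounded_box[M M0 hM].
have mI : measurable (`[(- M)%R, M]%classic : set (measurableTypeR R)) by exact: measurable_itv.
apply: (@le_lt_trans _ _ (leb2R (`[(- M)%R, M]%classic `*` `[(- M)%R, M]%classic))).
  apply: le_measure; rewrite ?inE.
  - exact: open_measurable2.
  - exact: measurableX.
  - by move=> z /hM[h1 h2]; split; rewrite /= in_itv/= -ler_norml.
rewrite product_measure1E//.
have fI : mu `[(- M)%R, M]%classic \is a fin_num by rewrite lebesgue_measure_itv/=; case: ifP.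
by apply: lte_mul_pinfty => //; rewrite ltey_eq fI.
Qed.

Lemma nablaA0 f g z : nablaA f g z 0 0 = g z 0 0.
Proof. by rewrite mxE. Qed.

Lemma nablaA1 f g z : nablaA f g z 1 0 = f z.1 * g z 1 0.
Proof. by rewrite mxE. Qed.

Lemma enorm_sqr (xi : 'cV[R]_2) : enorm xi ^+ 2 = xi 0 0 ^+ 2 + xi 1 0 ^+ 2.
Proof.
rewrite /enorm sqr_sqrtr; last by rewrite sumr_ge0// => i _; exact: sqr_ge0.
rewrite !big_ord_recl big_ord0 addr0; congr (_ + xi _ _ ^+ 2); exact: val_inj.
Qed.

Lemma enorm_ge0 (xi : 'cV[R]_2) : 0 <= enorm xi.
Proof. exact: sqrtr_ge0. Qed.

Lemma enorm_comp0 (xi : 'cV[R]_2) : `|xi 0 0| <= enorm xi.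
Proof.
rewrite -(ler_sqr (x := `|_|)) ?nnegrE ?enorm_ge0//.
by rewrite enorm_sqr real_normK ?num_real// lerDl sqr_ge0.
Qed.

Lemma enorm_comp1 (xi : 'cV[R]_2) : `|xi 1 0| <= enorm xi.
Proof.
rewrite -(ler_sqr (x := `|_|)) ?nnegrE ?enorm_ge0//.
by rewrite enorm_sqr real_normK ?num_real// lerDr sqr_ge0.
Qed.

(** The power [p] of the norm; the root is treated once, in the two lemmas on [Wnorm] below, and all
    estimates are made on the integral. *)
Definition Wint (p : nat) f O v g : \bar R :=
  (\int[leb2R]_(z in O) (`|v z| ^+ p + enorm (nablaA f g z) ^+ p)%:E)%E.

Lemma Wint_ge0 p f O v g : (0 <= Wint p f O v g)%E.
Proof.
by apply: integral_ge0 => z _; rewrite lee_fin addr_ge0// exprn_ge0// enorm_ge0.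
Qed.

Lemma Wnorm_lt p f O v g (e : R) : (0 < p)%N -> 0 < e ->
  (Wnorm p f O v g < e%:E)%E <-> (Wint p f O v g < (e ^+ p)%:E)%E.
Proof.
move=> p0 e0; rewrite /Wnorm -/(Wint p f O v g); have := Wint_ge0 p f O v g.
have pp : (p%:R : R) != 0 by rewrite pnatr_eq0 -lt0n.
have pi0 : 0 < (p%:R : R)^-1 by rewrite invr_gt0 ltr0n.
case: (Wint _ _ _ _ _) => [r| |]; rewrite ?lee_fin// => r0; last first.
  by rewrite poweRyr ?gt_eqF// !ltNge !leey.
rewrite poweR_EFin !lte_fin.
have E : e = (e ^+ p) `^ p%:R^-1 by rewrite -powR_mulrn ?ltW// -powRrM divff// powRr1// ltW.
rewrite {1}E; split => h.
  by rewrite ltNge; apply/negP => /(ge0_ler_powR (ltW pi0) (ltW (exprn_gt0 _ e0)) r0); rewrite leNgt h.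
by apply: gt0_ltr_powR => //; rewrite nnegrE// exprn_ge0// ltW.
Qed.

Lemma Wnorm_lty p f O v g : (0 < p)%N ->
  (Wnorm p f O v g < +oo)%E <-> (Wint p f O v g < +oo)%E.
Proof.
move=> p0; rewrite /Wnorm -/(Wint p f O v g); have := Wint_ge0 p f O v g.
case: (Wint _ _ _ _ _) => [r| |] // r0; first by rewrite poweR_EFin !ltry.
by rewrite poweRyr// gt_eqF// invr_gt0 ltr0n.
Qed.

Lemma measurable_enorm (D : set plane) f g : measurable D ->
  measurable_fun D (fun z => nablaA f g z 0 0) ->
  measurable_fun D (fun z => nablaA f g z 1 0) ->
  measurable_fun D (fun z => enorm (nablaA f g z)).
Proof.
move=> mD m0 m1.
have -> : (fun z => enorm (nablaA f g z)) = Num.sqrt \o (fun z => nablaA f g z 0 0 ^+ 2 + nablaA f g z 1 0 ^+ 2).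
  by apply/funext => z /=; rewrite -enorm_sqr sqrtr_sqr ger0_norm// enorm_ge0.
apply: (@measurableT_comp _ _ _ _ _ _ (@Num.sqrt R)).
  by apply: continuous_measurable_fun; exact: sqrt_continuous.
by apply: measurable_funD; exact: measurable_funX.
Qed.

Lemma measurable_nablaA (D : set plane) f g : measurable D -> degenerate_weight f ->
  (forall i, measurable_fun D (fun z => g z i 0)) ->
  measurable_fun D (fun z => nablaA f g z 0 0) /\ measurable_fun D (fun z => nablaA f g z 1 0).
Proof.
move=> mD [mf _ _ _] mg; split.
  by under eq_fun do rewrite nablaA0; exact: mg.
under eq_fun do rewrite nablaA1.
apply: measurable_funM; last exact: mg.
exact: (measurable_funTS (measurableT_comp mf measurable_fst)).
Qed.

Lemma measurable_Wint (D : set plane) p f v g : measurable D -> degenerate_weight f ->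
  measurable_fun D v -> (forall i, measurable_fun D (fun z => g z i 0)) ->
  measurable_fun D (fun z => `|v z| ^+ p + enorm (nablaA f g z) ^+ p).
Proof.
move=> mD wf mv mg; have [m0 m1] := measurable_nablaA mD wf mg.
have mn : measurable_fun D (fun z => `|v z|) by exact: measurableT_comp.
exact: measurable_funD (measurable_funX _ mn) (measurable_funX _ (measurable_enorm mD m0 m1)).
Qed.

Lemma Wint_integrable (D : set plane) p f v g : measurable D -> degenerate_weight f ->
  measurable_fun D v -> (forall i, measurable_fun D (fun z => g z i 0)) ->
  (Wint p f D v g < +oo)%E <->
  leb2R.-integrable D (EFin \o (fun z => `|v z| ^+ p + enorm (nablaA f g z) ^+ p)).
Proof.
move=> mD wf mv mg; have mW := measurable_Wint p mD wf mv mg.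
have E : (\int[leb2R]_(z in D) `|(EFin \o (fun z => (`|v z| ^+ p + enorm (nablaA f g z) ^+ p)%R)) z| = Wint p f D v g)%E.
  apply: eq_integral => z _ /=.
  by rewrite ger0_norm// addr_ge0// exprn_ge0// enorm_ge0.
split => [h|/integrableP[_]]; last by rewrite E.
by apply/integrableP; split; [exact/measurable_EFinP|rewrite E].
Qed.

Lemma sqr_le_integ (D : set plane) (q : R * R -> R) (I : R * R -> R) : measurable D -> (leb2R D < +oo)%E ->
  measurable_fun D q -> (forall z, D z -> q z ^+ 2 <= I z) ->
  leb2R.-integrable D (EFin \o I) ->
  integ (q \_ D) /\ integ (fun z => (q \_ D) z ^+ 2).
Proof.
move=> mD Doo mq qI iI.
have i2 : leb2R.-integrable D (EFin \o (fun z => q z ^+ 2)).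
  apply: (integ_le mD _ _ iI); first exact: measurable_funX.
  by move=> z Dz; rewrite ger0_norm ?sqr_ge0// qI.
have [i1 _] := cauchy_schwarz1 mD Doo mq i2.
split; first exact/(integ_patch _ mD).
have := (integ_patch _ mD).1 i2; congr (_.-integrable _ (_ \o _)).
by apply/funext => z; rewrite !patchE; case: ifP => // _; rewrite expr0n.
Qed.

End SobolevIntegrals.

(** * The chain rule for weak gradients *)

Section SobolevChainRule.
Context {R : realType}.
Local Notation mu := (@lebesgue_measure R).
Local Notation leb2R := ((@lebesgue_measure R) \x (@lebesgue_measure R))%E.
Local Notation plane := (measurableTypeR R * measurableTypeR R)%type.
Local Notation integ P := (leb2R.-integrable setT (EFin \o P)).
Local Notation e1 := ((1, 0) : R * R).
Local Notation e2 := ((0, 1) : R * R).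
Implicit Types (f : R -> R) (O K : set (R * R)) (u v w phi psi : R * R -> R)
  (g h : R * R -> 'cV[R]_2) (z : R * R).

Lemma plane_Rintegral O (h q : R * R -> R) : (forall z, O z -> h z = q z) ->
  (forall z, ~ O z -> q z = 0) -> \int[leb2]_(z in O) h z = \int[leb2R]_z q z.
Proof.
move=> hq q0; apply: etrans (Rintegral_mkcond _ _ _) _; apply: eq_Rintegral => z _.
by rewrite patchE; case: ifPn => [/set_mem/hq//|/negP nO]; rewrite q0// => /mem_set.
Qed.

Lemma test_bounds1 O phi : test_function O phi ->
  exists C, line_bounds (closure [set z | phi z != 0]) e1 C phi (d1 phi).
Proof.
move=> [sphi [cK _]]; have [c0 dd1 _ s1 _] := sphi 2%N.
have [c1 dd11 _ s11 _] := s1.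
apply: test_line_bounds => // z nKz; apply: contrapT => /eqP n; apply: nKz.
exact: subset_closure.
Qed.

Lemma test_bounds2 O phi : test_function O phi ->
  exists C, line_bounds (closure [set z | phi z != 0]) e2 C phi (d2 phi).
Proof.
move=> [sphi [cK _]]; have [c0 _ dd2 _ s2] := sphi 2%N.
have [c2 _ dd22 _ s22] := s2.
apply: test_line_bounds => // z nKz; apply: contrapT => /eqP n; apply: nKz.
exact: subset_closure.
Qed.

Lemma weak_gradient_line1 f O v g K : open O -> weak_gradient f O v g ->
  integ (v \_ O) -> integ ((fun z => nablaA f g z 0 0) \_ O) ->
  compact K -> K `<=` O -> exists2 t0, 0 < t0 & forall t, 0 < t < t0 ->
  {ae leb2R, forall z, K z \/ K (pt e1 t z) ->
     (v \_ O) (pt e1 t z) - (v \_ O) z = seg e1 t ((fun z => nablaA f g z 0 0) \_ O) z}.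
Proof.
move=> oO hw iv ip1 cK KO.
set vb := v \_ O in iv *; set p1 := _ \_ O in ip1 *.
apply: (compact_local_ae (D := fun t z => vb (pt e1 t z) - vb z = seg e1 t p1 z) oO cK KO).
- by rewrite normr1.
- by rewrite normr0.
move=> z0 r t tr bO'; apply: (weak_line1 tr bO') => // psi tpsi.
have [h _] := hw psi tpsi; move: h.
rewrite (plane_Rintegral (h := fun z => v z * d1 psi z) (q := fun z => vb z * d1 psi z)).
- rewrite (plane_Rintegral (h := fun z => nablaA f g z 0 0 * psi z) (q := fun z => p1 z * psi z))//.
    by move=> z Oz; rewrite /p1 patchE mem_set.
  by move=> z Oz; rewrite /p1 patchE memNset// mul0r.
- by move=> z Oz; rewrite /vb patchE mem_set.
- by move=> z Oz; rewrite /vb patchE memNset// mul0r.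
Qed.

(** The factor [f z.1] is constant in the direction [e2], so the second identity of [weak_gradient]
    says that [f v] has the ordinary weak derivative [f d_y v] in [y]. *)
Lemma weak_gradient_line2 f O v g K : open O -> weak_gradient f O v g ->
  integ (fun z => f z.1 * (v \_ O) z) -> integ ((fun z => nablaA f g z 1 0) \_ O) ->
  compact K -> K `<=` O -> exists2 t0, 0 < t0 & forall t, 0 < t < t0 ->
  {ae leb2R, forall z, K z \/ K (pt e2 t z) ->
     f (pt e2 t z).1 * (v \_ O) (pt e2 t z) - f z.1 * (v \_ O) z =
     seg e2 t ((fun z => nablaA f g z 1 0) \_ O) z}.
Proof.
move=> oO hw iV2 ip2 cK KO.
set vb := v \_ O in iV2 *; set p2 := _ \_ O in ip2 *; pose V2 z := f z.1 * vb z.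
apply: (compact_local_ae (D := fun t z => V2 (pt e2 t z) - V2 z = seg e2 t p2 z) oO cK KO).
- by rewrite normr0.
- by rewrite normr1.
move=> z0 r t tr bO'; apply: (weak_line2 tr bO') => // psi tpsi.
have [_ h] := hw psi tpsi; move: h.
rewrite (plane_Rintegral (h := fun z => v z * (f z.1 * d2 psi z)) (q := fun z => V2 z * d2 psi z)).
- rewrite (plane_Rintegral (h := fun z => nablaA f g z 1 0 * psi z) (q := fun z => p2 z * psi z))//.
    by move=> z Oz; rewrite /p2 patchE mem_set.
  by move=> z Oz; rewrite /p2 patchE memNset// mul0r.
- by move=> z Oz; rewrite /V2 /vb patchE mem_set//; ring.
- by move=> z Oz; rewrite /V2 /vb patchE memNset// mulr0 mul0r.
Qed.

(** Regularity of class [C^{1,1}] in the form in which it is consumed: the quadratic Taylor bound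
    identifies [G'] as the derivative of [G]. Vanishing at [0] makes composition with [G] compatible
    with extension by zero. *)
Definition smooth_truncation (G G' : R -> R) (L : R) : Prop :=
  [/\ 0 <= L, forall a b, `|G b - G a - G' a * (b - a)| <= L * (b - a) ^+ 2,
      (forall a, `|G' a| <= 1) /\ (forall a b, `|G' b - G' a| <= L * `|b - a|),
      G 0 = 0 /\ (forall a b, `|G b - G a| <= `|b - a|)
    & measurable_fun [set: measurableTypeR R] G /\ measurable_fun [set: measurableTypeR R] G'].

Section Fixed.
Variables (f : R -> R) (O : set (R * R)) (v : R * R -> R) (g : R * R -> 'cV[R]_2).
Hypotheses (wf : degenerate_weight f) (oO : open O) (bO : bounded_set O) (hv : inW 2 f O v g).

Let mO : measurable (O : set plane). Proof. exact: open_measurable2. Qed.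
Let Ooo : (leb2R O < +oo)%E. Proof. exact: bounded_lebesgue. Qed.
Let mv : measurable_fun (O : set plane) v. Proof. case: hv => h _ _ _; exact h. Qed.
Let mg i : measurable_fun (O : set plane) (fun z => g z i 0). Proof. case: hv => _ h _ _; exact (h i). Qed.
Let I2 z := `|v z| ^+ 2 + enorm (nablaA f g z) ^+ 2.
Let iI2 : leb2R.-integrable O (EFin \o I2).
Proof.
apply/(Wint_integrable 2 mO wf mv mg); apply/(Wnorm_lty f O v g (isT : (0 < 2)%N)).
by case: hv.
Qed.

Let vb := v \_ O.
Let p1 := (fun z => nablaA f g z 0 0) \_ O.
Let p2 := (fun z => nablaA f g z 1 0) \_ O.

Lemma inW2_integ : [/\ integ vb /\ integ (fun z => vb z ^+ 2),
  integ p1 /\ integ (fun z => p1 z ^+ 2) & integ p2 /\ integ (fun z => p2 z ^+ 2)].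
Proof.
have [m1 m2] := measurable_nablaA mO wf mg.
split.
- apply: (sqr_le_integ mO Ooo mv _ iI2) => z _.
  by rewrite /I2 real_normK ?num_real// lerDl sqr_ge0.
- apply: (sqr_le_integ mO Ooo m1 _ iI2) => z _.
  by rewrite /I2 enorm_sqr addrA addrC addrA lerDr addr_ge0 ?sqr_ge0.
- apply: (sqr_le_integ mO Ooo m2 _ iI2) => z _.
  by rewrite /I2 enorm_sqr addrA lerDr addr_ge0 ?sqr_ge0.
Qed.

Lemma inW2_line1 K : compact K -> K `<=` O -> exists2 t0, 0 < t0 & forall t, 0 < t < t0 ->
  {ae leb2R, forall z, K z \/ K (pt e1 t z) -> vb (pt e1 t z) - vb z = seg e1 t p1 z}.
Proof.
have [[iv _] [ip1 _] _] := inW2_integ; have [_ _ hw _] := hv.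
exact: weak_gradient_line1.
Qed.

Lemma chain_rule1 G G' L psi : smooth_truncation G G' L -> test_function O psi ->
  \int[leb2R]_(z in O) (G (v z) * d1 psi z) =
  - \int[leb2R]_(z in O) (nablaA f (fun z => G' (v z) *: g z) z 0 0 * psi z).
Proof.
move=> [L0 GT [G'1 G'L] [G0 GL] [mG mG']] tpsi.
have [C [C0 pK dK [pC dC] [pL pT]]] := test_bounds1 tpsi.
have [_ [cK KO]] := tpsi.
have [t0 t00 hD] := inW2_line1 cK KO.
have [[iv _] [ip1 ip12] _] := inW2_integ.
have G1 a : `|G a| <= `|a| by have := GL 0 a; rewrite G0 !subr0.
have [cpsi _ _ [cd1 _ _ _ _] _] := tpsi.1 2%N.
have := @line_chain_rule R G G' L C t0 e1 _ vb p1 psi (d1 psi) t00 L0 C0 GT G'1 G'L G1 mG mG' iv ip1 ip12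
  hD (continuous_measurable2 cpsi) (continuous_measurable2 cd1) pK pC dC pL pT.
rewrite (plane_Rintegral (h := fun z => G (v z) * d1 psi z) (q := fun z => G (vb z) * d1 psi z)).
- rewrite (plane_Rintegral (h := fun z => nablaA f (fun z => G' (v z) *: g z) z 0 0 * psi z)
     (q := fun z => G' (vb z) * p1 z * psi z))// => z Oz; rewrite /p1 /vb !patchE.
    by rewrite mem_set// !nablaA0 mxE.
  by rewrite memNset// mulr0 mul0r.
- by move=> z Oz; rewrite /vb patchE mem_set.
- by move=> z Oz; rewrite /vb patchE memNset// G0 mul0r.
Qed.
Let V2 z := f z.1 * vb z.

Let f_le M z : O z -> (forall z, O z -> `|z.1| <= M /\ `|z.2| <= M) -> f z.1 <= f M.
Proof.
case: wf => _ _ _ mono Oz hM; apply: mono; have [h _] := hM z Oz.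
by rewrite (le_trans h)// ler_norm.
Qed.

Let mf1 : measurable_fun [set: plane] (fun z => f z.1).
Proof. by case: wf => mf _ _ _; exact: measurableT_comp mf measurable_fst. Qed.

Let iV2 : integ V2.
Proof.
have [[iv _] _ _] := inW2_integ; have [M M0 hM] := bounded_box bO.
have mV : measurable_fun [set: plane] V2 by apply: measurable_funM => //; exact: integ_mfun iv.
apply: (integ_le measurableT mV _ (integZ measurableT (f M) (integ_abs iv))) => z _.
rewrite /V2 normrM; have [Oz|nOz] := pselect (O z); last first.
  by rewrite /vb patchE memNset// normr0 !mulr0.
by rewrite ler_wpM2r// ger0_norm ?degenerate_weight_ge0// (f_le Oz).
Qed.

Lemma inW2_line2 K : compact K -> K `<=` O -> exists2 t0, 0 < t0 & forall t, 0 < t < t0 ->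
  {ae leb2R, forall z, K z \/ K (pt e2 t z) -> V2 (pt e2 t z) - V2 z = seg e2 t p2 z}.
Proof.
have [_ _ [ip2 _]] := inW2_integ; have [_ _ hw _] := hv.
exact: weak_gradient_line2.
Qed.

(* Where [d < |x|] the weight is bounded below, so that [v] itself has a square integrable
   derivative in [y]; the strip [|x| <= d] disappears in the limit. *)
Section Cutoff.
Variables (d : R) (d0 : 0 < d).

Let far : set plane := [set z : R * R | d < `|z.1|].
Let chi : R * R -> R := \1_far.
Let gb := (fun z => g z 1 0) \_ O.

Let mfar : measurable far.
Proof.
rewrite -[X in measurable X]setTI.
have mn : measurable_fun [set: plane] (fun z => `|z.1|).
  by apply: (measurableT_comp (f := fun x : R => `|x|)); [exact: normr_measurable|exact: measurable_fst].
have -> : far = (fun z : plane => `|z.1|) @^-1` `]d, +oo[%classic.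
  by apply/seteqP; split => z /=; rewrite in_itv/= andbT.
exact: mn.
Qed.

Let chi_le1 z : `|chi z| <= 1.
Proof. by rewrite /chi indicE normr_nat; case: (_ \in _). Qed.

Let mchi : measurable_fun [set: plane] chi. Proof. exact: measurable_indic. Qed.

Let chiT z : d < `|z.1| -> chi z = 1.
Proof. by move=> h; rewrite /chi indicE mem_set. Qed.
Let chiF z : ~ d < `|z.1| -> chi z = 0.
Proof. by move=> h; rewrite /chi indicE memNset. Qed.

Let p2E z : p2 z = f z.1 * gb z.
Proof. by rewrite /p2 /gb !patchE; case: ifP => _; rewrite ?nablaA1 ?mulr0. Qed.

Let far_f z : d < `|z.1| -> [/\ f d <= f z.1, 0 < f d & 0 < f z.1].
Proof.
case: wf => _ _ fp mono dz; have fd : 0 < f d by apply: fp; rewrite gt_eqF.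
have h : f d <= f z.1 by apply: mono; rewrite (gtr0_norm d0) ltW.
by split => //; exact: lt_le_trans h.
Qed.

Let vd z := chi z * vb z.
Let pd z := chi z * gb z.

Let pd_le z : `|pd z| <= (f d)^-1 * `|p2 z|.
Proof.
rewrite /pd normrM; have [dz|ndz] := pselect (d < `|z.1|); last first.
  rewrite chiF// normr0 mul0r mulr_ge0// invr_ge0; exact: degenerate_weight_ge0.
have [h1 h2 h3] := far_f dz.
rewrite chiT// normr1 mul1r p2E normrM (gtr0_norm h3) mulrA ler_peMl//.
by rewrite ler_pdivlMl// mulr1.
Qed.

Let mgb : measurable_fun [set: plane] gb.
Proof. by apply/(measurable_restrictT _ mO). Qed.

Let ipd : integ pd /\ integ (fun z => pd z ^+ 2).
Proof.
have [_ _ [ip2 ip22]] := inW2_integ.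
have mpd : measurable_fun [set: plane] pd by exact: measurable_funM.
split.
  exact: (integ_le measurableT mpd (fun z _ => pd_le z) (integZ measurableT (f d)^-1 (integ_abs ip2))).
apply: (integ_le measurableT _ _ (integZ measurableT ((f d)^-1 ^+ 2) ip22)).
  exact: measurable_funX.
move=> z _; rewrite ger0_norm ?sqr_ge0// -[p2 z ^+ 2]real_normK ?num_real// -exprMn.
rewrite -[pd z ^+ 2]real_normK ?num_real// ler_sqr ?nnegrE//.
by rewrite mulr_ge0// invr_ge0; exact: degenerate_weight_ge0.
Qed.

Let ivd : integ vd.
Proof. by have [[iv _] _ _] := inW2_integ; exact: (integM measurableT (c := 1)). Qed.

(** Along a vertical line both the cutoff and [f] are constant, so the identity for [f v] can be
    divided by [f z.1] or, in the strip, reads [0 = 0]. *)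
Lemma cutoff_line K : compact K -> K `<=` O -> exists2 t0, 0 < t0 & forall t, 0 < t < t0 ->
  {ae leb2R, forall z, K z \/ K (pt e2 t z) -> vd (pt e2 t z) - vd z = seg e2 t pd z}.
Proof.
move=> cK KO; have [t0 t00 H] := inW2_line2 cK KO; exists t0 => // t tt.
have [_ _ [ip2 _]] := inW2_integ.
apply: (ae_imp (ae_and (H t tt) (ae_integrable_seg e2 t ip2))) => z [hz iz] hK.
have fst_pt s : (pt e2 s z).1 = z.1 by rewrite pt_e2.
have [dz|ndz] := pselect (d < `|z.1|); last first.
  rewrite /vd !chiF ?fst_pt// !mul0r subrr /seg; apply/esym.
  rewrite (_ : (fun s => pd (pt e2 s z)) = fun=> 0); last first.
    by apply/funext => s; rewrite /pd chiF ?fst_pt// mul0r.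
  by rewrite Rintegral_cst// mul0r.
have [_ _ fz] := far_f dz.
have {}hz := hz hK; move: hz; rewrite /V2 fst_pt -mulrBr => hz.
rewrite /vd !chiT ?fst_pt// !mul1r.
have -> : vb (pt e2 t z) - vb z = (f z.1)^-1 * seg e2 t p2 z by rewrite -hz mulKf// gt_eqF.
have mI : measurable (`[0%R, t]%classic : set (measurableTypeR R)) by exact: measurable_itv.
rewrite /seg; have <- := RintegralZl (f z.1)^-1 mI iz.
apply: eq_Rintegral => s _; rewrite /pd p2E chiT ?fst_pt// mul1r mulKf// gt_eqF//.
Qed.

Lemma cutoff_chain G G' L psi : smooth_truncation G G' L -> test_function O psi ->
  \int[leb2R]_z (chi z * (G (vb z) * (f z.1 * d2 psi z))) =
  - \int[leb2R]_z (chi z * (G' (vb z) * p2 z * psi z)).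
Proof.
move=> [L0 GT [G'1 G'L] [G0 GL] [mG mG']] tpsi.
have [C [C0 pK dK [pC dC] [pL pT]]] := test_bounds2 tpsi.
have [_ [cK KO]] := tpsi.
have [t0 t00 hD] := cutoff_line cK KO.
have [ip ip2] := ipd.
have G1 a : `|G a| <= `|a| by have := GL 0 a; rewrite G0 !subr0.
have [cpsi _ _ _ [cd2 _ _ _ _]] := tpsi.1 2%N.
have [M M0 hM] := bounded_box bO.
have fM0 : 0 <= f M by exact: degenerate_weight_ge0.
have f0 x : 0 <= f x by exact: degenerate_weight_ge0.
pose K := closure [set z | psi z != 0].
have KM z : K z -> f z.1 <= f M by move=> /KO Oz; exact: f_le Oz hM.
have fst_pt s z : (pt e2 s z).1 = z.1 by rewrite pt_e2.
(* [f] need not be bounded on the plane. If [f z.1] exceeds [f M], the whole vertical line through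
   [z] misses the support of [psi], so [f psi] inherits all bounds of [psi] with the factor
   [f M]. *)
have big z s : ~ f z.1 <= f M -> psi (pt e2 s z) = 0.
  by move=> h; apply: pK => /KM; rewrite fst_pt.
have bigd z s : ~ f z.1 <= f M -> d2 psi (pt e2 s z) = 0.
  by move=> h; apply: dK => /KM; rewrite fst_pt.
have := @line_chain_rule R G G' L (f M * C) t0 e2 K vd pd (fun z => f z.1 * psi z) (fun z => f z.1 * d2 psi z)
  t00 L0 (mulr_ge0 fM0 C0) GT G'1 G'L G1 mG mG' ivd ip ip2 hD
  (measurable_funM mf1 (continuous_measurable2 cpsi)) (measurable_funM mf1 (continuous_measurable2 cd2)).
have fb z (x c : R) : (~ f z.1 <= f M -> x = 0) -> `|x| <= C * c -> `|f z.1 * x| <= f M * C * c.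
  move=> x0 xc; rewrite normrM (ger0_norm (f0 _)) -mulrA.
  have [h|/x0->] := pselect (f z.1 <= f M); first by apply: ler_pM.
  rewrite normr0 mulr0 mulr_ge0// (le_trans _ xc)//.
have big0 z : ~ f z.1 <= f M -> psi z = 0 by move=> /(big _ 0); rewrite pt0.
have bigd0 z : ~ f z.1 <= f M -> d2 psi z = 0 by move=> /(bigd _ 0); rewrite pt0.
have -> : \int[leb2R]_z (chi z * (G (vb z) * (f z.1 * d2 psi z))) =
    \int[leb2R]_z (G (vd z) * (f z.1 * d2 psi z)).
  apply: eq_Rintegral => z _; rewrite /vd; have [dz|ndz] := pselect (d < `|z.1|).
    by rewrite chiT// !mul1r.
  by rewrite chiF// !mul0r G0 mul0r.
have -> : \int[leb2R]_z (chi z * (G' (vb z) * p2 z * psi z)) =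
    \int[leb2R]_z (G' (vd z) * pd z * (f z.1 * psi z)).
  apply: eq_Rintegral => z _; rewrite /vd /pd p2E; have [dz|ndz] := pselect (d < `|z.1|).
    by rewrite chiT// !mul1r; ring.
  by rewrite chiF// !mul0r mulr0 mul0r.
apply.
- by move=> z nK; rewrite pK// mulr0.
- move=> z; rewrite -[leRHS]mulr1; apply: fb; first exact: big0.
  by rewrite mulr1.
- move=> z; rewrite -[leRHS]mulr1; apply: fb; first exact: bigd0.
  by rewrite mulr1.
- move=> s z; rewrite fst_pt -mulrBr; apply: fb; last exact: pL.
  by move=> h; rewrite big// big0// subrr.
- move=> t z tp; rewrite fst_pt.
  have -> : f z.1 * psi (pt e2 (- t) z) - f z.1 * psi z + t * (f z.1 * d2 psi z) =
    f z.1 * (psi (pt e2 (- t) z) - psi z + t * d2 psi z) by ring.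
  apply: fb; last exact: pT.
  by move=> h; rewrite big// big0// bigd0// subrr mulr0 addr0.
Qed.

Lemma measurable_far_indic : measurable_fun [set: plane] (\1_[set z : R * R | d < `|z.1|] : R * R -> R).
Proof. exact: mchi. Qed.
End Cutoff.

(** The cutoffs exhaust the plane except for the axis. Vanishing there holds in both applications
    because the integrand carries the factor [f z.1] and [f 0 = 0]. *)
Lemma cutoff_cvg (a : R * R -> R) : integ a -> (forall z, z.1 = 0 -> a z = 0) ->
  (fun n => \int[leb2R]_z (\1_[set z : R * R | n.+1%:R^-1 < `|z.1|] z * a z)) @ \oo -->
  \int[leb2R]_z a z.
Proof.
move=> ia a0.
have ma := integ_mfun ia.
have cv z : (fun n => \1_[set z : R * R | n.+1%:R^-1 < `|z.1|] z * a z) @ \oo --> a z.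
  have [z0|zn] := eqVneq z.1 0.
    by rewrite a0//; under eq_fun do rewrite mulr0; exact: cvg_cst.
  rewrite -[X in _ --> X]mul1r; apply: cvgM; last exact: cvg_cst.
  apply: cvg_near_cst.
  have zp : 0 < `|z.1| by rewrite normr_gt0.
  have := near_infty_natSinv_lt (PosNum zp); apply: filterS => n /= h.
  by rewrite indicE mem_set.
have bd n z : `|\1_[set z : R * R | n.+1%:R^-1 < `|z.1|] z * a z| <= `|a z|.
  by rewrite normrM ler_piMl// indicE normr_nat; case: (_ \in _).
have mn n := measurable_funM (measurable_far_indic n.+1%:R^-1) ma.
by have [_ h] := Rdominated_convergence measurableT mn ma (fun z _ => cv z) (integ_abs ia) (fun n z _ => bd n z).
Qed.

Lemma chain_rule2 G G' L psi : smooth_truncation G G' L -> test_function O psi ->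
  \int[leb2R]_(z in O) (G (v z) * (f z.1 * d2 psi z)) =
  - \int[leb2R]_(z in O) (nablaA f (fun z => G' (v z) *: g z) z 1 0 * psi z).
Proof.
move=> hG tpsi; have [L0 GT [G'1 G'L] [G0 GL] [mG mG']] := hG.
have [C [C0 pK dK [pC dC] _]] := test_bounds2 tpsi.
have [[iv _] _ [ip2 _]] := inW2_integ.
have [cpsi _ _ _ [cd2 _ _ _ _]] := tpsi.1 2%N.
have G1 a : `|G a| <= `|a| by have := GL 0 a; rewrite G0 !subr0.
rewrite (plane_Rintegral (h := fun z => G (v z) * (f z.1 * d2 psi z))
   (q := fun z => G (vb z) * (f z.1 * d2 psi z))); last first.
- by move=> z Oz; rewrite /vb patchE memNset// G0 mul0r.
- by move=> z Oz; rewrite /vb patchE mem_set.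
rewrite (plane_Rintegral (h := fun z => nablaA f (fun z => G' (v z) *: g z) z 1 0 * psi z)
   (q := fun z => G' (vb z) * p2 z * psi z)); last first.
- by move=> z Oz; rewrite /vb /p2 !patchE memNset// mulr0 mul0r.
- by move=> z Oz; rewrite /vb /p2 !patchE mem_set// !nablaA1 mxE; ring.
set a := fun z => G (vb z) * (f z.1 * d2 psi z); set b := fun z => G' (vb z) * p2 z * psi z.
have mvb := integ_mfun iv.
have ia : integ a.
  have ma : measurable_fun [set: plane] a.
    apply: measurable_funM; first exact: measurableT_comp mG mvb.
    by apply: measurable_funM => //; exact: continuous_measurable2.
  apply: (integ_le measurableT ma _ (integZ measurableT C (integ_abs iV2))) => z _.
  have -> : `|a z| = `|d2 psi z| * (`|f z.1| * `|G (vb z)|) by rewrite /a !normrM; ring.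
  by apply: ler_pM => //; rewrite /V2 normrM; apply: ler_wpM2l => //; exact: G1.
have ib : integ b.
  have mb : measurable_fun [set: plane] b.
    apply: measurable_funM; last exact: continuous_measurable2.
    by apply: measurable_funM; [exact: measurableT_comp mG' mvb|exact: integ_mfun ip2].
  apply: (integ_le measurableT mb _ (integZ measurableT C (integ_abs ip2))) => z _.
  rewrite /b !normrM mulrC; apply: ler_pM => //.
  by rewrite -[leRHS]mul1r; exact: ler_wpM2r.
have [_ f0 _ _] := wf.
have a0 z : z.1 = 0 -> a z = 0 by move=> z0; rewrite /a z0 f0 mul0r mulr0.
have b0 z : z.1 = 0 -> b z = 0.
  move=> z0; rewrite /b /p2 patchE nablaA1 z0 f0 mul0r.
  by case: ifP => _; rewrite mulr0 mul0r.
have ca := cutoff_cvg ia a0; have cb := cutoff_cvg ib b0.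
have E : (fun n => \int[leb2R]_z (\1_[set z : R * R | n.+1%:R^-1 < `|z.1|] z * a z)) =
   (fun n => - \int[leb2R]_z (\1_[set z : R * R | n.+1%:R^-1 < `|z.1|] z * b z)).
  by apply/funext => n; apply: (cutoff_chain _ hG tpsi).
rewrite E in ca; exact: cvg_unique ca (cvgN cb).
Qed.

Lemma weak_gradient_comp G G' L : smooth_truncation G G' L ->
  weak_gradient f O (fun z => G (v z)) (fun z => G' (v z) *: g z).
Proof. by move=> hG psi tpsi; split; [exact: chain_rule1 hG tpsi|exact: chain_rule2 hG tpsi]. Qed.

End Fixed.
End SobolevChainRule.

(** * Pointwise bounds by integrals over full lines *)

Section LineSup.
Context {R : realType}.
Local Notation mu := (@lebesgue_measure R).
Local Notation leb2R := ((@lebesgue_measure R) \x (@lebesgue_measure R))%E.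
Local Notation plane := (measurableTypeR R * measurableTypeR R)%type.
Local Notation integ P := (leb2R.-integrable setT (EFin \o P)).
Implicit Types (P V : R * R -> R) (e z : R * R) (s t : R) (K : set (R * R)).

(** Half-open intervals concatenate without overlap, and an extended-real integral is additive in
    [n] with no integrability on the long segment. *)
Definition segn e (n : nat) t P z : \bar R :=
  (\int[mu]_(s in `[0%R, (n%:R * t)%R[) `|(P (pt e s z))%:E|)%E.

Lemma measurable_line e P z : measurable_fun [set: plane] P ->
  measurable_fun [set: measurableTypeR R] (fun s => P (pt e s z)).
Proof.
move=> mP; have := measurable_pt1 e 1 z; under eq_fun do rewrite pt_mul1.
by move=> m1; exact: measurableT_comp mP m1.
Qed.

Lemma segnS e n t P z : 0 <= t -> measurable_fun [set: plane] P ->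
  (segn e n.+1 t P z = segn e n t P z + segn e 1 t P (pt e (n%:R * t) z))%E.
Proof.
move=> t0 mP; have nt0 : 0 <= n%:R * t by exact: mulr_ge0.
have mm : measurable_fun [set: measurableTypeR R] (fun s => `|(P (pt e s z))%:E|%E).
  by apply: measurableT_comp => //; apply/measurable_EFinP; exact: measurable_line.
have E : `[0, (n.+1%:R * t)[%classic = `[0, (n%:R * t)[%classic `|` `[(n%:R * t), (n.+1%:R * t)[%classic :> set (measurableTypeR R).
  rewrite -itv_bndbnd_setU// !bnd_simp ler_wpM2r// ler_nat//.
rewrite {1}/segn E ge0_integral_setU//; last 2 first.
- exact: measurable_funTS.
- apply/disj_setPS => s [/=]; rewrite !in_itv/= => /andP[_ h1] /andP[h2 _].
  by have := lt_le_trans h1 h2; rewrite ltxx.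
congr (_ + _)%E.
rewrite /segn mul1r [LHS]integral_mkcond [RHS]integral_mkcond.
rewrite -(ge0_integral_trans1 (n%:R * t)).
- apply: eq_integral => s _; rewrite !patchE.
  have -> : (s + n%:R * t \in `[n%:R * t, (n.+1%:R * t)[%classic) = (s \in `[0, t[%classic).
    rewrite !mem_setE !in_itv/= -natr1 mulrDl mul1r lerDr; congr (_ && _).
    by rewrite addrC ltrD2l.
  by case: ifP => // _; rewrite ptD.
- have mI : measurable (`[(n%:R * t)%R, (n.+1%:R * t)%R[%classic : set (measurableTypeR R)).
    exact: measurable_itv.
  exact: (measurable_restrictT _ mI).1 (measurable_funTS mm).
- by move=> s; rewrite patchE; case: ifP.
Qed.

Lemma line_telescope e K V P t n : 0 < t -> integ P ->
  (forall z, ~ K z -> V z = 0) ->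
  {ae leb2R, forall z, K z \/ K (pt e t z) -> V (pt e t z) - V z = seg e t P z} ->
  {ae leb2R, forall z, (`|V (pt e (n%:R * t) z) - V z|%:E <= segn e n t P z)%E}.
Proof.
move=> t0 iP VK hD; have mP := integ_mfun iP.
have one : {ae leb2R, forall z, (`|V (pt e t z) - V z|%:E <= segn e 1 t P z)%E}.
  apply: (ae_imp (ae_and hD (ae_integrable_seg e t iP))) => z [hz iz].
  have s0 : (0 <= segn e 1 t P z)%E by exact: integral_ge0.
  have [h|/not_orP[n1 n2]] := pselect (K z \/ K (pt e t z)); last first.
    by rewrite !VK// subrr normr0.
  have mI : measurable (`[0%R, t]%classic : set (measurableTypeR R)) by exact: measurable_itv.
  rewrite hz//; apply: (@le_trans _ _ (\int[mu]_(s in `[0%R, t]) `|P (pt e s z)|)%:E).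
    by rewrite lee_fin; exact: (le_normr_Rintegral mI iz).
  rewrite -(integ_fin mI (integ_abs iz)) /segn mul1r integral_itv_bndo_bndc//.
  by apply: measurableT_comp => //; apply/measurable_EFinP; apply: measurable_funTS; exact: measurable_line.
elim: n => [|n IH].
  apply: ae_all => z; rewrite mul0r pt0 subrr normr0; exact: integral_ge0.
have one' := ae_trans2 (n%:R * t * e.1, n%:R * t * e.2) one.
apply: (ae_imp (ae_and IH one')) => z [h1 h2].
rewrite -/(pt e (n%:R * t) z) in h2.
rewrite (segnS _ _ _ (ltW t0) mP); apply: (le_trans _ (leeD h1 h2)).
have -> : pt e (n.+1%:R * t) z = pt e t (pt e (n%:R * t) z).
  by rewrite ptD; congr (pt e _ z); rewrite -natr1 mulrDl mul1r addrC.
by rewrite -EFinD lee_fin [leRHS]addrC; exact: ler_distD.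
Qed.

(** The difference identity is valid only for steps shorter than [t0], so it is summed over [n]
    steps until the segment has left [K]; at its far end [V] is zero and the difference is
    [- V z]. *)
Lemma line_sup e K V P (T : R) : integ P ->
  (forall z, ~ K z -> V z = 0) -> (forall z s, K z -> T <= s -> ~ K (pt e s z)) ->
  (exists2 t0, 0 < t0 & forall t, 0 < t < t0 ->
    {ae leb2R, forall z, K z \/ K (pt e t z) -> V (pt e t z) - V z = seg e t P z}) ->
  {ae leb2R, forall z, (`|V z|%:E <= \int[mu]_s `|(P (pt e s z))%:E|)%E}.
Proof.
move=> iP VK out [t0 t00 hD]; have mP := integ_mfun iP.
pose t := t0 / 2; have tp : 0 < t by exact: divr_gt0.
have tt : 0 < t < t0 by rewrite tp /t; lra.
pose n := (Num.truncn (`|T| / t)).+1.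
have nT : T <= n%:R * t.
  rewrite (le_trans (ler_norm _))// -ler_pdivrMr// ltW//; exact: truncnS_gt.
apply: (ae_imp (line_telescope n tp iP VK (hD t tt))) => z h.
have [Kz|/VK->] := pselect (K z); last by rewrite normr0; exact: integral_ge0.
have := h; rewrite (VK (pt e _ z)); last exact: out.
rewrite sub0r normrN => /le_trans; apply; rewrite /segn.
apply: ge0_subset_integral => //.
by apply: measurableT_comp => //; apply/measurable_EFinP; exact: measurable_line.
Qed.

End LineSup.

(** * The Sobolev inequality on sets of small measure *)

Section Sobolev1.
Context {R : realType}.
Local Notation mu := (@lebesgue_measure R).
Local Notation leb2R := ((@lebesgue_measure R) \x (@lebesgue_measure R))%E.
Local Notation plane := (measurableTypeR R * measurableTypeR R)%type.
Local Notation integ P := (leb2R.-integrable setT (EFin \o P)).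
Local Notation e1 := ((1, 0) : R * R).
Local Notation e2 := ((0, 1) : R * R).
Implicit Types (f : R -> R) (O K : set (R * R)) (v psi : R * R -> R)
  (g h : R * R -> 'cV[R]_2) (z : R * R).

Lemma inW1_integ f O v g : degenerate_weight f -> open O -> bounded_set O ->
  inW 1 f O v g ->
  [/\ integ (v \_ O), integ ((fun z => nablaA f g z 0 0) \_ O),
      integ ((fun z => nablaA f g z 1 0) \_ O) &
      leb2R.-integrable O (EFin \o (fun z => enorm (nablaA f g z)))].
Proof.
move=> wf oO bO [mv0 mg0 _ hW].
have mO : measurable (O : set plane) by exact: open_measurable2.
have mv : measurable_fun (O : set plane) v by exact mv0.
have mg i : measurable_fun (O : set plane) (fun z => g z i 0) by exact (mg0 i).
have [m0 m1] := measurable_nablaA mO wf mg.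
have iI := (Wint_integrable 1 mO wf mv mg).1 ((Wnorm_lty f O v g (isT : (0 < 1)%N)).1 hW).
have dom (q : R * R -> R) : measurable_fun (O : set plane) q ->
    (forall z, `|q z| <= `|v z| ^+ 1 + enorm (nablaA f g z) ^+ 1) -> leb2R.-integrable O (EFin \o q).
  by move=> mq qI; exact: (integ_le mO mq (fun z _ => qI z) iI).
split.
- by apply/(integ_patch _ mO); apply: dom => // z; rewrite !expr1 lerDl enorm_ge0.
- apply/(integ_patch _ mO); apply: dom => // z; rewrite !expr1.
  by apply: le_trans (enorm_comp0 _) _; rewrite lerDr.
- apply/(integ_patch _ mO); apply: dom => // z; rewrite !expr1.
  by apply: le_trans (enorm_comp1 _) _; rewrite lerDr.
- apply: dom; first exact: measurable_enorm.
  by move=> z; rewrite !expr1 ger0_norm ?enorm_ge0// lerDr.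
Qed.

(** The inner integral depends on [z.2] only, so the integral over the vertical strip above [B]
    factorises. *)
Lemma tonelli_fst (B : set (measurableTypeR R)) (q : R * R -> \bar R) :
  measurable B -> measurable_fun [set: plane] q -> (forall z, 0 <= q z)%E ->
  (\int[leb2R]_(z in B `*` setT) (\int[mu]_x q (x, z.2)) = mu B * \int[leb2R]_z q z)%E.
Proof.
move=> mB mq q0.
have mG := measurable_fun_fubini_tonelli_G (m1 := mu) q mq q0.
have G0 y : (0 <= fubini_G mu q y)%E by exact: integral_ge0.
rewrite integral_mkcond.
have -> : (fun z : plane => \int[mu]_x q (x, z.2))%E \_ (B `*` setT) =
   (fun z : plane => (\1_B z.1)%:E * fubini_G mu q z.2)%E.
  apply/funext => z; rewrite patchE indicE /=.
  have -> : (z \in B `*` setT) = (z.1 \in B).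
    by apply/idP/idP => /set_mem h; apply/mem_set; [case: h|split].
  by case: (z.1 \in B); rewrite ?mul1e ?mul0e.
rewrite (fubini_tonelli1 (m1 := mu) (m2 := mu)); last 2 first.
- apply: emeasurable_funM.
    have m1B : measurable_fun [set: measurableTypeR R] (\1_B : R -> R) by exact: measurable_indic.
    by apply/measurable_EFinP; exact: measurableT_comp m1B measurable_fst.
  exact: measurableT_comp mG measurable_snd.
- by move=> z; rewrite mule_ge0// lee_fin indicE.
rewrite /fubini_F /=.
have i0 (x : R) : (0%:E <= (\1_B x : R)%:E)%E by rewrite lee_fin indicE.
under eq_integral => x _ do rewrite ge0_integralZl//.
rewrite ge0_integralZr//; last 2 first.
- by apply/measurable_EFinP; exact: measurable_indic.
- exact: integral_ge0.
rewrite integral_indic// setIT; congr (_ * _)%E.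
by rewrite -(fubini_tonelli2 (m1 := mu) (m2 := mu)).
Qed.

(** The inner integral depends on [z.1] only; integrating it over a slice of [E] of length at most
    [tau] multiplies it by at most [tau]. *)
Lemma tonelli_snd (B : set (measurableTypeR R)) (E : set plane) (tau : R) (q : R * R -> \bar R) :
  measurable B -> measurable E -> measurable_fun [set: plane] q -> (forall z, 0 <= q z)%E ->
  0 <= tau -> (forall x, B x -> (mu (xsection E x) <= tau%:E)%E) ->
  (\int[leb2R]_(z in E `&` (B `*` setT)) (\int[mu]_y q (z.1, y)) <= tau%:E * \int[leb2R]_z q z)%E.
Proof.
move=> mB mE mq q0 t0 hB.
have mF := measurable_fun_fubini_tonelli_F (m2 := mu) q mq q0.
have F0 x : (0 <= fubini_F mu q x)%E by exact: integral_ge0.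
have mEB : measurable (E `&` (B `*` setT)) by apply: measurableI => //; exact: measurableX.
rewrite integral_mkcond.
have -> : (fun z : plane => \int[mu]_y q (z.1, y))%E \_ (E `&` (B `*` setT)) =
   (fun z : plane => fubini_F mu q z.1 * (\1_(E `&` (B `*` setT)) z)%:E)%E.
  by apply/funext => z; rewrite patchE indicE; case: (_ \in _); rewrite ?mule1 ?mule0.
rewrite (fubini_tonelli1 (m1 := mu) (m2 := mu)); last 2 first.
- apply: emeasurable_funM; first exact: measurableT_comp mF measurable_fst.
  by apply/measurable_EFinP; exact: measurable_indic.
- by move=> z; rewrite mule_ge0// lee_fin indicE.
rewrite (fubini_tonelli1 (m1 := mu) (m2 := mu) q mq q0) -ge0_integralZl//.
apply: ge0_le_integral => //.
- by move=> x _; apply: integral_ge0 => y _; rewrite mule_ge0// lee_fin indicE.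
- apply: (measurable_fun_fubini_tonelli_F (m2 := mu)
    (fun z : plane => fubini_F mu q z.1 * (\1_(E `&` (B `*` setT)) z)%:E)%E).
    apply: emeasurable_funM; first exact: measurableT_comp mF measurable_fst.
    by apply/measurable_EFinP; exact: measurable_indic.
  by move=> z; rewrite mule_ge0// lee_fin indicE.
- exact: emeasurable_funM.
move=> x _; rewrite /fubini_F /=.
rewrite ge0_integralZl//; last 2 first.
- apply/measurable_EFinP.
  have mi : measurable_fun [set: plane] (\1_(E `&` (B `*` setT)) : R * R -> R) by exact: measurable_indic.
  exact: measurableT_comp mi (measurable_pair1 x).
- exact: F0.
rewrite muleC; apply: lee_wpmul2r; first exact: F0.
have [xB|xB] := pselect (B x).
  apply: le_trans (hB x xB).
  rewrite (eq_integral (fun y => (\1_(xsection E x) y)%:E)); last first.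
    move=> y _; rewrite !indicE.
    suff -> : ((x, y) \in E `&` (B `*` setT)) = (y \in xsection E x) by [].
    apply/idP/idP => [/set_mem[Exy _]|/set_mem]; first by apply/mem_set; rewrite /xsection/=; exact/mem_set.
    by rewrite /xsection/= => /set_mem Exy; apply/mem_set; split.
  by rewrite integral_indic ?setIT//; exact: measurable_xsection.
rewrite (eq_integral (fun=> 0%E)); first by rewrite integral0 lee_fin.
  by move=> y _; rewrite indicE memNset// => -[_ []].
by move=> x _; exact: F0.
Qed.

Lemma sobolev_lipschitz f O psi h (E : set plane) (m tau rho : R) :
  degenerate_weight f -> open O -> bounded_set O -> lipschitz_c O psi -> inW 1 f O psi h ->
  measurable E -> (leb2R E <= m%:E)%E -> 0 < tau -> 0 < rho ->
  (\int[leb2R]_(z in E) `|(psi z)%:E| <=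
    (2 * rho + m / tau + tau / f rho)%:E * \int[leb2R]_(z in O) (enorm (nablaA f h z))%:E)%E.
Proof.
move=> wf oO bO [_ [cK KO]] hW mE Em tau0 rho0.
have [_ _ hw _] := hW.
have [iv ip1 ip2 ien] := inW1_integ wf oO bO hW.
have mO : measurable (O : set plane) by exact: open_measurable2.
set K := closure _ in cK KO.
have psiK z : ~ K z -> psi z = 0.
  by move=> nK; apply: contrapT => /eqP n; apply: nK; exact: subset_closure.
have psiO : psi \_ O = psi.
  apply/funext => z; rewrite patchE; case: ifPn => // /negP nO; rewrite psiK// => /KO Oz.
  by apply: nO; exact/mem_set.
have [_ f0 fpos fmono] := wf.
have [M M0 hM] := bounded_box bO.
have iV2 : integ (fun z => f z.1 * psi z).
  rewrite psiO in iv.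
  have mV : measurable_fun [set: plane] (fun z => f z.1 * psi z).
    apply: measurable_funM; last exact: integ_mfun iv.
    by case: wf => mf _ _ _; exact: measurableT_comp mf measurable_fst.
  apply: (integ_le measurableT mV _ (integZ measurableT (f M) (integ_abs iv))) => z _.
  rewrite normrM (ger0_norm (degenerate_weight_ge0 _ wf)).
  have [Kz|/psiK->] := pselect (K z); last by rewrite normr0 !mulr0.
  apply: ler_wpM2r => //; apply: fmono; have [h1 _] := hM _ (KO _ Kz).
  by rewrite (le_trans h1)// ler_norm.
set p1 := _ \_ O in ip1; set p2 := _ \_ O in ip2.
have out z s : K z -> 2 * M + 1 <= s -> ~ K (pt e1 s z) /\ ~ K (pt e2 s z).
  move=> /KO/hM[]; rewrite !ler_norml => /andP[? ?] /andP[? ?] Ms; split => /KO/hM[].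
    by rewrite pt_e1 ler_norml => /andP[_ /=]; lra.
  by rewrite pt_e2 => _; rewrite ler_norml => /andP[_ /=]; lra.
have sup1 : {ae leb2R, forall z, (`|psi z|%:E <= \int[mu]_s `|(p1 (pt e1 s z))%:E|)%E}.
  apply: (line_sup (K := K) ip1 psiK (fun z s Kz hs => (out z s Kz hs).1)).
  by have := weak_gradient_line1 oO hw iv ip1 cK KO; rewrite psiO.
have sup2 : {ae leb2R, forall z, (`|f z.1 * psi z|%:E <= \int[mu]_s `|(p2 (pt e2 s z))%:E|)%E}.
  apply: (line_sup (K := K) (V := fun z => f z.1 * psi z) ip2 _ (fun z s Kz hs => (out z s Kz hs).2)).
    by move=> z /psiK->; rewrite mulr0.
  have := weak_gradient_line2 (v := psi) oO hw _ ip2 cK KO; rewrite psiO; exact.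
pose T x := mu (xsection E x).
have mT : measurable_fun [set: measurableTypeR R] T by exact: measurable_fun_xsection.
pose B1 : set (measurableTypeR R) := `](- rho)%R, rho[%classic.
pose B2 : set (measurableTypeR R) := [set x | (tau%:E < T x)%E].
pose B := B1 `|` B2.
have mB1 : measurable B1 by exact: measurable_itv.
have mB2 : measurable B2.
  by rewrite -[B2]setTI; exact: emeasurable_fun_o_infty.
have mB : measurable B by exact: measurableU.
have m0 : 0 <= m by rewrite -lee_fin (le_trans _ Em).
(* Markov's inequality for the slice length [T], whose integral is the measure of [E]. *)
have muB2 : (mu B2 <= (m / tau)%:E)%E.
  have TE : (\int[mu]_x T x = leb2R E)%E by [].
  have : (tau%:E * mu B2 <= m%:E)%E.
    apply: le_trans Em; rewrite -TE -integral_cst//.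
    apply: (@le_trans _ _ (\int[mu]_(x in B2) T x)%E).
      apply: ge0_le_integral => //.
      - by move=> x _; rewrite lee_fin ltW.
      - exact: measurable_funTS.
      - by move=> x /= /ltW.
    by apply: ge0_subset_integral.
  by rewrite muleC -lee_pdivlMr// EFinM.
have muB : (mu B <= (2 * rho + m / tau)%:E)%E.
  have h0 : (mu B <= mu B1 + mu B2)%E by exact: measureU2.
  apply: (le_trans h0); rewrite EFinD; apply: leeD => //.
  rewrite lebesgue_measure_itv/= lte_fin; case: ifP => _; rewrite ?lee_fin; lra.
have mh i : measurable_fun (O : set plane) (fun z => h z i 0).
  by case: hW => _ mh0 _ _; exact (mh0 i).
have [mn0 mn1] := measurable_nablaA mO wf mh.
have men := measurable_enorm mO mn0 mn1.
pose X := (\int[leb2R]_(z in O) (enorm (nablaA f h z))%:E)%E.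
have X0 : (0 <= X)%E by apply: integral_ge0 => z _; rewrite lee_fin enorm_ge0.
have pq (q : R * R -> R) : measurable_fun (O : set plane) q ->
    (forall z, `|q z| <= enorm (nablaA f h z)) -> (\int[leb2R]_z `|(q \_ O) z|%:E <= X)%E.
  move=> mq qe.
  have -> : (\int[leb2R]_z `|(q \_ O) z|%:E = \int[leb2R]_(z in O) `|q z|%:E)%E.
    rewrite [RHS]integral_mkcond; apply: eq_integral => z _; rewrite !patchE.
    by case: ifP => // _; rewrite normr0.
  apply: ge0_le_integral => //.
  - by apply/measurable_EFinP; exact: measurableT_comp.
  - exact/measurable_EFinP.
  - by move=> z _; rewrite lee_fin.
have pq1 := pq _ mn0 (fun z => enorm_comp0 _); have pq2 := pq _ mn1 (fun z => enorm_comp1 _).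
have mpsi : measurable_fun [set: plane] (fun z => `|(psi z)%:E|%E).
  by rewrite psiO in iv; apply: measurableT_comp => //; apply/measurable_EFinP; exact: integ_mfun iv.
have mp1 : measurable_fun [set: plane] (fun z => `|(p1 z)%:E|%E).
  by apply: measurableT_comp => //; apply/measurable_EFinP; exact: integ_mfun ip1.
have mp2 : measurable_fun [set: plane] (fun z => `|(p2 z)%:E|%E).
  by apply: measurableT_comp => //; apply/measurable_EFinP; exact: integ_mfun ip2.
have mBT : measurable (B `*` setT : set plane) by exact: measurableX.
have mCT : measurable (E `&` (~` B `*` setT) : set plane).
  by apply: measurableI => //; apply: measurableX => //; exact: measurableC.
have split_int : (\int[leb2R]_(z in E) `|(psi z)%:E| <= \int[leb2R]_(z in B `*` setT) `|(psi z)%:E| +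
    \int[leb2R]_(z in E `&` (~` B `*` setT)) `|(psi z)%:E|)%E.
  rewrite -ge0_integral_setU//; last 2 first.
  - exact: measurable_funTS.
  - by apply/disj_setPS => z [[/= h1 _] [_ [/= h2 _]]].
  apply: ge0_subset_integral => //; first exact: measurableU.
    exact: measurable_funTS.
  by move=> z Ez; have [h1|h1] := pselect (B z.1); [left|right].
(* Here [E] is abandoned for the full strip above [B]: the horizontal bound does not depend on the
   abscissa, so only the measure of [B] enters. *)
have part1 : (\int[leb2R]_(z in B `*` setT) `|(psi z)%:E| <= (2 * rho + m / tau)%:E * X)%E.
  apply: (@le_trans _ _ (\int[leb2R]_(z in B `*` setT) (\int[mu]_x `|(p1 (x, z.2))%:E|))%E).
    apply: ae_ge0_le_integral => //.
    - exact: measurable_funTS.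
    - by move=> z _; exact: integral_ge0.
    - apply: measurable_funTS.
      have mG := measurable_fun_fubini_tonelli_G (m1 := mu) (fun z => `|(p1 z)%:E|%E) mp1 (fun z => abse_ge0 _).
      exact: measurableT_comp mG measurable_snd.
    - apply: (ae_imp sup1) => z hz _; apply: le_trans hz _.
      rewrite -[leRHS](ge0_integral_trans1 z.1)//.
        by under eq_integral => s _ do rewrite pt_e1 addrC.
      exact: measurableT_comp mp1 (measurable_pair2 _).
  have -> : (\int[leb2R]_(z in B `*` setT) (\int[mu]_x `|(p1 (x, z.2))%:E|) =
      mu B * \int[leb2R]_z `|(p1 z)%:E|)%E by exact: (tonelli_fst mB mp1 (fun z => abse_ge0 _)).
  by apply: lee_pmul => //; exact: integral_ge0.
have part2 : (\int[leb2R]_(z in E `&` (~` B `*` setT)) `|(psi z)%:E| <= (tau / f rho)%:E * X)%E.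
  have frho : 0 < f rho by apply: fpos; rewrite gt_eqF.
  have fi : (0 <= ((f rho)^-1)%:E)%E by rewrite lee_fin invr_ge0 ltW.
  pose q z := (((f rho)^-1)%:E * `|(p2 z)%:E|)%E.
  have mq : measurable_fun [set: plane] q by exact: measurable_funeM.
  have q0 z : (0 <= q z)%E by rewrite mule_ge0.
  apply: (@le_trans _ _ (\int[leb2R]_(z in E `&` (~` B `*` setT)) (\int[mu]_y q (z.1, y)))%E).
    apply: ae_ge0_le_integral => //.
    - exact: measurable_funTS.
    - by move=> z _; exact: integral_ge0.
    - apply: measurable_funTS.
      have mF := measurable_fun_fubini_tonelli_F (m2 := mu) q mq q0.
      exact: measurableT_comp mF measurable_fst.
    - apply: (ae_imp sup2) => z hz [_ [/= nB _]].
      have mp2z : measurable_fun [set: measurableTypeR R] (fun y => `|(p2 (z.1, y))%:E|%E).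
        exact: measurableT_comp mp2 (measurable_pair1 _).
      rewrite /q ge0_integralZl//.
      have zrho : rho <= `|z.1|.
        rewrite leNgt; apply/negP => h1; apply: nB; left.
        by rewrite /B1 /= in_itv/= -ltr_norml.
      have fz : f rho <= f z.1 by apply: fmono; rewrite gtr0_norm.
      apply: (@le_trans _ _ (((f rho)^-1)%:E * `|f z.1 * psi z|%:E)%E).
        rewrite -EFinM lee_fin normrM ger0_norm ?(le_trans (ltW frho))//.
        by rewrite mulrA ler_peMl// ler_pdivlMl// mulr1.
      apply: lee_wpmul2l => //; apply: le_trans hz _.
      rewrite -[leRHS](ge0_integral_trans1 z.2)//.
      by under eq_integral => s _ do rewrite pt_e2 addrC.
  apply: le_trans (tonelli_snd _ mE mq q0 (ltW tau0) _) _.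
  - exact: measurableC.
  - move=> x nB; rewrite leNgt; apply/negP => h1; apply: nB; right; exact: h1.
  rewrite /q ge0_integralZl// muleA -EFinM; apply: lee_wpmul2l => //.
  by rewrite lee_fin divr_ge0// ltW.
apply: (le_trans split_int); rewrite (EFinD (2 * rho + m / tau)) ge0_muleDl ?lee_fin.
- exact: leeD.
- by rewrite addr_ge0// ?divr_ge0// ?mulr_ge0// ltW.
- by rewrite divr_ge0// ?ltW// fpos// gt_eqF.
Qed.

End Sobolev1.

(** * Uniqueness of weak gradients *)

Section Uniqueness.
Context {R : realType}.
Local Notation mu := (@lebesgue_measure R).
Local Notation leb2R := ((@lebesgue_measure R) \x (@lebesgue_measure R))%E.
Local Notation plane := (measurableTypeR R * measurableTypeR R)%type.
Local Notation integ P := (leb2R.-integrable setT (EFin \o P)).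
Local Notation e1 := ((1, 0) : R * R).
Local Notation e2 := ((0, 1) : R * R).
Implicit Types (f : R -> R) (O K : set (R * R)) (v psi q : R * R -> R)
  (g h : R * R -> 'cV[R]_2) (z : R * R).

Lemma ae_countable (I : countType) (Q : I -> R * R -> Prop) :
  (forall i, {ae leb2R, forall z, Q i z}) -> {ae leb2R, forall z, forall i, Q i z}.
Proof.
move=> h.
have : {ae leb2R, forall z, forall n, if unpickle n is Some i then Q i z else True}.
  apply: ae_foralln => n; case: (unpickle n) => [i|]; first exact: h.
  exact: ae_all.
move=> /ae_imp; apply => z hz i; by have := hz (pickle i); rewrite pickleK.
Qed.

(** On a rational box whose closure lies in [O], every bump supported in the closed box is a test
    function. The countably many such boxes cover [O]. *)
Lemma ae0_of_test O q : open O -> integ (q \_ O) ->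
  (forall psi, test_function O psi -> \int[leb2R]_(z in O) (q z * psi z) = 0) ->
  {ae leb2R, forall z, O z -> q z = 0}.
Proof.
move=> oO iq hq.
pose box (i : rat * rat * rat) : set plane :=
  `](ratr i.1.1 - ratr i.2)%R, (ratr i.1.1 + ratr i.2)%R[%classic `*`
  `](ratr i.1.2 - ratr i.2)%R, (ratr i.1.2 + ratr i.2)%R[%classic.
pose cbox (i : rat * rat * rat) : set (R * R) :=
  `[(ratr i.1.1 - ratr i.2)%R, (ratr i.1.1 + ratr i.2)%R]%classic `*`
  `[(ratr i.1.2 - ratr i.2)%R, (ratr i.1.2 + ratr i.2)%R]%classic.
have : {ae leb2R, forall z, forall i : rat * rat * rat, cbox i `<=` O -> box i z -> q z = 0}.
  apply: ae_countable => i.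
  have [iO|niO] := pselect (cbox i `<=` O); last by apply: ae_all.
  have mb : measurable (box i) by apply: measurableX; exact: measurable_itv.
  have bc : box i `<=` cbox i.
    by move=> z [/=]; rewrite !in_itv/= => /andP[? ?] /andP[? ?]; split; rewrite /= in_itv/= !ltW.
  have mq := integ_mfun iq.
  pose q' z := \1_(box i) z * (q \_ O) z.
  have q'E z : box i z -> q' z = q z.
    by move=> bz; rewrite /q' indicE mem_set// mul1r patchE mem_set//; exact/iO/bc.
  have q'0 z : ~ box i z -> q' z = 0 by move=> bz; rewrite /q' indicE memNset// mul0r.
  have iq' : integ q'.
    apply: (integM measurableT (c := 1)) => //.
    by move=> z _; rewrite indicE normr_nat; case: (_ \in _).
  have : {ae leb2R, forall z, q' z = 0}.
    apply: (ae0_of_bumps iq' q'0) => n a b c e ha hb hc he.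
    have tt : test_function O (fun z => bumpn n.+1 a b z.1 * bumpn n.+1 c e z.2).
      apply: (test_tensor (a := a) (b := b) (c := c) (d := e)).
      - exact: smooth_bumpn.
      - exact: smooth_bumpn.
      - by move=> x; exact: bumpn_out_cc.
      - by move=> x; exact: bumpn_out_cc.
      move=> z [/=]; rewrite !in_itv/= => /andP[? ?] /andP[? ?].
      by apply: iO; split; rewrite /= in_itv/=; apply/andP; split; lra.
    have := hq _ tt.
    rewrite (plane_Rintegral (q := fun z => bumpn n.+1 a b z.1 * bumpn n.+1 c e z.2 * (q \_ O) z)).
    - move=> E0; rewrite -[RHS]E0; apply: eq_Rintegral => z _.
      have [bz|nbz] := pselect (box i z).
        by rewrite q'E// patchE mem_set//; exact/iO/bc.
      rewrite q'0// mulr0.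
      have : (z.1 \notin `]a, b[) \/ (z.2 \notin `]c, e[).
        have [h1|] := boolP (z.1 \in `]a, b[); last by left.
        have [h2|] := boolP (z.2 \in `]c, e[); last by right.
        exfalso; apply: nbz; move: h1 h2; rewrite !in_itv/= => /andP[? ?] /andP[? ?].
        by split; rewrite /= in_itv/=; apply/andP; split; lra.
      by case=> h; rewrite (bumpn_out _ h)// ?mulr0 ?mul0r.
    - by move=> z Oz; rewrite patchE mem_set// mulrC.
    - by move=> z nOz; rewrite patchE memNset// mulr0.
  by move=> /ae_imp; apply => z hz _ bz; rewrite -q'E.
move=> /ae_imp; apply => z hz Oz.
have /nbhs_ballP[e/= e0 eO] : nbhs z O by exact: open_nbhs_nbhs.
have [r] := @rat_in_itvoo R 0 (e / 2) ltac:(lra); rewrite in_itv/= => /andP[r0 re].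
have [a] := @rat_in_itvoo R (z.1 - ratr r) z.1 ltac:(lra); rewrite in_itv/= => /andP[a0 a1].
have [b] := @rat_in_itvoo R (z.2 - ratr r) z.2 ltac:(lra); rewrite in_itv/= => /andP[b0 b1].
apply: (hz (a, b, r)).
  case => x y [] /=; rewrite !in_itv/= => /andP[? ?] /andP[? ?].
  by apply: eO; split => /=; rewrite /ball/= ltr_norml; apply/andP; split; lra.
by split; rewrite /= in_itv/=; apply/andP; split; lra.
Qed.

Lemma closed_measurable2 K : closed K -> measurable (K : set plane).
Proof. by move=> cK; rewrite -[K]setCK; apply: measurableC; apply: open_measurable2; exact: closed_openC. Qed.

(** As [a] is invariant along [e], the integrals of [a * phi] and of [a] times the translate of
    [phi] agree. Hence [t] times the integral in question equals the integral of a Taylor remainder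
    of order [t ^+ 2], and [t] tends to [0]. *)
Lemma integral_line_derivative K (e : R * R) (A C : R) (a phi dphi : R * R -> R) :
  compact K -> (leb2R K < +oo)%E -> line_bounds K e C phi dphi ->
  measurable_fun [set: plane] phi -> measurable_fun [set: plane] dphi ->
  measurable_fun [set: plane] a -> (forall s z, a (pt e s z) = a z) ->
  0 <= A -> (forall z, K z -> `|a z| <= A) ->
  \int[leb2R]_z (a z * dphi z) = 0.
Proof.
move=> cK Koo [C0 pK dK [pC dC] [_ pT]] mphi mdphi ma ainv A0 aA.
have clK : closed K by apply: compact_closed => //; exact: norm_hausdorff.
have mK := closed_measurable2 clK.
pose kappa : R * R -> R := \1_K.
have ik : integ kappa.
  have := (integ_patch (cst 1) mK).1 (integ_cst mK 1 Koo); congr (_.-integrable _ (_ \o _)).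
  by apply/funext => z; rewrite patchE /kappa indicE /=; case: ifP.
have k0 z : 0 <= kappa z by rewrite /kappa indicE.
have k1 z : K z -> kappa z = 1 by move=> Kz; rewrite /kappa indicE mem_set.
have ib (h : R * R -> R) : measurable_fun [set: plane] h -> (forall z, ~ K z -> h z = 0) ->
    (forall z, `|h z| <= C) -> integ (fun z => a z * h z).
  move=> mh h0 hC; apply: (integ_le measurableT _ _ (integZ measurableT (A * C) ik)).
    exact: measurable_funM.
  move=> z _; have [Kz|/[dup] nKz /h0->] := pselect (K z); last first.
    by rewrite mulr0 normr0 !mulr_ge0.
  by rewrite k1// mulr1 normrM ler_pM// aA.
have ip := ib _ mphi pK pC; have id := ib _ mdphi dK dC.
set I := \int[leb2R]_z _.
suff small t : 0 < t -> `|I| <= (2 * (A * C) * \int[leb2R]_z kappa z) * t.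
  apply/eqP; rewrite -normr_eq0 eq_le normr_ge0 andbT.
  apply/ler_addgt0Pr => e0 e0p; rewrite add0r.
  set B := _ * \int[leb2R]_z kappa z in small.
  have B0 : 0 <= B by rewrite /B !mulr_ge0//; exact: Rintegral_ge0.
  have t0 : 0 < e0 / (B + 1) by rewrite divr_gt0// ltr_wpDl.
  apply: le_trans (small _ t0) _; rewrite mulrCA; apply: ler_piMr; first exact: ltW.
  by rewrite ler_pdivrMr ?ltr_wpDl// mul1r lerDl.
move=> t0; pose D := trans2 ((- t) * e.1, (- t) * e.2).
have DE z : D z = pt e (- t) z by [].
have iD : integ (fun z => a z * phi (D z)).
  have := integ_trans2 ((- t) * e.1, (- t) * e.2) ip; congr (_.-integrable _ (_ \o _)).
  by apply/funext => z /=; rewrite -/(pt e (- t) z) ainv.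
have ikD : integ (fun z => kappa (D z)) by exact: (integ_trans2 ((- t) * e.1, (- t) * e.2) ik).
have E1 : \int[leb2R]_z (a z * phi (D z)) = \int[leb2R]_z (a z * phi z).
  rewrite -(Rintegral_trans2 ((- t) * e.1, (- t) * e.2) ip).
  by apply: eq_Rintegral => z _; rewrite -/(pt e (- t) z) ainv.
have E2 : \int[leb2R]_z kappa (D z) = \int[leb2R]_z kappa z.
  exact: (Rintegral_trans2 ((- t) * e.1, (- t) * e.2) ik).
pose rem z := a z * phi (D z) - a z * phi z + t * (a z * dphi z).
have iB := integB measurableT iD ip.
have itd := integZ measurableT t id.
have irem : integ rem by exact: integD.
have Erem : \int[leb2R]_z rem z = t * I.
  rewrite /rem RintegralD// RintegralB// E1 subrr add0r.
  exact: (RintegralZl t measurableT id).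
have ikk := integZ measurableT (A * C * t ^+ 2) (integD measurableT ik ikD).
have bound z : `|rem z| <= A * C * t ^+ 2 * (kappa z + kappa (D z)).
  have [h|/not_orP[n1 n2]] := pselect (K z \/ K (D z)); last first.
    rewrite /rem !pK// dK// !mulr0 subrr addr0 normr0.
    by apply: mulr_ge0; [rewrite mulr_ge0 ?sqr_ge0// mulr_ge0|rewrite addr_ge0].
  have az : `|a z| <= A by case: h => [|/aA]; [exact: aA|rewrite DE ainv].
  have kk : 1 <= kappa z + kappa (D z).
    by case: h => /k1 ->; rewrite ?lerDl ?lerDr.
  have -> : rem z = a z * (phi (pt e (- t) z) - phi z + t * dphi z) by rewrite /rem DE; ring.
  rewrite normrM; apply: (@le_trans _ _ (A * (C * t ^+ 2))).
    by apply: ler_pM => //; exact: pT.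
  rewrite mulrA -[leLHS]mulr1; apply: ler_wpM2l => //; rewrite mulr_ge0 ?sqr_ge0//; exact: mulr_ge0.
have : `|t * I| <= A * C * t ^+ 2 * (\int[leb2R]_z kappa z + \int[leb2R]_z kappa z).
  rewrite -Erem; apply: le_trans (le_normr_Rintegral measurableT irem) _.
  rewrite -{2}E2 -RintegralD// -(RintegralZl _ measurableT (integD measurableT ik ikD)).
  apply: le_Rintegral => //; first exact: integ_abs.
rewrite normrM (gtr0_norm t0) -mulr2n -mulr_natl => h.
rewrite -(ler_pM2l t0); apply: le_trans h _; rewrite le_eqVlt; apply/orP; left; apply/eqP; ring.
Qed.

Lemma weak_gradient_cst f O (c : R) : degenerate_weight f -> open O -> bounded_set O ->
  weak_gradient f O (cst c) (cst 0).
Proof.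
move=> wf oO bO psi tpsi.
have [C1 lb1] := test_bounds1 tpsi; have [C2 lb2] := test_bounds2 tpsi.
have [_ [cK KO]] := tpsi.
have [M M0 hM] := bounded_box bO.
move: cK KO lb1 lb2; set K := closure _ => cK KO lb1 lb2.
have clK : closed K by exact: closed_closure.
have Koo : (leb2R K < +oo)%E.
  apply: le_lt_trans (bounded_lebesgue oO bO).
  by apply: le_measure; rewrite ?inE//; [exact: closed_measurable2|exact: open_measurable2].
have [cpsi _ _ [cd1 _ _ _ _] [cd2 _ _ _ _]] := tpsi.1 2%N.
have mpsi := continuous_measurable2 cpsi.
have md1 := continuous_measurable2 cd1; have md2 := continuous_measurable2 cd2.
have z0 (i : 'I_2) : \int[leb2R]_(z in O) (nablaA f (cst 0) z i 0 * psi z) = 0.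
  rewrite (plane_Rintegral (q := fun=> 0))//; last by move=> z _; rewrite !mxE; case: ifP => _; rewrite ?mulr0 mul0r.
  by rewrite Rintegral_cst// mul0r.
rewrite !z0 oppr0; split.
  rewrite (plane_Rintegral (q := fun z => cst c z * d1 psi z))//.
    apply: (integral_line_derivative (A := `|c|) cK Koo lb1 mpsi md1) => //.
  by case: lb1 => _ _ d0 _ _ z nO; rewrite d0 ?mulr0// => /KO.
rewrite (plane_Rintegral (q := fun z => (c * f z.1) * d2 psi z)).
- apply: (integral_line_derivative (A := `|c| * f M) cK Koo lb2 mpsi md2).
  + apply: measurable_funM => //; case: wf => mf _ _ _; exact: measurableT_comp mf measurable_fst.
  + by move=> s z; rewrite pt_e2.
  + by rewrite mulr_ge0//; exact: degenerate_weight_ge0.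
  + move=> z /KO /hM[h _]; rewrite normrM ler_wpM2l// ger0_norm; last exact: degenerate_weight_ge0.
    by case: wf => _ _ _; apply; rewrite (le_trans h)// ler_norm.
- by move=> z _; rewrite mulrA.
- by case: lb2 => _ _ d0 _ _ z nO; rewrite d0 ?mulr0// => /KO.
Qed.

(** The two functions may differ by a constant because a truncation shifted by [l] has to be
    renormalised to vanish at [0]. The result compares [nablaA], the only combination that the weak
    identities determine. *)
Lemma weak_gradient_unique f O v v' g g' (c : R) :
  degenerate_weight f -> open O -> bounded_set O ->
  weak_gradient f O v g -> weak_gradient f O v' g' -> (forall z, O z -> v z = v' z + c) ->
  integ (v' \_ O) ->
  (forall i, integ ((fun z => nablaA f g z i 0) \_ O)) ->
  (forall i, integ ((fun z => nablaA f g' z i 0) \_ O)) ->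
  {ae leb2R, forall z, O z -> nablaA f g z = nablaA f g' z}.
Proof.
move=> wf oO bO hg hg' vE iv' ig ig'.
have mO : measurable (O : set plane) by exact: open_measurable2.
have {}iv' := (integ_patch _ mO).2 iv'.
have igO i := (integ_patch _ mO).2 (ig i); have igO' i := (integ_patch _ mO).2 (ig' i).
have [M M0 hM] := bounded_box bO.
have Ooo := bounded_lebesgue oO bO.
have key (i : 'I_2) : {ae leb2R, forall z, O z -> nablaA f g z i 0 - nablaA f g' z i 0 = 0}.
  apply: ae0_of_test => //.
    have := integB measurableT (ig i) (ig' i); congr (_.-integrable _ (_ \o _)).
    by apply/funext => z; rewrite !patchE; case: ifP => // _; rewrite subrr.
  move=> psi tpsi.
  have [C1 [_ pK dK1 [pC dC1] _]] := test_bounds1 tpsi; have [C2 [_ _ dK2 [_ dC2] _]] := test_bounds2 tpsi.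
  have [_ [cK KO]] := tpsi.
  have [cpsi _ _ [cd1 _ _ _ _] [cd2 _ _ _ _]] := tpsi.1 2%N.
  have mT (h : R * R -> R) : measurable_fun [set: plane] h -> measurable_fun (O : set plane) h.
    by move=> mh; exact: measurable_funTS.
  have ipsi (q : R * R -> R) : leb2R.-integrable O (EFin \o q) -> leb2R.-integrable O (EFin \o (fun z => q z * psi z)).
    move=> iq; under eq_fun do rewrite mulrC.
    exact: (integM mO (c := C1) (mT _ (continuous_measurable2 cpsi))).
  have -> : \int[leb2R]_(z in O) ((nablaA f g z i 0 - nablaA f g' z i 0) * psi z) =
      \int[leb2R]_(z in O) (nablaA f g z i 0 * psi z - nablaA f g' z i 0 * psi z).
    by apply: eq_Rintegral => z _; rewrite mulrBl.
  rewrite RintegralB//; [|exact: ipsi|exact: ipsi].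
  have [h1 h2] := hg _ tpsi; have [h1' h2'] := hg' _ tpsi.
  have [c1 c2] := weak_gradient_cst c wf oO bO tpsi.
  have z0 (j : 'I_2) : \int[leb2R]_(z in O) (nablaA f (cst 0) z j 0 * psi z) = 0.
    rewrite (plane_Rintegral (q := fun=> 0))//; last by move=> z _; rewrite !mxE; case: ifP => _; rewrite ?mulr0 mul0r.
    by rewrite Rintegral_cst// mul0r.
  rewrite z0 oppr0 in c1; rewrite z0 oppr0 in c2.
  have comb (B : R) (h : R * R -> R) : measurable_fun [set: plane] h -> (forall z, O z -> `|h z| <= B) ->
      \int[leb2R]_(z in O) (cst c z * h z) = 0 ->
      \int[leb2R]_(z in O) (v z * h z) = \int[leb2R]_(z in O) (v' z * h z).
    move=> mh hB e0.
    have i1 : leb2R.-integrable O (EFin \o (fun z => v' z * h z)).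
      by under eq_fun do rewrite mulrC; exact: (integM mO (c := B) (mT _ mh)).
    have i2 : leb2R.-integrable O (EFin \o (fun z => cst c z * h z)).
      by under eq_fun do rewrite mulrC; exact: (integM mO (c := B) (mT _ mh) hB (integ_cst mO c Ooo)).
    have -> : \int[leb2R]_(z in O) (v z * h z) = \int[leb2R]_(z in O) (v' z * h z + cst c z * h z).
      by apply: eq_Rintegral => z /set_mem Oz; rewrite vE// mulrDl.
    by rewrite RintegralD// e0 addr0.
  have E1 := comb C1 _ (continuous_measurable2 cd1) (fun z _ => dC1 z) c1.
  have E2 : \int[leb2R]_(z in O) (v z * (f z.1 * d2 psi z)) = \int[leb2R]_(z in O) (v' z * (f z.1 * d2 psi z)).
    apply: (comb (f M * C2) _ _ _ c2).
      apply: measurable_funM; last exact: continuous_measurable2.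
      case: wf => mf _ _ _; exact: measurableT_comp mf measurable_fst.
    move=> z /hM[h _]; rewrite normrM ler_pM// ger0_norm; last exact: degenerate_weight_ge0.
    by case: wf => _ _ _; apply; rewrite (le_trans h)// ler_norm.
  rewrite E1 h1' in h1; rewrite E2 h2' in h2.
  apply/eqP; rewrite subr_eq0; apply/eqP; apply: oppr_inj.
  have [->|->] : i = 0 \/ i = 1 by case: i {ig ig' igO igO'} => -[|[|//]] lt; [left|right]; exact: val_inj.
    by rewrite h1.
  by rewrite h2.
apply: (ae_imp (ae_and (key 0) (key 1))) => z [k0 k1] Oz.
apply/matrixP => i j; rewrite ord1; apply/eqP; rewrite -subr_eq0; apply/eqP.
have [->|->] : i = 0 \/ i = 1 by case: i => -[|[|//]] lt; [left|right]; exact: val_inj.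
  exact: k0.
exact: k1.
Qed.

End Uniqueness.

(** * Truncations with Lipschitz derivative *)

Section Truncation.
Context {R : realType}.
Implicit Types (m d t a b : R).

(* [trunc_fun m d] smooths [max (t - m - d / 2) 0] on [m, m + d]. *)
Definition trunc_der m d t : R := Num.min (Num.max (t - m) 0) d / d.
Definition trunc_fun m d t : R :=
  Num.max (t - m - d) 0 + Num.min (Num.max (t - m) 0) d ^+ 2 / (2 * d).

Lemma trunc_cases m d t : 0 < d ->
  [\/ [/\ t <= m, d * trunc_der m d t = 0 & d * trunc_fun m d t = 0],
      [/\ m <= t <= m + d, d * trunc_der m d t = t - m & d * trunc_fun m d t = (t - m) ^+ 2 / 2] |
      [/\ m + d <= t, d * trunc_der m d t = d & d * trunc_fun m d t = d * (t - m - d) + d ^+ 2 / 2]].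
Proof.
move=> d0; have dn : d != 0 by rewrite gt_eqF.
rewrite /trunc_der /trunc_fun; have [tm|tm] := leP t m.
  constructor 1; rewrite (max_r (_ : t - m <= 0)) ?subr_le0// (max_r (_ : t - m - d <= 0)); last by lra.
  by rewrite min_l ?ltW//; split; rewrite // ?expr0n/= ?mul0r ?add0r mulr0.
have [td|td] := leP t (m + d).
  constructor 2; rewrite (max_l (_ : 0 <= t - m)); last by lra.
  rewrite (max_r (_ : t - m - d <= 0)); last by lra.
  rewrite min_l; last by lra.
  split; [by apply/andP; split; [exact: ltW|]|by rewrite mulrC divfK|by rewrite add0r; field].
constructor 3; rewrite (max_l (_ : 0 <= t - m)); last by lra.
rewrite (max_l (_ : 0 <= t - m - d)); last by lra.
rewrite min_r; last by lra.
by split; [exact: ltW|rewrite divff ?mulr1|field].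
Qed.

Lemma trunc_low m d t : 0 < d -> t <= m -> trunc_fun m d t = 0 /\ trunc_der m d t = 0.
Proof.
move=> d0 tm; have dn : d != 0 by rewrite gt_eqF.
suff [h1 h2] : d * trunc_fun m d t = 0 /\ d * trunc_der m d t = 0.
  by split; apply: (mulfI dn); rewrite mulr0.
have [[_ -> ->]//|[/andP[h _] -> ->]|[h _ _]] := trunc_cases m t d0; last by exfalso; lra.
have -> : t - m = 0 by lra.
by rewrite expr0n/= mul0r.
Qed.

Lemma trunc_der_itv m d t : 0 < d -> 0 <= trunc_der m d t <= 1.
Proof.
move=> d0; suff : 0 <= d * trunc_der m d t <= d.
  by move=> /andP[h1 h2]; apply/andP; split; rewrite -(ler_pM2l d0) ?mulr0 ?mulr1.
by have [[_ -> _]|[/andP[? ?] -> _]|[_ -> _]] := trunc_cases m t d0; apply/andP; split; lra.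
Qed.

Lemma trunc_fun_ge0 m d t : 0 < d -> 0 <= trunc_fun m d t.
Proof.
move=> d0; rewrite -(pmulr_rge0 _ d0).
have [[_ _ ->]//|[_ _ ->]|[h _ ->]] := trunc_cases m t d0; first by rewrite divr_ge0 ?sqr_ge0.
by rewrite addr_ge0 ?divr_ge0 ?sqr_ge0//; apply: mulr_ge0; lra.
Qed.

Lemma trunc_fun_high m d t : 0 < d -> m + d <= t -> d / 2 <= trunc_fun m d t.
Proof.
move=> d0 td; rewrite -(ler_pM2l d0).
have [[h _ _]|[/andP[h1 h2] _ ->]|[h _ ->]] := trunc_cases m t d0; first by exfalso; lra.
  have -> : t - m = d by lra.
  by rewrite expr2 mulrA.
by rewrite mulrA -expr2 lerDr; apply: mulr_ge0; lra.
Qed.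

Lemma trunc_der_lip m d a b : 0 < d -> a <= b ->
  0 <= d * trunc_der m d b - d * trunc_der m d a <= b - a.
Proof.
move=> d0 ab.
have [[? -> _]|[/andP[? ?] -> _]|[? -> _]] := trunc_cases m a d0;
have [[? -> _]|[/andP[? ?] -> _]|[? -> _]] := trunc_cases m b d0; apply/andP; split; lra.
Qed.

Lemma trunc_fun_lip m d a b : 0 < d -> a <= b ->
  0 <= d * trunc_fun m d b - d * trunc_fun m d a <= d * (b - a).
Proof.
move=> d0 ab.
have [[? _ ->]|[/andP[? ?] _ ->]|[? _ ->]] := trunc_cases m a d0;
have [[? _ ->]|[/andP[? ?] _ ->]|[? _ ->]] := trunc_cases m b d0; apply/andP; split; nra.
Qed.

Lemma trunc_taylor m d a b : 0 < d ->
  `|d * trunc_fun m d b - d * trunc_fun m d a - d * trunc_der m d a * (b - a)| <= (b - a) ^+ 2.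
Proof.
move=> d0; rewrite ler_norml.
(* In the cases below, products of the signed distances to the breakpoints [m] and [m + d] supply
   the quadratic terms that linear arithmetic needs. *)
have P (x y : R) : 0 <= x -> 0 <= y -> 0 <= x * y by exact: mulr_ge0.
have [[h1 -> ->]|[/andP[h1 h2] -> ->]|[h1 -> ->]] := trunc_cases m a d0;
have [[k1 _ ->]|[/andP[k1 k2] _ ->]|[k1 _ ->]] := trunc_cases m b d0.
- by have H := sqr_ge0 (b - a); apply/andP; split; lra.
- have H0 := P (m - a) (b - m) ltac:(lra) ltac:(lra).
  have H1 := P (m - a) (m - a) ltac:(lra) ltac:(lra).
  have H2 := P (b - m) (b - m) ltac:(lra) ltac:(lra).
  by apply/andP; split; lra.
- have H0 := P (m - a) (b - m) ltac:(lra) ltac:(lra).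
  have H1 := P (m - a) (m - a) ltac:(lra) ltac:(lra).
  have H2 := P (b - m - d) (d) ltac:(lra) ltac:(lra).
  have H3 := P (b - m - d) (b - m - d) ltac:(lra) ltac:(lra).
  have H4 := P (d) (d) ltac:(lra) ltac:(lra).
  by apply/andP; split; nra.
- have H0 := P (a - m) (m - b) ltac:(lra) ltac:(lra).
  have H1 := P (a - m) (a - m) ltac:(lra) ltac:(lra).
  have H2 := P (m - b) (m - b) ltac:(lra) ltac:(lra).
  by apply/andP; split; lra.
- by have H := sqr_ge0 (b - a); apply/andP; split; lra.
- have H0 := P (m + d - a) (b - m - d) ltac:(lra) ltac:(lra).
  have H1 := P (m + d - a) (m + d - a) ltac:(lra) ltac:(lra).
  have H2 := P (b - m - d) (b - m - d) ltac:(lra) ltac:(lra).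
  by apply/andP; split; lra.
- have H0 := P (a - m - d) (m - b) ltac:(lra) ltac:(lra).
  have H1 := P (a - m - d) (d) ltac:(lra) ltac:(lra).
  have H2 := P (d) (m - b) ltac:(lra) ltac:(lra).
  have H3 := P (a - m - d) (a - m - d) ltac:(lra) ltac:(lra).
  have H4 := P (m - b) (m - b) ltac:(lra) ltac:(lra).
  have H5 := P (d) (d) ltac:(lra) ltac:(lra).
  by apply/andP; split; lra.
- have H0 := P (a - m - d) (m + d - b) ltac:(lra) ltac:(lra).
  have H1 := P (a - m - d) (a - m - d) ltac:(lra) ltac:(lra).
  have H2 := P (m + d - b) (m + d - b) ltac:(lra) ltac:(lra).
  by apply/andP; split; lra.
- by have H := sqr_ge0 (b - a); apply/andP; split; lra.
Qed.

(** [trunc_der] rises from [0] to [1] over a length [d], whence the constant [d^-1]; [0 <= m] places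
    [0] in the region where the truncation vanishes. *)
Lemma trunc_smooth m d : 0 <= m -> 0 < d ->
  smooth_truncation (trunc_fun m d) (trunc_der m d) d^-1.
Proof.
move=> m0 d0.
have sc x : x = d^-1 * (d * x) by rewrite mulKf// gt_eqF.
have abssc x : `|x| = d^-1 * `|d * x| by rewrite normrM (gtr0_norm d0) -sc.
have lip a b : `|trunc_fun m d b - trunc_fun m d a| <= `|b - a|.
  wlog ab : a b / a <= b.
    by move=> wl; have [/wl//|/ltW/wl] := leP a b; rewrite distrC (distrC a).
  rewrite abssc ler_pdivrMl// (ger0_norm (_ : 0 <= b - a)) ?subr_ge0//.
  by have /andP[h1 h2] := trunc_fun_lip m d0 ab; rewrite mulrBr ger0_norm.
have lip' a b : `|trunc_der m d b - trunc_der m d a| <= d^-1 * `|b - a|.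
  wlog ab : a b / a <= b.
    by move=> wl; have [/wl//|/ltW/wl] := leP a b; rewrite distrC (distrC a).
  rewrite abssc ler_pM2l ?invr_gt0// (ger0_norm (_ : 0 <= b - a)) ?subr_ge0//.
  by have /andP[h1 h2] := trunc_der_lip m d0 ab; rewrite mulrBr ger0_norm.
split.
- by rewrite invr_ge0 ltW.
- move=> a b; rewrite abssc ler_pM2l ?invr_gt0//.
  apply: le_trans (trunc_taylor m a b d0); rewrite le_eqVlt; apply/orP; left; apply/eqP.
  by congr `|_|; ring.
- by split => // a; have /andP[? ?] := trunc_der_itv m a d0; rewrite ger0_norm.
- by split => //; have [] := trunc_low d0 m0.
- split; apply: nondecreasing_measurable => // a b ab; rewrite -(ler_pM2l d0) -subr_ge0.
    by have /andP[] := trunc_fun_lip m d0 ab.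
  by have /andP[] := trunc_der_lip m d0 ab.
Qed.

End Truncation.

(** * Truncation and approximation by Lipschitz functions *)

Section Approximation.
Context {R : realType}.
Local Notation mu := (@lebesgue_measure R).
Local Notation leb2R := ((@lebesgue_measure R) \x (@lebesgue_measure R))%E.
Local Notation plane := (measurableTypeR R * measurableTypeR R)%type.
Implicit Types (f : R -> R) (O K : set (R * R)) (v w psi q : R * R -> R)
  (g h : R * R -> 'cV[R]_2) (z : R * R).

Lemma enormD (a b : 'cV[R]_2) : enorm (a + b) <= enorm a + enorm b.
Proof.
rewrite -(ler_sqr (x := enorm _)) ?nnegrE ?addr_ge0 ?enorm_ge0//.
rewrite sqrrD !enorm_sqr !mxE.
have h : `|a 0 0 * b 0 0 + a 1 0 * b 1 0| <= enorm a * enorm b.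
  rewrite -(ler_sqr (x := `|_|)) ?nnegrE ?mulr_ge0 ?enorm_ge0//.
  rewrite real_normK ?num_real// exprMn !enorm_sqr.
  by have := sqr_ge0 (a 0 0 * b 1 0 - a 1 0 * b 0 0); nra.
by have := le_trans (ler_norm _) h; lra.
Qed.

Lemma enormZ (c : R) (a : 'cV[R]_2) : enorm (c *: a) = `|c| * enorm a.
Proof.
apply/eqP; rewrite -(eqrXn2 (ltn0Sn 1)) ?mulr_ge0 ?enorm_ge0//.
rewrite exprMn !enorm_sqr !mxE !exprMn real_normK ?num_real// mulrDr//.
Qed.

Lemma enormB (a b : 'cV[R]_2) : enorm (a - b) = enorm (b - a).
Proof. by rewrite -opprB -scaleN1r enormZ normrN1 mul1r. Qed.

Lemma nablaAB f g h z : nablaA f (fun z => g z - h z) z = nablaA f g z - nablaA f h z.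
Proof. by apply/matrixP => i j; rewrite !mxE; case: ifP => _ //; rewrite mulrBr. Qed.

Lemma nablaAZ f (c : R * R -> R) g z : nablaA f (fun z => c z *: g z) z = c z *: nablaA f g z.
Proof. by apply/matrixP => i j; rewrite !mxE; case: ifP => _ //; rewrite mulrCA. Qed.

Lemma lipschitz_c_comp O (G : R -> R) psi : (forall a b, `|G b - G a| <= `|b - a|) -> G 0 = 0 ->
  lipschitz_c O psi -> lipschitz_c O (fun z => G (psi z)).
Proof.
move=> GL G0 [lpsi [cK KO]].
have sub : closure [set z | G (psi z) != 0] `<=` closure [set z | psi z != 0].
  by apply: closureS => z /=; apply: contra => /eqP->; rewrite G0.
split; last split.
- move: lpsi; rewrite /lipschitz_on; apply: filterS => M h z Az; exact: le_trans (GL _ _) (h z Az).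
- exact: subclosed_compact (@closed_closure _ _) cK sub.
- exact: subset_trans KO.
Qed.

End Approximation.

Section Closure.
Context {R : realType}.
Local Notation mu := (@lebesgue_measure R).
Local Notation leb2R := ((@lebesgue_measure R) \x (@lebesgue_measure R))%E.
Local Notation plane := (measurableTypeR R * measurableTypeR R)%type.
Implicit Types (v w psi q : R * R -> R) (g h : R * R -> 'cV[R]_2) (z : R * R).
Variables (f : R -> R) (O : set (R * R)).
Hypotheses (wf : degenerate_weight f) (oO : open O) (bO : bounded_set O).

Let mO : measurable (O : set plane). Proof. exact: open_measurable2. Qed.
Let Ooo : (leb2R O < +oo)%E. Proof. exact: bounded_lebesgue. Qed.

Lemma inW_measurable p v g : inW p f O v g ->
  measurable_fun (O : set plane) v /\ forall i, measurable_fun (O : set plane) (fun z => g z i 0).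
Proof. by case=> mv mg _ _; split; [exact mv|move=> i; exact (mg i)]. Qed.

(** The inequality [a <= eta / 2 + a ^+ 2 / eta], integrated. The free parameter [eta] makes the
    contribution of the measure of [O] as small as desired, so convergence in [W_A^{1,2}] implies
    convergence in [W_A^{1,1}]. *)
Lemma Wint1_le v g (eta : R) : measurable_fun (O : set plane) v ->
  (forall i, measurable_fun (O : set plane) (fun z => g z i 0)) -> 0 < eta ->
  (Wint 1 f O v g <= eta%:E * leb2R O + (eta^-1)%:E * Wint 2 f O v g)%E.
Proof.
move=> mv mg e0.
have m1 := measurable_Wint 1 mO wf mv mg; have m2 := measurable_Wint 2 mO wf mv mg.
have W20 z : 0 <= `|v z| ^+ 2 + enorm (nablaA f g z) ^+ 2 by rewrite addr_ge0 ?sqr_ge0.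
have ei : 0 <= eta^-1 by rewrite invr_ge0 ltW.
rewrite -integral_cst// -ge0_integralZl//; last 2 first.
- exact/measurable_EFinP.
- by move=> z _; rewrite lee_fin.
have mC : measurable_fun (O : set plane) (fun z => (eta^-1)%:E * (`|v z| ^+ 2 + enorm (nablaA f g z) ^+ 2)%:E)%E.
  by apply: measurable_funeM; exact/measurable_EFinP.
have C0 z : (0 <= (eta^-1)%:E * (`|v z| ^+ 2 + enorm (nablaA f g z) ^+ 2)%:E)%E.
  by rewrite -EFinM lee_fin mulr_ge0.
have ceta z : (0 <= cst eta%:E z)%E by rewrite lee_fin ltW.
rewrite -ge0_integralD//.
apply: ge0_le_integral => //.
- by move=> z _; rewrite lee_fin addr_ge0// enorm_ge0.
- exact/measurable_EFinP.
- exact: emeasurable_funD.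
move=> z _; rewrite -EFinM -EFinD lee_fin !expr1.
have amgm (a : R) : a <= eta / 2 + eta^-1 * a ^+ 2.
  rewrite -(ler_pM2l e0) mulrDr mulrA mulVKf ?gt_eqF//.
  by have := sqr_ge0 (a - eta / 2); nra.
by have := amgm `|v z|; have := amgm (enorm (nablaA f g z)); lra.
Qed.

Lemma inW_2_1 v g : inW 2 f O v g -> inW 1 f O v g.
Proof.
move=> hv; have [mv mg] := inW_measurable hv; have [mv' mg' hw hn] := hv; split => //.
apply/Wnorm_lty => //; apply: le_lt_trans (Wint1_le mv mg ltr01) _.
rewrite invr1 !mul1e; apply: lte_add_pinfty => //.
by apply/(Wnorm_lty f O v g (isT : (0 < 2)%N)).
Qed.

Lemma inW0_2_1 v g : inW0 2 f O v g -> inW0 1 f O v g.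
Proof.
move=> [hv app]; split; first exact: inW_2_1.
move=> e e0; have [mv mg] := inW_measurable hv.
have [M M0 OM] : exists2 M : R, 0 <= M & (leb2R O <= M%:E)%E.
  by exists (fine (leb2R O)); [exact: fine_ge0|rewrite fineK// ge0_fin_numE].
(* [eta] keeps the measure term at most [e / 2]; the approximation is then taken with squared
   distance below [eta * e / 2], which leaves less than [e / 2] for the other term. The [+ 1] covers
   [M = 0]. *)
pose eta := e / (2 * (M + 1)).
have eta0 : 0 < eta by apply: divr_gt0 => //; apply: mulr_gt0 => //; exact: ltr_wpDl.
have d0 : 0 < Num.sqrt (eta * e / 2).
  by rewrite sqrtr_gt0; apply: divr_gt0 => //; exact: mulr_gt0.
have [psi [h [lpsi hpsi hn]]] := app _ d0.
exists psi, h; split => //; first exact: inW_2_1.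
have [mpsi mh] := inW_measurable hpsi.
apply/(Wnorm_lt f O _ _ _ e0) => //; rewrite expr1.
have r0 : 0 <= eta * e / 2 by rewrite divr_ge0// ltW// mulr_gt0.
have /(Wnorm_lt f O _ _ _ d0) := hn; rewrite sqr_sqrtr// => /(_ isT) hn2.
apply: le_lt_trans (Wint1_le _ _ eta0) _.
- exact: measurable_funB.
- move=> i; under eq_fun do rewrite mxE [X in _ + X]mxE.
  exact: (measurable_funB (mg i) (mh i)).
have -> : e = eta * (M + 1) + eta^-1 * (eta * e / 2).
  rewrite -mulrA mulKf ?gt_eqF// /eta; field; rewrite gt_eqF//; lra.
rewrite EFinD; apply: lee_ltD => //.
- by rewrite fin_numM// ge0_fin_numE.
- rewrite [leRHS]EFinM; apply: lee_wpmul2l; first by rewrite lee_fin ltW.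
  by apply: le_trans OM _; rewrite lee_fin lerDl.
- by rewrite [ltRHS]EFinM lte_pmul2l// lte_fin invr_gt0.
Qed.

Lemma inW_comp v g G G' L : inW 2 f O v g -> smooth_truncation G G' L ->
  inW 2 f O (fun z => G (v z)) (fun z => G' (v z) *: g z).
Proof.
move=> hv hG; have [mv mg] := inW_measurable hv.
have [L0 GT [G'1 G'L] [G0 GL] [mG mG']] := hG.
have mGv : measurable_fun (O : set plane) (fun z => G (v z)) by exact: measurableT_comp mG mv.
have mGg i : measurable_fun (O : set plane) (fun z => (G' (v z) *: g z) i 0).
  under eq_fun do rewrite mxE.
  by apply: measurable_funM; [exact: measurableT_comp mG' mv|exact: mg].
split; [exact mGv|move=> i; exact (mGg i)|exact: weak_gradient_comp hG|].
have [_ _ _ /(Wnorm_lty f O v g (isT : (0 < 2)%N)) hn] := hv.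
apply/(Wnorm_lty f O _ _ (isT : (0 < 2)%N)); apply: le_lt_trans hn.
apply: ge0_le_integral => //.
- by move=> z _; rewrite lee_fin addr_ge0 ?sqr_ge0.
- by apply/measurable_EFinP; exact: (measurable_Wint 2 mO wf mGv mGg).
- by apply/measurable_EFinP; exact: (measurable_Wint 2 mO wf mv mg).
move=> z _; rewrite lee_fin lerD//.
  by rewrite ler_sqr ?nnegrE//; have := GL 0 (v z); rewrite G0 !subr0.
rewrite ler_sqr ?nnegrE ?enorm_ge0// nablaAZ enormZ ler_piMl ?enorm_ge0//.
Qed.

Definition gradient_excess g (T : R) z : R :=
  (T < enorm (nablaA f g z))%R%:R * enorm (nablaA f g z) ^+ 2.

Lemma gradient_tail v g (e : R) : inW 2 f O v g -> 0 < e ->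
  exists2 T : R, 0 < T &
    (\int[leb2R]_(z in O) (gradient_excess g T z)%:E < e%:E)%E.
Proof.
move=> hv e0; have [mv mg] := inW_measurable hv.
have [_ _ _ /(Wnorm_lty f O v g (isT : (0 < 2)%N)) hn] := hv.
have iI := (Wint_integrable 2 mO wf mv mg).1 hn.
have [m0 m1] := measurable_nablaA mO wf mg.
have men := measurable_enorm mO m0 m1.
pose E z := enorm (nablaA f g z).
pose F (n : nat) z : R := (n.+1%:R < E z)%R%:R * E z ^+ 2.
have ii : leb2R.-integrable O (EFin \o (fun z => E z ^+ 2)).
  apply: (integ_le mO _ _ iI); first exact: measurable_funX.
  by move=> z _; rewrite ger0_norm ?sqr_ge0// lerDr sqr_ge0.
have mF n : measurable_fun (O : set plane) (F n).
  apply: measurable_funM; last exact: measurable_funX.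
  have -> : (fun z => (n.+1%:R < E z)%R%:R : R) = \1_(`]n.+1%:R, +oo[%classic : set R) \o E.
    by apply/funext => z /=; rewrite indicE mem_setE in_itv/= andbT.
  apply: (measurableT_comp _ men); apply: measurable_indic; exact: measurable_itv.
have cF z : O z -> (fun n => F n z) @ \oo --> (0 : R).
  move=> _; apply: cvg_near_cst; near=> n; apply/eqP.
  rewrite /F ltNge (_ : E z <= n.+1%:R) ?mul0r//.
  rewrite (le_trans (ltW (truncnS_gt (E z))))// ler_nat ltnS; near: n; exact: nbhs_infty_ge.
have bF n z : O z -> `|F n z| <= E z ^+ 2.
  move=> _; rewrite /F normrM (ger0_norm (sqr_ge0 _)) ler_piMl ?sqr_ge0//.
  by rewrite normr_nat; case: (_ < _)%R.
have [_ cI] := Rdominated_convergence mO mF (@measurable_cst _ _ _ _ _ (0 : R)) cF ii bF.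
rewrite Rintegral_cst// mul0r in cI.
have [n hnI] : exists n, \int[leb2R]_(z in O) F n z < e.
  have /cvgrPdist_lt/(_ _ e0)[N _ h] := cI; exists N.
  by have := h N (leqnn N); rewrite sub0r normrN; exact: le_lt_trans (ler_norm _).
exists n.+1%:R => //.
have iF : leb2R.-integrable O (EFin \o F n) by exact: (integ_le mO (mF n) (bF n) ii).
by rewrite (integ_fin mO iF) lte_fin.
Unshelve. all: by end_near.
Qed.

(* Where [enorm x <= T] the factor [c - b] is controlled by [a]; elsewhere only by [2], which suffices
   because [gradient_excess] is small for large [T]. *)
Lemma comp_gradient_bound (b c L T : R) (x y : 'cV[R]_2) (a : R) :
  0 <= L -> 0 <= T -> `|b| <= 1 -> `|c| <= 1 -> `|c - b| <= L * `|a| ->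
  enorm (c *: x - b *: y) ^+ 2 <= (2 + 2 * (L * T) ^+ 2) * (`|a| ^+ 2 + enorm (x - y) ^+ 2) +
    8 * ((T < enorm x)%R%:R * enorm x ^+ 2).
Proof.
move=> L0 T0 b1 c1 cb.
have -> : c *: x - b *: y = (c - b) *: x + b *: (x - y).
  by rewrite scalerBl scalerBr addrA subrK.
have h1 : enorm ((c - b) *: x + b *: (x - y)) <= `|c - b| * enorm x + `|b| * enorm (x - y).
  by apply: le_trans (enormD _ _) _; rewrite !enormZ.
have h2 : `|b| * enorm (x - y) <= enorm (x - y) by rewrite ler_piMl ?enorm_ge0.
have P1 := enorm_ge0 x; have P2 := enorm_ge0 (x - y).
have P3 : 0 <= `|c - b| by [].
have h3 : enorm ((c - b) *: x + b *: (x - y)) ^+ 2 <= 2 * (`|c - b| * enorm x) ^+ 2 + 2 * enorm (x - y) ^+ 2.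
  have h : enorm ((c - b) *: x + b *: (x - y)) <= `|c - b| * enorm x + enorm (x - y).
    by apply: le_trans h1 _; rewrite lerD2l.
  rewrite -(ler_sqr (x := enorm _)) ?nnegrE ?enorm_ge0 ?addr_ge0 ?mulr_ge0// in h.
  apply: le_trans h _; have := sqr_ge0 (`|c - b| * enorm x - enorm (x - y)); nra.
apply: le_trans h3 _.
have S2 : 0 <= (L * T) ^+ 2 by exact: sqr_ge0.
have A2 : 0 <= `|a| ^+ 2 by exact: sqr_ge0.
have X2 : 0 <= enorm (x - y) ^+ 2 by exact: sqr_ge0.
have [xT|Tx] := leP (enorm x) T; last first.
  rewrite mul1r.
  have : (`|c - b| * enorm x) ^+ 2 <= 4 * enorm x ^+ 2.
    rewrite exprMn ler_wpM2r ?sqr_ge0//.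
    have : `|c - b| <= 2 by apply: le_trans (ler_normB _ _) _; lra.
    by move=> ?; nra.
  move: X2 A2 S2; move: (enorm (x - y) ^+ 2) (`|a| ^+ 2) ((L * T) ^+ 2) ((`|c - b| * enorm x) ^+ 2) (enorm x ^+ 2) => ? ? ? ? ? ? ? ? ?; nra.
rewrite mul0r mulr0 addr0.
have : (`|c - b| * enorm x) ^+ 2 <= (L * T) ^+ 2 * `|a| ^+ 2.
  rewrite -exprMn ler_sqr ?nnegrE ?mulr_ge0//.
  by rewrite mulrAC ler_pM.
move: X2 A2 S2; move: (enorm (x - y) ^+ 2) (`|a| ^+ 2) ((L * T) ^+ 2) ((`|c - b| * enorm x) ^+ 2) => ? ? ? ? ? ? ? ?; nra.
Qed.

(** The gradients [G' (v) g] and [G' (psi) h] are not close uniformly in [g], so the order of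
    choices matters: the threshold [T] comes from [g] alone, and only then is [psi] chosen, with an
    accuracy depending on [T]. *)
Lemma inW0_comp v g G G' L : inW0 2 f O v g -> smooth_truncation G G' L ->
  inW0 2 f O (fun z => G (v z)) (fun z => G' (v z) *: g z).
Proof.
move=> [hv app] hG; split; first exact: inW_comp hG.
have [L0 GT [G'1 G'L] [G0 GL] [mG mG']] := hG.
have [mv mg] := inW_measurable hv.
(* The tail enters with the factor [8], so [e'] accounts for one half of [e ^+ 2]. *)
move=> e e0; pose e' := e ^+ 2 / 16.
have e'0 : 0 < e' by apply: divr_gt0 => //; exact: exprn_gt0.
have [T T0 tail] := gradient_tail hv e'0.
(* One unit for the functions and [2 + 2 * (L * T) ^+ 2] for the gradients, as in
   [comp_gradient_bound]. *)
pose B := 3 + 2 * (L * T) ^+ 2.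
have B0 : 0 < B by rewrite /B ltr_wpDr// mulr_ge0// sqr_ge0.
have d0 : 0 < Num.sqrt (e ^+ 2 / (2 * B)) by rewrite sqrtr_gt0; apply: divr_gt0; [exact: exprn_gt0|exact: mulr_gt0].
have [psi [h [lpsi hpsi hn]]] := app _ d0.
have [mpsi mh] := inW_measurable hpsi.
exists (fun z => G (psi z)), (fun z => G' (psi z) *: h z); split.
- exact: lipschitz_c_comp.
- exact: inW_comp hG.
apply/(Wnorm_lt f O _ _ _ e0) => //.
have /(Wnorm_lt f O _ _ _ d0) := hn; rewrite sqr_sqrtr; last by apply: divr_ge0; [exact: sqr_ge0|rewrite ltW// mulr_gt0].
move=> /(_ isT) hn2.
have mvp : measurable_fun (O : set plane) (fun z => v z - psi z) by exact: measurable_funB.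
have mgh i : measurable_fun (O : set plane) (fun z => (g z - h z) i 0).
  under eq_fun do rewrite mxE [X in _ + X]mxE.
  exact: (measurable_funB (mg i) (mh i)).
have mW2 := measurable_Wint 2 mO wf mvp mgh.
have [mn0 mn1] := measurable_nablaA mO wf mg.
have men := measurable_enorm mO mn0 mn1.
pose E z := enorm (nablaA f g z).
pose F z : R := (T < E z)%R%:R * E z ^+ 2.
have F0 z : 0 <= F z by rewrite mulr_ge0 ?sqr_ge0.
have mF : measurable_fun (O : set plane) F.
  apply: measurable_funM; last exact: measurable_funX.
  have -> : (fun z => (T < E z)%R%:R : R) = \1_(`]T, +oo[%classic : set R) \o E.
    by apply/funext => z /=; rewrite indicE mem_setE in_itv/= andbT.
  apply: (measurableT_comp _ men); apply: measurable_indic; exact: measurable_itv.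
have I20 z : 0 <= `|v z - psi z| ^+ 2 + enorm (nablaA f (fun z => g z - h z) z) ^+ 2 by rewrite addr_ge0 ?sqr_ge0.
pose W := Wint 2 f O (fun z => v z - psi z) (fun z => g z - h z).
apply: (@le_lt_trans _ _ (B%:E * W + (8 : R)%:E * \int[leb2R]_(z in O) (F z)%:E)%E); last first.
  have -> : (e ^+ 2)%:E = (B%:E * (e ^+ 2 / (2 * B))%:E + (8 : R)%:E * e'%:E)%E.
    by rewrite -!EFinM -EFinD; congr EFin; rewrite /e'; field; rewrite gt_eqF.
  by apply: lteD; rewrite lte_pmul2l.
rewrite /W /Wint.
have B0' : 0 <= B by exact: ltW.
have mI : measurable_fun (O : set plane) (fun z => (`|v z - psi z| ^+ 2 + enorm (nablaA f (fun z => g z - h z) z) ^+ 2)%:E).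
  exact/measurable_EFinP.
have mFE : measurable_fun (O : set plane) (fun z => (F z)%:E) by exact/measurable_EFinP.
rewrite -!ge0_integralZl//; try by move=> z _; rewrite lee_fin.
have mBI := measurable_funeM B%:E mI; have m8 := measurable_funeM (8 : R)%:E mFE.
have BI0 z : (0 <= B%:E * (`|v z - psi z| ^+ 2 + enorm (nablaA f (fun z => g z - h z)%R z) ^+ 2)%:E)%E.
  by rewrite -EFinM lee_fin mulr_ge0.
have F80 z : (0 <= (8 : R)%:E * (F z)%:E)%E by rewrite -EFinM lee_fin mulr_ge0.
rewrite -ge0_integralD//.
have mGg k (u : R * R -> R) (l : R * R -> 'cV[R]_2) : measurable_fun (O : set plane) u ->
    (forall i, measurable_fun (O : set plane) (fun z => l z i 0)) ->
    measurable_fun (O : set plane) (fun z => (G' (u z) *: l z) k 0).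
  move=> mu' ml; under eq_fun do rewrite mxE.
  by apply: measurable_funM; [exact: measurableT_comp mG' mu'|exact: ml].
apply: ge0_le_integral => //.
- by move=> z _; rewrite lee_fin addr_ge0 ?sqr_ge0.
- apply/measurable_EFinP; apply: (measurable_Wint 2 mO wf).
    by apply: measurable_funB; [exact: measurableT_comp mG mv|exact: measurableT_comp mG mpsi].
  move=> i; under eq_fun do rewrite mxE [X in _ + X]mxE.
  exact: (measurable_funB (mGg i _ _ mv mg) (mGg i _ _ mpsi mh)).
- exact: emeasurable_funD.
move=> z _; rewrite -!EFinM -EFinD lee_fin.
have h1 : `|G (v z) - G (psi z)| ^+ 2 <= `|v z - psi z| ^+ 2 by rewrite ler_sqr ?nnegrE.
have h2 := comp_gradient_bound (nablaA f g z) (nablaA f h z) L0 (ltW T0) (G'1 (psi z)) (G'1 (v z)) (G'L _ _).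
rewrite nablaAB !nablaAZ nablaAB -/(F z).
apply: le_trans (lerD h1 h2) _; rewrite addrA lerD2r /B.
have : 0 <= enorm (nablaA f g z - nablaA f h z) ^+ 2 by exact: sqr_ge0.
by move: (enorm (nablaA f g z - nablaA f h z) ^+ 2) (`|v z - psi z| ^+ 2) ((L * T) ^+ 2) => ? ? ? ?; lra.
Qed.

Lemma sobolev_inW0 v g (E : set plane) (m tau rho : R) : inW0 1 f O v g ->
  measurable E -> E `<=` O -> (leb2R E <= m%:E)%E -> 0 < tau -> 0 < rho ->
  (\int[leb2R]_(z in E) `|v z|%:E <=
    (2 * rho + m / tau + tau / f rho)%:E * \int[leb2R]_(z in O) (enorm (nablaA f g z))%:E)%E.
Proof.
move=> [hv app] mE EO Em tau0 rho0.
have [mv mg] := inW_measurable hv.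
set th := 2 * rho + _ + _.
have m0 : 0 <= m by rewrite -lee_fin (le_trans _ Em).
have th0 : 0 <= th.
  have f0 := degenerate_weight_ge0 rho wf.
  by rewrite /th !addr_ge0// ?divr_ge0// ?mulr_ge0// ltW.
apply/lee_addgt0Pr => e e0.
(* Replacing [v] by [psi] costs at most [d] on the left and [th * d] on the right, in total [e]. *)
pose d := e / (th + 1).
have d0 : 0 < d by apply: divr_gt0 => //; exact: ltr_wpDl.
have [psi [h [lpsi hpsi /(Wnorm_lt f O _ _ _ d0) hn]]] := app _ d0.
have [mpsi mh] := inW_measurable hpsi.
have {hn} := hn isT; rewrite expr1 => hn.
have mvp : measurable_fun (O : set plane) (fun z => v z - psi z) by exact: measurable_funB.
have mgh i : measurable_fun (O : set plane) (fun z => (g z - h z) i 0).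
  under eq_fun do rewrite mxE [X in _ + X]mxE.
  exact: (measurable_funB (mg i) (mh i)).
have nm (l : R * R -> 'cV[R]_2) : (forall i, measurable_fun (O : set plane) (fun z => l z i 0)) ->
    measurable_fun (O : set plane) (fun z => (enorm (nablaA f l z))%:E).
  by move=> ml; have [? ?] := measurable_nablaA mO wf ml; apply/measurable_EFinP; exact: measurable_enorm.
have am (u : R * R -> R) : measurable_fun (O : set plane) u -> measurable_fun (O : set plane) (fun z => `|u z|%:E).
  by move=> mu'; apply/measurable_EFinP; exact: measurableT_comp.
pose A := (\int[leb2R]_(z in O) `|v z - psi z|%:E)%E.
pose B := (\int[leb2R]_(z in O) (enorm (nablaA f (fun z => g z - h z)%R z))%:E)%E.
have A0 : (0 <= A)%E by apply: integral_ge0 => z _; rewrite lee_fin.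
have B0 : (0 <= B)%E by apply: integral_ge0 => z _; rewrite lee_fin enorm_ge0.
have AB : (A + B <= d%:E)%E.
  rewrite /A /B -ge0_integralD//; try by move=> z _; rewrite lee_fin enorm_ge0.
  - exact: ltW.
  - exact: am.
  - exact: nm.
have Ad : (A <= d%:E)%E by apply: le_trans AB; rewrite leeDl.
have Bd : (B <= d%:E)%E by apply: le_trans AB; rewrite leeDr.
have S := sobolev_lipschitz wf oO bO lpsi hpsi mE Em tau0 rho0.
have h1 : (\int[leb2R]_(z in E) `|v z|%:E <= \int[leb2R]_(z in E) `|(psi z)%:E| + A)%E.
  apply: (@le_trans _ _ (\int[leb2R]_(z in E) `|psi z|%:E + \int[leb2R]_(z in E) `|v z - psi z|%:E)%E); last first.
    by apply: leeD => //; apply: ge0_subset_integral => //; exact: am.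
  have mE1 := measurable_funS mO EO (am _ mpsi); have mE2 := measurable_funS mO EO (am _ mvp).
  rewrite -ge0_integralD//.
  apply: ge0_le_integral => //.
  - by apply: (measurable_funS mO EO); exact: am.
  - exact: emeasurable_funD.
  - by move=> z _; rewrite -EFinD lee_fin -[X in `|X| <= _](subrK (psi z)) addrC ler_normD.
have h2 : (\int[leb2R]_(z in O) (enorm (nablaA f h z))%:E <=
    \int[leb2R]_(z in O) (enorm (nablaA f g z))%:E + B)%E.
  have n1 := nm _ mg; have n2 := nm _ mgh.
  rewrite /B -ge0_integralD//; try by move=> z _; rewrite lee_fin enorm_ge0.
  apply: ge0_le_integral => //.
  - by move=> z _; rewrite lee_fin enorm_ge0.
  - exact: nm.
  - by apply: emeasurable_funD; exact: nm.
  move=> z _; rewrite -EFinD lee_fin nablaAB enormB.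
  by rewrite -[X in enorm X <= _](subrK (nablaA f g z)) addrC; exact: enormD.
apply: le_trans h1 _.
apply: (@le_trans _ _ (th%:E * (\int[leb2R]_(z in O) (enorm (nablaA f g z))%:E + B) + d%:E)%E).
  apply: leeD => //; apply: le_trans S _; apply: lee_wpmul2l => //; by rewrite lee_fin.
rewrite ge0_muleDr//; last by apply: integral_ge0 => z _; rewrite lee_fin enorm_ge0.
rewrite -addeA; apply: leeD => //.
have -> : e%:E = (th%:E * d%:E + d%:E)%E.
  by rewrite -EFinM -EFinD; congr EFin; rewrite /d; field; rewrite gt_eqF// ltr_wpDl.
by apply: leeD => //; apply: lee_wpmul2l => //; rewrite lee_fin.
Qed.

End Closure.

(** * The energy estimate and the passage from one level to the next *)

Section Energy.
Context {R : realType}.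
Local Notation mu := (@lebesgue_measure R).
Local Notation leb2R := ((@lebesgue_measure R) \x (@lebesgue_measure R))%E.
Local Notation plane := (measurableTypeR R * measurableTypeR R)%type.
Implicit Types (v w psi q : R * R -> R) (g h : R * R -> 'cV[R]_2) (z : R * R).

Lemma bform_Amx (f : R -> R) (g : R * R -> 'cV[R]_2) z :
  bform (Amx f z) (g z) (g z) = enorm (nablaA f g z) ^+ 2.
Proof.
rewrite enorm_sqr nablaA0 nablaA1 /bform /Amx mxE !big_ord_recl big_ord0 addr0.
rewrite !mxE !big_ord_recl !big_ord0 !addr0 !mxE /=.
have -> : lift ord0 ord0 = 1 :> 'I_2 by exact: val_inj.
by rewrite !mulr1n !mulr0n; ring.
Qed.

Lemma bformZl (M : 'M[R]_2) (c : R) (a b : 'cV[R]_2) : bform M (c *: a) b = c * bform M a b.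
Proof. by rewrite /bform linearZ/= -!scalemxAl mxE. Qed.

Lemma ae_fst_neq0 : {ae leb2R, forall z, z.1 != 0}.
Proof.
exists ([set 0%R] `*` setT); split.
- by apply: measurableX.
- have E0 : mu [set 0%R] = 0%E by exact: lebesgue_measure_set1.
  apply: etrans (product_measure1E mu mu (measurable_set1 (0 : R)) measurableT) _.
  by apply: etrans (mul0e (mu setT)); congr (_ * _)%E.
- by move=> z /= /negP; rewrite negbK => /eqP.
Qed.

Lemma Xnorm_bound f O phi (X : R) v g : degenerate_weight f -> open O -> bounded_set O ->
  (Xnorm f O phi <= X%:E)%E -> inW0 1 f O v g ->
  (\int[leb2R]_(z in O) `|v z * phi z|%:E <=
     X%:E * \int[leb2R]_(z in O) (enorm (nablaA f g z))%:E)%E.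
Proof.
move=> wf oO bO hX hv.
have mO : measurable (O : set plane) by exact: open_measurable2.
have [_ _ _ ie] := inW1_integ wf oO bO hv.1.
set a := (\int[leb2R]_(z in O) `|v z * phi z|%:E)%E.
rewrite (integ_fin mO ie); set b := \int[leb2R]_(z in O) _.
have a0 : (0 <= a)%E by apply: integral_ge0 => z _; rewrite lee_fin.
have b0 : 0 <= b by apply: Rintegral_ge0 => z _; exact: enorm_ge0.
have : (a / b%:E <= X%:E)%E.
  apply: le_trans hX; apply: ereal_sup_ubound; exists v, g; split => //.
  by rewrite /b -(integ_fin mO ie).
(* If the gradient integral is zero, the convention that a positive number divided by [0] is [+oo]
   makes finiteness of the norm force the numerator to vanish. *)
move: b0; rewrite le_eqVlt => /predU1P[<-|bp].
  rewrite inve0 mule0 => h; rewrite leNgt; apply/negP => ap; move: h.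
  by rewrite gt0_muley// leye_eq.
by rewrite inver (gt_eqF bp) lee_pdivrMr.
Qed.

Lemma smooth_truncation_shift G G' (L l : R) : smooth_truncation G G' L ->
  smooth_truncation (fun t => G (t - l) - G (- l)) (fun t => G' (t - l)) L.
Proof.
move=> [L0 GT [G'1 G'L] [G0 GL] [mG mG']].
have ms : measurable_fun [set: measurableTypeR R] (fun t : R => t - l) by exact: measurable_funB.
split => //.
- move=> a b; have := GT (a - l) (b - l).
  have -> : b - l - (a - l) = b - a by ring.
  by congr (`|_| <= _); ring.
- split => // a b; have := G'L (a - l) (b - l).
  by have -> : b - l - (a - l) = b - a by ring.
- split => [|a b]; first by rewrite sub0r subrr.
  have := GL (a - l) (b - l); have -> : b - l - (a - l) = b - a by ring.
  by congr (`|_| <= _); ring.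
- split; last exact: measurableT_comp mG' ms.
  by apply: measurable_funB => //; exact: measurableT_comp mG ms.
Qed.

Variables (f : R -> R) (O : set (R * R)).
Hypotheses (wf : degenerate_weight f) (oO : open O) (bO : bounded_set O).
Let mO : measurable (O : set plane). Proof. exact: open_measurable2. Qed.
Let Ooo : (leb2R O < +oo)%E. Proof. exact: bounded_lebesgue. Qed.

Variables (u : R * R -> R) (gu : R * R -> 'cV[R]_2) (l : R) (g : R * R -> 'cV[R]_2).
Let w z := Num.max (u z - l) 0.
Hypotheses (hu : inW 2 f O u gu) (hw : inW0 2 f O w g).

(** Membership of [w] in the closure provides a gradient [g] with no stated link to [gu]. For
    [m >= 0] the truncations of [w] and of [u - l] coincide, so uniqueness equates the gradients
    given by the two chain rules; dividing by [f] is possible off the axis, which is a null set. *)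
Lemma trunc_gradient (m d : R) : 0 <= m -> 0 < d ->
  {ae leb2R, forall z, O z -> trunc_der m d (w z) *: g z = trunc_der m d (w z) *: gu z}.
Proof.
move=> m0 d0; have hG := trunc_smooth m0 d0; have hGl := smooth_truncation_shift l hG.
have low t : t <= 0 -> trunc_fun m d t = 0 /\ trunc_der m d t = 0.
  by move=> t0; apply: trunc_low => //; exact: le_trans m0.
have wE z : trunc_fun m d (w z) = trunc_fun m d (u z - l) /\ trunc_der m d (w z) = trunc_der m d (u z - l).
  rewrite /w; have [//|h] := leP 0 (u z - l).
  by have [-> ->] := low _ (lexx 0); have [-> ->] := low _ (ltW h).
have c1 := inW_comp wf oO bO hw.1 hG; have c2 := inW_comp wf oO bO hu hGl.
have [i1 p1 q1 _] := inW1_integ wf oO bO (inW_2_1 wf oO bO c1).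
have [i2 p2 q2 _] := inW1_integ wf oO bO (inW_2_1 wf oO bO c2).
have two (i : 'I_2) : i = 0 \/ i = 1 by case: i => -[|[|//]] lt; [left|right]; exact: val_inj.
have [_ _ w1 _] := c1; have [_ _ w2 _] := c2.
have E z : O z -> trunc_fun m d (w z) = trunc_fun m d (u z - l) - trunc_fun m d (- l) + trunc_fun m d (- l).
  by move=> _; rewrite subrK (wE z).1.
have := weak_gradient_unique wf oO bO w1 w2 E i2 _ _.
move=> /(_ (fun i => _) (fun i => _)) U.
have {}U : {ae leb2R, forall z, O z ->
    nablaA f (fun z => trunc_der m d (w z) *: g z) z = nablaA f (fun z => trunc_der m d (u z - l) *: gu z) z}.
  by apply: U => i; have [->|->] := two i.
apply: (ae_imp (ae_and U ae_fst_neq0)) => z [h zn] Oz; have {}h := h Oz.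
have fz : f z.1 != 0 by case: wf => _ _ fp _; rewrite gt_eqF// fp.
apply/matrixP => i j; rewrite ord1.
have h0 := congr1 (fun M : 'cV[R]_2 => M 0 0) h; have h1 := congr1 (fun M : 'cV[R]_2 => M 1 0) h.
move: h0 h1; rewrite /= !nablaA0 !nablaA1 -(wE z).2 => h0 /(mulfI fz) h1.
by have [->|->] := two i.
Qed.

Variables (cA : R * R -> R -> 'M[R]_2) (c0 C0 : R) (phi : R * R -> R) (X K : R).
Hypotheses (c00 : 0 < c0) (hell : A_elliptic f O c0 C0 cA) (hX : (Xnorm f O phi <= X%:E)%E)
  (K0 : 0 < K) (XK : X <= c0 * K).
Hypothesis hsub : forall w gw, inW0 2 f O w gw ->
    {ae leb2, forall z : R * R, O z -> 0 <= w z} ->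
    exists F : R * R -> R,
      [/\ {ae leb2, forall z : R * R, O z ->
             F z = bform (cA z (u z)) (gw z) (gu z)},
          leb2.-integrable O (EFin \o F),
          leb2.-integrable O (EFin \o (fun z => phi z * w z))
        & - (\int[leb2]_(z in O) F z) >= \int[leb2]_(z in O) (phi z * w z)].

Let super (m : R) : set plane := [set z | O z /\ m < w z].

Lemma measurable_super m : measurable (super m).
Proof.
have [mw _] := inW_measurable hw.1.
have -> : super m = O `&` w @^-1` `]m, +oo[%classic.
  by apply/seteqP; split => z /=; rewrite in_itv/= andbT.
by apply: mw => //; exact: measurable_itv.
Qed.

Lemma super_finite m : (leb2R (super m) < +oo)%E.
Proof.
apply: le_lt_trans Ooo; apply: le_measure; rewrite ?inE//; first exact: measurable_super.
by move=> z [].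
Qed.

(** The test function has gradient [D gu] with [D = trunc_der m d (w z)]. Ellipticity bounds its
    pairing with [gu] below by [c0 * D * N ^+ 2], while admissibility bounds the right side by [X]
    times the integral of [D * N]. The quadratic energy [I2] is thus at most [K * I1], where [I1] is
    the linear one. *)
Lemma energy_bound (m d : R) : 0 <= m -> 0 < d ->
  (\int[leb2R]_(z in O) (enorm (nablaA f (fun z => trunc_der m d (w z) *: g z) z))%:E <=
    K%:E * leb2R (super m))%E.
Proof.
move=> m0 d0; have hG := trunc_smooth m0 d0.
have hc := inW0_comp wf oO bO hw hG; have hc1 := inW0_2_1 wf oO bO hc.
have [mw mg] := inW_measurable hw.1; have [mu' mgu] := inW_measurable hu.
have [_ _ _ _ [_ mG']] := hG.
have [F [FE iF iphi Fle]] : exists F : R * R -> R,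
      [/\ {ae leb2R, forall z : R * R, O z ->
             F z = bform (cA z (u z)) (trunc_der m d (w z) *: g z) (gu z)},
          leb2R.-integrable O (EFin \o F),
          leb2R.-integrable O (EFin \o (fun z => phi z * trunc_fun m d (w z)))
        & \int[leb2R]_(z in O) (phi z * trunc_fun m d (w z)) <= - (\int[leb2R]_(z in O) F z)].
  by apply: hsub hc _; apply: ae_all => z _; exact: trunc_fun_ge0.
pose D z := trunc_der m d (w z).
have D01 z : 0 <= D z <= 1 by exact: trunc_der_itv.
have mD : measurable_fun (O : set plane) D by exact: measurableT_comp mG' mw.
pose N z := enorm (nablaA f gu z).
have [n0 n1] := measurable_nablaA mO wf mgu.
have mN : measurable_fun (O : set plane) N by exact: measurable_enorm.
have [_ _ _ /(Wnorm_lty f O u gu (isT : (0 < 2)%N)) hn] := hu.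
have iI := (Wint_integrable 2 mO wf mu' mgu).1 hn.
have D1 z : `|D z| <= 1 by have /andP[? ?] := D01 z; rewrite ger0_norm.
have iN2 : leb2R.-integrable O (EFin \o (fun z => N z ^+ 2)).
  apply: (integ_le mO _ _ iI); first exact: measurable_funX.
  by move=> z _; rewrite ger0_norm ?sqr_ge0// lerDr sqr_ge0.
have iDN2 : leb2R.-integrable O (EFin \o (fun z => D z * N z ^+ 2)).
  exact: (integM mO mD (fun z _ => D1 z) iN2).
have [iN _] := cauchy_schwarz1 mO Ooo mN iN2.
have iDN : leb2R.-integrable O (EFin \o (fun z => D z * N z)).
  exact: (integM mO mD (fun z _ => D1 z) iN).
have iD : leb2R.-integrable O (EFin \o D).
  have := integM mO mD (fun z _ => D1 z) (integ_cst mO 1 Ooo); congr (_.-integrable _ (_ \o _)).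
  by apply/funext => z; rewrite mulr1.
have [_ _ _ ieg] := inW1_integ wf oO bO hc1.1.
pose I1 := \int[leb2R]_(z in O) (D z * N z).
pose I2 := \int[leb2R]_(z in O) (D z * N z ^+ 2).
have tg := trunc_gradient m0 d0.
have I1E : \int[leb2R]_(z in O) enorm (nablaA f (fun z => trunc_der m d (w z) *: g z) z) = I1.
  apply: (ae_eq_Rint mO (integ_mfun ieg) (integ_mfun iDN)); apply: (ae_imp tg) => z h Oz.
  have -> : nablaA f (fun z => trunc_der m d (w z) *: g z) z = nablaA f (fun z => D z *: gu z) z.
    by apply/matrixP => i j; rewrite !(mxE, h Oz).
  by rewrite nablaAZ enormZ ger0_norm//; have /andP[] := D01 z.
have I10 : 0 <= I1.
  by apply: Rintegral_ge0 => z _; rewrite mulr_ge0 ?enorm_ge0//; have /andP[] := D01 z.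
have lower : c0 * I2 <= \int[leb2R]_(z in O) F z.
  rewrite /I2 -(RintegralZl c0 mO iDN2).
  apply: (ae_le_Rint mO (integZ mO c0 iDN2) iF).
  apply: (ae_imp (ae_and (ae_and FE tg) hell)) => z [[h1 h2] h3] Oz.
  rewrite h1// h2// bformZl -/(D z) mulrCA.
  have [] := h3 Oz (u z) (gu z).
  rewrite bform_Amx => h _; apply: ler_wpM2l => //; by have /andP[] := D01 z.
have upper : \int[leb2R]_(z in O) F z <= X * I1.
  have h1 : \int[leb2R]_(z in O) F z <= - \int[leb2R]_(z in O) (phi z * trunc_fun m d (w z)).
    by rewrite lerNr.
  apply: le_trans h1 _.
  apply: (@le_trans _ _ (\int[leb2R]_(z in O) `|phi z * trunc_fun m d (w z)|)).
    apply: le_trans (le_normr_Rintegral mO iphi); rewrite -normrN; exact: ler_norm.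
  have := Xnorm_bound wf oO bO hX hc1; rewrite (integ_fin mO ieg) I1E.
  have -> : (\int[leb2R]_(z in O) `|trunc_fun m d (w z) * phi z|%:E)%E =
     (\int[leb2R]_(z in O) `|phi z * trunc_fun m d (w z)|%:E)%E.
    by apply: eq_integral => z _; rewrite mulrC.
  by rewrite (integ_fin mO (integ_abs iphi)) -EFinM lee_fin.
pose S := fine (leb2R (super m)).
have SE : leb2R (super m) = S%:E by rewrite /S fineK// ge0_fin_numE// super_finite.
have IDS : \int[leb2R]_(z in O) D z <= S.
  have ic : leb2R.-integrable O (EFin \o (\1_(super m) : R * R -> R)).
    have := integM mO (g := \1_(super m)) (c := 1) _ _ (integ_cst mO 1 Ooo).
    move=> H; have {}H : leb2R.-integrable O (EFin \o (fun z => \1_(super m) z * (1 : R))).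
      apply: H; first by apply: measurable_indic; exact: measurable_super.
      by move=> z _; rewrite indicE normr_nat; case: (_ \in _).
    move: H; congr (_.-integrable _ (_ \o _)); by apply/funext => z; rewrite mulr1.
  have -> : S = \int[leb2R]_(z in O) (\1_(super m) z : R).
    rewrite /S /Rintegral integral_indic//; last exact: measurable_super.
    by congr (fine (_ _)); apply/seteqP; split => z; [move=> h; split => //; case: h|case].
  apply: le_Rintegral => // z Oz; rewrite indicE.
  have [h|h] := leP (w z) m.
    rewrite /D (trunc_low d0 h).2; exact: ler0n.
  by rewrite mem_set; [have /andP[] := D01 z|split].
(* Integrate [D * (N - K) ^+ 2 >= 0], using that [D] is at most [1] and vanishes off [super m].
   Together with [I2 <= K * I1] this leaves [I1 <= K * S]. *)
have amgm : 2 * K * I1 <= I2 + K ^+ 2 * S.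
  have iK := integZ mO (K ^+ 2) iD.
  have h : \int[leb2R]_(z in O) (2 * K * (D z * N z)) <= \int[leb2R]_(z in O) (D z * N z ^+ 2 + K ^+ 2 * D z).
    apply: le_Rintegral => //; [exact: integZ|exact: integD|].
    move=> z _; have /andP[Dz _] := D01 z; have := sqr_ge0 (N z - K) => sq.
    rewrite -subr_ge0; apply: le_trans (mulr_ge0 Dz sq) _; rewrite le_eqVlt; apply/orP; left; apply/eqP; ring.
  have E1 := RintegralZl (2 * K) mO iDN; have E2 := RintegralD mO iDN2 iK.
  have E3 := RintegralZl (K ^+ 2) mO iD.
  rewrite E1 E2 E3 in h; apply: le_trans h _; rewrite lerD2l ler_wpM2l ?sqr_ge0//.
rewrite (integ_fin mO ieg) I1E SE -EFinM lee_fin.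
have key : c0 * I2 <= c0 * K * I1.
  apply: le_trans lower _; apply: le_trans upper _; exact: ler_wpM2r.
have {}key : I2 <= K * I1 by rewrite -(ler_pM2l c00) mulrA.
have : K * I1 <= K * (K * S).
  rewrite -(lerD2l (K * I1)); apply: (@le_trans _ _ (2 * K * I1)).
    by rewrite -mulrA mulr_natl mulr2n.
  by apply: le_trans amgm _; rewrite [K * (K * S)]mulrA -expr2 lerD2r.
by rewrite ler_pM2l.
Qed.

Lemma level_step (m d M tau rho : R) : 0 <= m -> 0 < d -> 0 < tau -> 0 < rho ->
  (leb2R (super m) <= M%:E)%E ->
  (leb2R (super (m + d)) <= (2 / d * (2 * rho + M / tau + tau / f rho) * K * M)%:E)%E.
Proof.
move=> m0 d0 tau0 rho0 hM; have hG := trunc_smooth m0 d0.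
have hc1 := inW0_2_1 wf oO bO (inW0_comp wf oO bO hw hG).
have ms := measurable_super m; have msd := measurable_super (m + d).
have sub : super (m + d) `<=` super m by move=> z [Oz h]; split => //; apply: lt_trans h; rewrite ltrDl.
have subO : super m `<=` O by move=> z [].
have M0 : 0 <= M by rewrite -lee_fin (le_trans _ hM).
set th := 2 * rho + _ + _.
have th0 : 0 <= th.
  have f0 := degenerate_weight_ge0 rho wf.
  by rewrite /th !addr_ge0// ?divr_ge0// ?mulr_ge0// ltW.
have S := sobolev_inW0 wf oO bO hc1 ms subO hM tau0 rho0.
have en := energy_bound m0 d0.
(* The truncation is at least [d / 2] above the level [m + d], while the Sobolev inequality is
   applied on the larger set [super m]. *)
have h1 : ((d / 2)%:E * leb2R (super (m + d)) <= th%:E * (K%:E * M%:E))%E.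
  apply: (@le_trans _ _ (\int[leb2R]_(z in super m) `|trunc_fun m d (w z)|%:E)%E); last first.
    apply: le_trans S _; apply: lee_wpmul2l; first by rewrite lee_fin.
    by apply: le_trans en _; apply: lee_wpmul2l => //; rewrite lee_fin ltW.
  have [mw _] := inW_measurable hw.1; have [_ _ _ _ [mG _]] := hG.
  have mGw : measurable_fun (O : set plane) (fun z => `|trunc_fun m d (w z)|%:E).
    by apply/measurable_EFinP; apply: measurableT_comp => //; exact: measurableT_comp mG mw.
  rewrite -integral_cst//.
  apply: (@le_trans _ _ (\int[leb2R]_(z in super (m + d)) `|trunc_fun m d (w z)|%:E)%E).
    apply: ge0_le_integral => //.
    - by move=> z _; rewrite lee_fin divr_ge0// ltW.
    - by apply: (measurable_funS mO _ mGw); exact: subset_trans subO.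
    - move=> z [_ h]; rewrite lee_fin ger0_norm; last exact: trunc_fun_ge0.
      by apply: trunc_fun_high => //; exact: ltW.
  by apply: ge0_subset_integral => //; apply: (measurable_funS mO _ mGw).
have d20 : 0 < d / 2 by rewrite divr_gt0.
rewrite -(lee_pmul2l _ (_ : 0 < (d / 2)%:E)%E) ?lte_fin//.
apply: le_trans h1 _; rewrite -!EFinM lee_fin le_eqVlt; apply/orP; left; apply/eqP.
by field; rewrite gt_eqF.
Qed.

End Energy.

(** * Lower bound of the profile and the iteration over levels *)

Section Profile.
Context {R : realType}.
Implicit Types (f : R -> R) (s a L y : R) (k n j : nat).

(** As long as an iterate is positive, a further logarithm decreases it; at a nonpositive argument
    [ln] takes the default value [0], which is below [ln y] as well. *)
Lemma iter_ln_le k y : 1 <= ln y -> iter k.+1 (@ln R) y <= ln y.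
Proof.
move=> L1; elim: k => [//|k IH]; rewrite iterS; set a := iter k.+1 _ y in IH *.
have [a0|a0] := ltP 0 a; first by apply: le_trans IH; rewrite ltW// ln_sublinear.
by rewrite ln0//; exact: le_trans L1.
Qed.

(** A negative base has the default power [1], which is why [1 <= L] is asked; an iterated logarithm
    can indeed be negative. *)
Lemma powR_le_max a L s : 0 < s -> 1 <= L -> a <= L -> a `^ s <= L `^ s.
Proof.
move=> s0 L1 aL; have L0 : 0 <= L by exact: le_trans L1.
have [a0|a0] := leP 0 a; first by apply: ge0_ler_powR => //; exact: ltW.
have one : (1 : R) `^ s = 1 by rewrite powR1.
by rewrite lt0_powR1// -one; apply: ge0_ler_powR => //; exact: ltW.
Qed.

Lemma pow_le_expR n L : (0 < n)%N -> 16 * n%:R ^+ 2 <= L -> L ^+ n <= expR (L / 2).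
Proof.
move=> n0 Ln; have np : 0 < (n%:R : R) by rewrite ltr0n.
have L0 : 0 < L by apply: lt_le_trans Ln; rewrite mulr_gt0// exprn_gt0.
(* Thus [expR (L / 2)] is the [n]-th power of [expR (L / (4 * n)) ^+ 2], which is at least
   [(L / (4 * n)) ^+ 2], and this is at least [L] when [L >= 16 * n ^+ 2]. *)
have -> : L / 2 = (2 * n)%N%:R * (L / (4 * n%:R)).
  by rewrite natrM; field; rewrite gt_eqF.
rewrite expRM_natl exprM; apply: lerXn2r; first by rewrite nnegrE ltW.
  by rewrite nnegrE exprn_ge0 ?expR_ge0.
apply: (@le_trans _ _ ((L / (4 * n%:R)) ^+ 2)).
  rewrite expr_div_n ler_pdivlMr; last by rewrite exprn_gt0// mulr_gt0.
  rewrite [leRHS]expr2 ler_pM2l//; apply: le_trans Ln; rewrite exprMn; lra.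
rewrite ler_sqr ?nnegrE ?expR_ge0//; last by rewrite ltW// divr_gt0// mulr_gt0.
by apply: le_trans (expR_ge1Dx _); rewrite lerDr.
Qed.

(** At [r = j ^ (-2)] put [L = ln (1 / r)], so that [j = expR (L / 2)]. Iterated logarithms are at
    most [L], hence the exponent is at most [L ^ (1 + s)], and a power of [L] is eventually
    dominated by [expR (L / 2)]. *)
Lemma profile_lower k s f : (0 < k)%N -> 0 < s -> degenerate_profile k s f ->
  exists2 N, (0 < N)%N & forall j, (N <= j)%N -> expR (- j%:R) <= f (j%:R ^- 2).
Proof.
case: k => // k _ s0 [_ _ near_f _ _].
have /nbhs_ballP[e/= e0 he] : nbhs (0 : R) [set x : R | x != 0 -> f x = f_ks k.+1 s `|x|] by exact: near_f.
pose n := (Num.truncn (1 + s)).+1.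
have ns : 1 + s <= n%:R by rewrite ltW// truncnS_gt.
(* The first summand brings [j ^ (-2)] into the neighbourhood where [f] equals its germ; the second
   forces [ln j >= 8 * n ^ 2], that is [L >= 16 * n ^ 2]. *)
pose N := ((Num.truncn e^-1).+1 + (Num.truncn (expR (8 * n%:R ^+ 2 : R))).+1)%N.
exists N => // j Nj.
have j1 : e^-1 < j%:R.
  apply: (lt_le_trans (truncnS_gt e^-1)); rewrite ler_nat (leq_trans _ Nj)// leq_addr//.
have j2 : expR (8 * n%:R ^+ 2) < j%:R :> R.
  apply: (lt_le_trans (truncnS_gt (expR (8 * n%:R ^+ 2)))); rewrite ler_nat (leq_trans _ Nj)// leq_addl//.
have j0 : 0 < (j%:R : R) by apply: lt_trans j2; exact: expR_gt0.
have jge1 : 1 <= (j%:R : R) by rewrite ler1n -(ltr_nat R).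
pose L := ln (j%:R ^+ 2 : R).
have LE : L / 2 = ln (j%:R : R) by rewrite /L lnXn// mulr2n; lra.
have jE : expR (L / 2) = j%:R by rewrite LE lnK// posrE.
have L16 : 16 * n%:R ^+ 2 <= L.
  have : 8 * n%:R ^+ 2 <= ln (j%:R : R) by rewrite -ler_expR lnK ?posrE// ltW.
  by rewrite -LE; lra.
have n1 : 1 <= (n%:R : R) by rewrite ler1n.
have n21 : 1 <= (n%:R ^+ 2 : R) by rewrite exprn_ege1.
have L1 : 1 <= L by apply: le_trans L16; lra.
have r0 : 0 < (j%:R ^- 2 : R) by rewrite invr_gt0 exprn_gt0.
have re : j%:R ^- 2 < e.
  rewrite invf_plt ?posrE ?exprn_gt0//; apply: lt_le_trans j1 _.
  by rewrite expr2 ler_peMl// ltW.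
have -> : f (j%:R ^- 2) = f_ks k.+1 s (j%:R ^- 2).
  rewrite he ?gt_eqF ?(gtr0_norm r0)//.
  by rewrite /ball/= sub0r normrN gtr0_norm.
rewrite /f_ks invrK -/L ler_expR lerN2 -[leRHS]jE.
apply: le_trans (pow_le_expR _ L16) => //.
have h := powR_le_max s0 L1 (iter_ln_le k L1).
apply: (@le_trans _ _ (L * L `^ s)); first by rewrite ler_wpM2l// (le_trans _ L1).
have L0 : 0 < L by exact: lt_le_trans L1.
rewrite -{1}(powRr1 (ltW L0)) -powRD; last by rewrite (gt_eqF L0) implybT.
by rewrite -powR_mulrn ?(ltW L0)//; apply: ler_powR.
Qed.

(* With tau_j = e^(-2j) and rho_j = (j + N)^-2 the Sobolev constant of a set of measure at most
   M e^(-4j) is O(1/(j+1)(j+2)), like the gap between the levels D j / (j+1) and D (j+1) / (j+2). *)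
Lemma degiorgi_constant f (N j : nat) (M : R) : (0 < N)%N -> 0 <= M ->
  (forall i, (N <= i)%N -> expR (- i%:R) <= f (i%:R ^- 2)) ->
  2 * (j + N)%N%:R ^- 2 + M * expR (- 4 * j%:R) / expR (- 2 * j%:R)
    + expR (- 2 * j%:R) / f ((j + N)%N%:R ^- 2) <=
  (4 + 4 * M + 4 * expR N%:R) / (j.+1%:R * j.+2%:R).
Proof.
move=> N0 M0 hf.
set q := j.+1%:R * j.+2%:R.
have jp : 0 <= (j%:R : R) by [].
have q0 : 0 < q by rewrite mulr_gt0.
have qE : q = (j%:R + 1) * (j%:R + 2) by rewrite /q -[j.+2]addn2 -[j.+1]addn1 !natrD.
(* [expR j] is the square of [expR (j / 2) >= 1 + j / 2], and [4 * (1 + j / 2) ^ 2 = (j + 2) ^ 2] is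
   at least [(j + 1) * (j + 2)]. *)
have ej : expR (- j%:R) <= 4 / q.
  rewrite expRN -[leRHS]invrK lef_pV2 ?posrE ?expR_gt0 ?invr_gt0 ?divr_gt0//.
  rewrite invf_div ler_pdivrMr//.
  have -> : expR j%:R = expR (j%:R / 2) ^+ 2 :> R by rewrite -expRM_natl; congr expR; field.
  have h := expR_ge1Dx (j%:R / 2 : R).
  rewrite -(ler_sqr (x := 1 + _)) ?nnegrE ?expR_ge0 ?addr_ge0 ?divr_ge0// in h.
  apply: (@le_trans _ _ ((1 + j%:R / 2) ^+ 2 * 4)); last by rewrite ler_wpM2r.
  by rewrite qE; move: jp; move: (j%:R : R) => x x0; nra.
have A : 2 * (j + N)%N%:R ^- 2 <= 4 / q.
  rewrite ler_pdivlMr// mulrAC ler_pdivrMr; last by rewrite exprn_gt0// ltr0n ltn_addl.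
  have : (j%:R + 1 : R) <= (j + N)%N%:R by rewrite natr1 ler_nat -addn1 leq_add2l.
  rewrite qE; move: jp; move: (j%:R : R) ((j + N)%N%:R : R) => x y x0 xy.
  by have := @ler_pM _ (x + 1) y (x + 1) y ltac:(lra) ltac:(lra) xy xy; nra.
have B : M * expR (- 4 * j%:R) / expR (- 2 * j%:R) <= 4 * M / q.
  rewrite -expRN -mulrA -expRD mulrC -[4 * M]mulrC -mulrA mulrC; apply: ler_wpM2l => //.
  by apply: le_trans ej; rewrite ler_expR; lra.
have C : expR (- 2 * j%:R) / f ((j + N)%N%:R ^- 2) <= 4 * expR N%:R / q.
  have fj := hf (j + N)%N (leq_addl _ _).
  have f0 := lt_le_trans (expR_gt0 _) fj.
  apply: (@le_trans _ _ (expR (- 2 * j%:R) / expR (- (j + N)%N%:R))).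
    by rewrite ler_wpM2l ?expR_ge0// lef_pV2 ?posrE// expR_gt0.
  rewrite -expRN -expRD mulrAC [4 / q * _]mulrC.
  have -> : - 2 * j%:R + - - (j + N)%N%:R = N%:R + - j%:R :> R by rewrite natrD; ring.
  by rewrite expRD ler_wpM2l// expR_ge0.
have -> : (4 + 4 * M + 4 * expR N%:R) / q = 4 / q + 4 * M / q + 4 * expR N%:R / q by rewrite -!mulrDl.
exact: lerD (lerD A B) C.
Qed.

Lemma degiorgi_iteration f (N : nat) (M K : R) (S : R -> \bar R) : (0 < N)%N -> 0 <= M -> 0 < K ->
  (forall i, (N <= i)%N -> expR (- i%:R) <= f (i%:R ^- 2)) ->
  (forall m, 0 <= S m)%E -> (forall m m', (m <= m')%R -> S m' <= S m)%E -> (S 0%R <= M%:E)%E ->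
  (forall m d M' tau rho, 0 <= m -> 0 < d -> 0 < tau -> 0 < rho -> (S m <= M'%:E)%E ->
     (S (m + d)%R <= (2 / d * (2 * rho + M' / tau + tau / f rho) * K * M')%:E)%E) ->
  S (2 * expR 4 * (4 + 4 * M + 4 * expR N%:R) * K) = 0%E.
Proof.
move=> N0 M0 K0 hf S0 Smono SM step.
(* [D] is tuned so that [2 * Ct * K / D = expR (- 4)]. The factor [q] in the level gap [D / q]
   cancels the one in the Sobolev constant [Ct / q], so each step gains exactly the factor
   [expR (- 4)]. *)
set Ct := 4 + _ + _; set D := 2 * expR 4 * Ct * K.
have Ct0 : 0 < Ct by have := expR_gt0 (N%:R : R); rewrite /Ct; lra.
have D0 : 0 < D by rewrite /D !mulr_gt0// expR_gt0.
have decay j : (S (D * (j%:R / j.+1%:R))%R <= (M * expR (- 4 * j%:R))%:E)%E.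
  elim: j => [|j IH]; first by rewrite mul0r !mulr0 expR0 mulr1.
  set q : R := j.+1%:R * j.+2%:R.
  have q0 : 0 < q by rewrite mulr_gt0.
  have E : D * (j.+1%:R / j.+2%:R) = D * (j%:R / j.+1%:R) + D / q.
    rewrite /q -[j.+2]addn2 -[j.+1]addn1 !natrD; field.
    by rewrite !gt_eqF// ltr_wpDl.
  have lev0 : 0 <= D * (j%:R / j.+1%:R) by apply: mulr_ge0; [exact: ltW|exact: divr_ge0].
  have Dq : 0 < D / q by rewrite divr_gt0.
  have rho0 : 0 < ((j + N)%N%:R ^- 2 : R) by rewrite invr_gt0 exprn_gt0// ltr0n ltn_addl.
  have := step _ _ _ (expR (- 2 * j%:R)) _ lev0 Dq (expR_gt0 _) rho0 IH.
  rewrite -E => /le_trans; apply; rewrite lee_fin.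
  have th := degiorgi_constant j N0 M0 hf; rewrite -/Ct -/q in th.
  set th0 := 2 * _ ^- 2 + _ + _ in th *.
  have P0 : 0 <= M * expR (- 4 * j%:R) by rewrite mulr_ge0 ?expR_ge0.
  apply: (@le_trans _ _ (2 / (D / q) * (Ct / q) * K * (M * expR (- 4 * j%:R)))).
    apply: ler_wpM2r => //; apply: ler_wpM2r; first exact: ltW.
    by apply: ler_wpM2l => //; apply: divr_ge0 => //; exact: ltW.
  have -> : - 4 * j.+1%:R = - 4 * j%:R + - 4 :> R by rewrite -natr1; ring.
  rewrite expRD expRN le_eqVlt; apply/orP; left; apply/eqP; rewrite /D; field.
  by rewrite !gt_eqF ?expR_gt0.
have le j : (S D <= (M * expR (- 4 * j%:R))%:E)%E.
  apply: le_trans (decay j); apply: Smono; rewrite ler_piMr ?(ltW D0)// ler_pdivrMr// mul1r ler_nat//.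
apply/eqP; rewrite eq_le S0 andbT; apply/lee_addgt0Pr => e e0; rewrite add0e.
have [j hj] : exists j : nat, M * expR (- 4 * j%:R) <= e.
  pose j := (Num.truncn (M / e)).+1; exists j.
  have h1 : M / e < j%:R by exact: truncnS_gt.
  have j0 : 0 < (j%:R : R) by rewrite ltr0n.
  have h2 : expR (- 4 * j%:R) <= (j%:R : R)^-1.
    rewrite mulNr expRN lef_pV2 ?posrE ?expR_gt0//.
    by apply: le_trans (expR_ge1Dx _); lra.
  apply: (@le_trans _ _ (M * j%:R^-1)); first exact: ler_wpM2l.
  rewrite ler_pdivrMr//; move: h1; rewrite ltr_pdivrMr// mulrC; exact: ltW.
by apply: le_trans (le j) _; rewrite lee_fin.
Qed.

End Profile.

(** * Nonnegativity of the admissibility norm and the maximum principle *)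

Section Supremum.
Context {R : realType}.
Local Notation mu := (@lebesgue_measure R).
Local Notation leb2R := ((@lebesgue_measure R) \x (@lebesgue_measure R))%E.
Local Notation plane := (measurableTypeR R * measurableTypeR R)%type.

Lemma inW0_zero (f : R -> R) (O : set (R * R)) : degenerate_weight f -> open O -> bounded_set O ->
  inW0 1 f O (cst 0) (cst 0).
Proof.
move=> wf oO bO.
have W0 (v : R * R -> R) (g : R * R -> 'cV[R]_2) : (forall z, v z = 0) -> (forall z, g z = 0) ->
    Wint 1 f O v g = 0%E.
  move=> v0 g0; apply: integral0_eq => z _; rewrite v0 !expr1 normr0 add0r.
  have -> : nablaA f g z = 0 by apply/matrixP => i j; rewrite !mxE g0 !mxE mulr0; case: ifP.
  by rewrite -(scale0r (0 : 'cV[R]_2)) enormZ normr0 mul0r.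
have mc (c : R) : measurable_fun (O : set plane) (cst c) by exact: measurable_cst.
have W : inW 1 f O (cst 0) (cst 0).
  split.
  - exact (mc 0).
  - by move=> i; exact (mc ((0 : 'cV[R]_2) i 0)).
  - exact: weak_gradient_cst.
  - by apply/Wnorm_lty => //; rewrite W0.
split => // e e0; exists (cst 0), (cst 0); split => //; last first.
  apply/(Wnorm_lt f O _ _ _ e0) => //; rewrite W0 ?lte_fin ?expr1// => z; rewrite subrr//.
have E : closure [set z : R * R | (cst 0 z : R) != 0] = set0.
  rewrite -[RHS](closure0); congr closure.
  by apply/seteqP; split => z //=; rewrite eqxx.
split; last by rewrite /compactly_supported E; split => //; exact: compact0.
by exists 0; split => // M M0 z _ /=; rewrite subrr normr0 mulr_ge0// ltW.
Qed.

(** The zero function is a competitor in the supremum and its quotient is nonnegative. Together with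
    admissibility this makes the norm a nonnegative real number. *)
Lemma Xnorm_ge0 (f : R -> R) (O : set (R * R)) (phi : R * R -> R) :
  degenerate_weight f -> open O -> bounded_set O -> (0 <= Xnorm f O phi)%E.
Proof.
move=> wf oO bO; pose a := (\int[leb2R]_(z in O) `|cst (0 : R) z * phi z|%:E)%E.
pose b := (\int[leb2R]_(z in O) (enorm (nablaA f (cst 0) z))%:E)%E.
apply: (@le_trans _ _ (a / b)%E).
  apply: mule_ge0; first by apply: integral_ge0 => z _; rewrite lee_fin.
  by rewrite inve_ge0; apply: integral_ge0 => z _; rewrite lee_fin enorm_ge0.
by apply: ereal_sup_ubound; exists (cst 0), (cst 0); split => //; exact: inW0_zero.
Qed.

End Supremum.

Theorem theorem17 (R : realType) (k : nat) (sigma : R) (f : R -> R)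
  (O : set (R * R)) (cA : R * R -> R -> 'M[R]_2) (c0 C0 : R)
  (hsigma : 0 < sigma)
  (hf : degenerate_profile k sigma f)
  (hO : bounded_domain O)
  (hpsd : forall (z : R * R) (s : R), O z -> psd (cA z s))
  (hc0 : 0 < c0) (hC0 : 0 < C0)
  (hell : A_elliptic f O c0 C0 cA)
  (hks : (1 <= k)%N /\ 0 < sigma < 1 \/ (2 <= k)%N /\ 0 < sigma) :
  exists C : R, forall phi u : R * R -> R,
    L2loc O phi -> admissible f O phi -> weak_subsolution f O cA phi u ->
    (ess_sup_on O u <= bdry_sup f O u + C%:E * Xnorm f O phi)%E.
Proof.
have wf := profile_weight hf; have [_ oO _ bO] := hO.
have k0 : (0 < k)%N by case: hks => -[]; case: (k).
have [N N0 hN] := profile_lower k0 hsigma hf.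
have Ooo := bounded_lebesgue oO bO.
pose M := fine ((lebesgue_measure \x lebesgue_measure)%E O : \bar R).
have M0 : 0 <= M by exact: fine_ge0.
pose Ct := 2 * expR 4 * (4 + 4 * M + 4 * expR N%:R) : R.
have Ct0 : 0 < Ct.
  rewrite /Ct; apply: mulr_gt0; first by rewrite mulr_gt0 ?expR_gt0.
  by have := expR_gt0 (N%:R : R); lra.
exists (Ct / c0) => phi u _ hadm [gu [hu hsub]].
have X0 := Xnorm_ge0 phi wf oO bO; move: hadm; rewrite /admissible.
case XE : (Xnorm f O phi) X0 => [X| |] // X0 _; rewrite lee_fin in X0.
(* The boundary supremum is an infimum, so the estimate is proved for each admissible level [l],
   with an error [e]; without admissible levels the right side is [+oo]. *)
rewrite -EFinM -leeBlDr//; apply: le_ereal_inf_tmp => _ [l [g hg] <-].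
rewrite leeBlDr// -EFinD; apply/lee_addgt0Pr => e e0; rewrite -EFinD.
(* [e / Ct] keeps [K] positive when [X = 0] and contributes exactly [e] to the final level
   [Ct * K]. *)
pose K := X / c0 + e / Ct.
have K0 : 0 < K by apply: ltr_wpDl; [rewrite divr_ge0// ltW|rewrite divr_gt0].
have XK : X <= c0 * K.
  rewrite /K mulrDr mulrCA divff ?gt_eqF// mulr1 lerDl mulr_ge0 ?ltW// divr_gt0//.
have D0 : Ct * K = Ct / c0 * X + e by rewrite /K; field; rewrite !gt_eqF.
have hX : (Xnorm f O phi <= X%:E)%E by rewrite XE.
pose S m := (lebesgue_measure \x lebesgue_measure)%E
  [set z : R * R | O z /\ m < Num.max (u z - l) 0] : \bar R.
have mS m : measurable ([set z : R * R | O z /\ m < Num.max (u z - l) 0] : set (measurableTypeR R * measurableTypeR R)).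
  exact: (measurable_super oO hg).
have null : S (Ct * K) = 0%E.
  apply: (degiorgi_iteration (f := f) N0 M0 K0 hN).
  - by move=> m; exact: measure_ge0.
  - move=> m m' mm; apply: le_measure; rewrite ?inE//.
    by move=> z [Oz h]; split => //; exact: le_lt_trans h.
  - rewrite /M fineK ?ge0_fin_numE//; apply: le_measure; rewrite ?inE//; first exact: open_measurable2.
    by move=> z [].
  - move=> m d M' tau rho m0 d0 tau0 rho0 hM.
    exact: (level_step wf oO bO hu hg hc0 hell hX K0 XK hsub).
(* The exceptional set is the top level set, just shown to be null; outside [O] the patched function
   is [-oo] and the bound is automatic. *)
apply/ess_supP; exists [set z : R * R | O z /\ Ct * K < Num.max (u z - l) 0]; split => //.
move=> z /= h; apply: contrapT => n; apply: h; rewrite /patch; case: ifPn => [/set_mem Oz|_]; last exact: leNye.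
rewrite /= lee_fin leNgt; apply/negP => lt; apply: n; split => //.
by rewrite lt_max D0 ltrBrDl addrA lt.
Qed.
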